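(* Let $\Lambda$ be an extremal odd unimodular lattice of dimension $n\geq 10$, i.e. (by the known classification) one of the lattices $D_{12}^+$, $(E_7^2)^+$, $A_{15}^+$, $O_{23}$, of dimensions $12,14,15,23$ respectively. Then the maximum of the secrecy function $\Xi_\Lambda$ is achieved at $\tau=i$, and the secrecy gains are $$\chi_{D_{12}^+}=\frac{8}{5},\qquad \chi_{(E_7^2)^+}=\frac{16}{9},\qquad \chi_{A_{15}^+}=\frac{32}{17},\qquad \chi_{O_{23}}=\frac{32}{9}.$$
   Context: A lattice $\Lambda\subset\mathbb{R}^n$ of dimension $n$ is unimodular if it equals its dual $\Lambda^*=\{\mathbf{x}\in\mathbb{R}^n:\mathbf{x}\cdot\lambda\in\mathbb{Z}\ \text{for all } \lambda\in\Lambda\}$. The norm of a vector is its squared length $\mathbf{x}\cdot\mathbf{x}$. A unimodular lattice is even if all its vectors have even norm, and odd otherwise. A lattice of dimension $n$ is called extremal if its minimal nonzero norm is $\lfloor n/8\rfloor+1$. By the known classification (Conway–Sloane), the extremal odd unimodular lattices in dimension $n\ge 10$ are, up to isometry: $D_{12}^+$, the unique unimodular lattice of dimension 12 with no vectors of norm 1 (explicitly $D_{12}\cup(D_{12}+(\frac12,\dots,\frac12))$); $(E_7^2)^+$, the unique unimodular lattice of dimension 14 with no vectors of norm 1 (its norm-2 vectors generate $E_7\oplus E_7$); $A_{15}^+$, the unique unimodular lattice of dimension 15 with no vectors of norm 1 (its norm-2 vectors generate $A_{15}$); and $O_{23}$, the shorter Leech lattice, the unique unimodular lattice of dimension 23 with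 no vectors of norm 1 or 2. For $\tau$ in the upper half plane let $q=e^{\pi i\tau}$, $\Theta_\Lambda(\tau)=\sum_{\lambda\in\Lambda}q^{\lambda\cdot\lambda}$ and $\vartheta_3(\tau)=\Theta_{\mathbb{Z}}(\tau)=\sum_{m\in\mathbb{Z}}q^{m^2}$. The secrecy function of an $n$-dimensional unimodular lattice is $\Xi_\Lambda(\tau)=\vartheta_3^n(\tau)/\Theta_\Lambda(\tau)$, considered for $\tau=yi$ with $y>0$, and the secrecy gain $\chi_\Lambda$ is the maximal value of $\Xi_\Lambda(yi)$ over $y>0$. *)

(* Defs.v *)
From HB Require Import structures.
From mathcomp Require Import all_boot all_order all_algebra.
From mathcomp Require Import all_classical all_reals all_analysis.

Set Implicit Arguments.
Unset Strict Implicit.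
Unset Printing Implicit Defensive.

Import Order.TTheory GRing.Theory Num.Theory.
Import numFieldNormedType.Exports.

Local Open Scope classical_set_scope.
Local Open Scope ring_scope.

Section Lattices.
Context {R : realType} {n : nat}.
Implicit Types (x y : 'rV[R]_n) (L : set 'rV[R]_n).

Definition dotp x y : R := \sum_i x 0 i * y 0 i.

(* The norm of a vector is its squared length. *)
Definition sqnorm x : R := dotp x x.

(* A lattice of dimension n: the integer span of the rows of an invertible
   matrix, i.e. of a basis of R^n. *)
Definition is_lattice L : Prop :=
  exists2 B : 'M[R]_n, B \in unitmx &
    L = [set map_mx intr z *m B | z in [set: 'rV[int]_n]].

Definition dual_lattice L : set 'rV[R]_n :=
  [set x | forall l, L l -> dotp x l \is a Num.int].

Definition unimodular L : Prop := is_lattice L /\ L = dual_lattice L.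

Definition all_norms_even L : Prop :=
  forall x, L x -> exists k : int, sqnorm x = 2 * k%:~R.

Definition odd_unimodular L : Prop := unimodular L /\ ~ all_norms_even L.

Definition is_min_norm L (m : R) : Prop :=
  (exists x, [/\ L x, x != 0 & sqnorm x = m]) /\
  (forall x, L x -> x != 0 -> m <= sqnorm x).

Definition extremal L : Prop := is_min_norm L (n %/ 8).+1%:R.

Definition no_vector_of_norm L (m : R) : Prop :=
  forall x, L x -> sqnorm x != m.

(* D_n : integer vectors with even coordinate sum. *)
Definition D_lattice : set 'rV[R]_n :=
  [set x | (forall i, x 0 i \is a Num.int) /\
           exists k : int, \sum_i x 0 i = 2 * k%:~R].

Definition D_plus : set 'rV[R]_n :=
  D_lattice `|` [set x + const_mx 2^-1 | x in D_lattice].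

End Lattices.

Arguments D_lattice : clear implicits.
Arguments D_plus : clear implicits.

Section NamedLattices.
Context {R : realType}.

(* By the Conway-Sloane classification, each of the following predicates holds
   of exactly one lattice up to isometry. *)
Definition is_D12_plus (L : set 'rV[R]_12) : Prop :=
  unimodular L /\ no_vector_of_norm L 1.

Definition is_E7E7_plus (L : set 'rV[R]_14) : Prop :=
  unimodular L /\ no_vector_of_norm L 1.

Definition is_A15_plus (L : set 'rV[R]_15) : Prop :=
  unimodular L /\ no_vector_of_norm L 1.

Definition is_O23 (L : set 'rV[R]_23) : Prop :=
  [/\ unimodular L, no_vector_of_norm L 1 & no_vector_of_norm L 2].

End NamedLattices.

Section Secrecy.
Context {R : realType}.

(* The value of q = exp (pi i tau) at tau = y i.  All functions of tau below are
   written as functions of y > 0, where tau = y i; so tau = i is y = 1. *)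
Definition nome (y : R) : R := expR (- (pi * y)).

(* The terms are nonnegative, so the sum over L is an esum in \bar R; [fine]
   returns its real value, the sum being finite for a lattice and y > 0. *)
Definition theta (n : nat) (L : set 'rV[R]_n) (y : R) : R :=
  fine (\esum_(x in L) (nome y `^ sqnorm x)%:E).

Definition theta3 (y : R) : R :=
  fine (\esum_(m in [set: int]) (nome y `^ (m%:~R ^+ 2))%:E).

Definition secrecy (n : nat) (L : set 'rV[R]_n) (y : R) : R :=
  theta3 y ^+ n / theta L y.

Definition secrecy_max_at (n : nat) (L : set 'rV[R]_n) (y0 : R) : Prop :=
  0 < y0 /\ forall y : R, 0 < y -> secrecy L y <= secrecy L y0.

(* chi is the maximal (attained) value of the secrecy function. *)
Definition is_secrecy_gain (n : nat) (L : set 'rV[R]_n) (chi : R) : Prop :=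
  (exists2 y : R, 0 < y & secrecy L y = chi) /\
  (forall y : R, 0 < y -> secrecy L y <= chi).

End Secrecy.

(* Main.v *)
(* Idea.  Put q = exp(-pi y), and let phi(q) be the sum of the q^(m^2) over all integers m, so that
   theta_3 = phi(q), and psi(q) the sum of the q^(m(m+1)/2) over m >= 0.
   For a unimodular lattice L of dimension n the quotient F = theta_L / phi^n is invariant under
   y -> 1/y by Poisson summation, and its value at -q is the quotient of the theta series of the
   shadow of L by a power of theta_2.  The function z = q psi(q^2)^4 phi(-q)^4 / phi(q)^8 is
   invariant too.  If P is the polynomial of degree n/8 in z that agrees with F to the highest
   order at q = 0, then (F - P)^16 / z^(2n+1) is holomorphic, invariant and zero at both cusps.
   A maximum principle on the half-plane makes it 0, hence F = P.  By Lagrange inversion the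
   coefficients of P are residues of explicit series; when L has no vectors of norm 1, ..., n/8 they
   depend on n only.  For 8 <= n <= 23 they are nonpositive from degree 1 on, so 1/F is an
   increasing function of z, and 0 <= z <= 1/64 with equality on the right at y = 1.  For n >= 24
   the resulting shadow theta series has a negative or a non-integral coefficient, except for n = 24,
   where its constant term is 1 and L is even. *)

Require Import Defs.
From HB Require Import structures.
From mathcomp Require Import all_boot all_order all_algebra.
From mathcomp Require Import all_classical all_reals all_analysis.
From mathcomp Require Import complex zify ring lra.

Set Implicit Arguments.
Unset Strict Implicit.
Unset Printing Implicit Defensive.

Import Order.TTheory GRing.Theory Num.Theory.
Import numFieldNormedType.Exports.
Import Normc.

Local Open Scope classical_set_scope.
Local Open Scope ring_scope.

(** * Absolutely summable families *)

(** No general theory of holomorphic functions is used: a function on the half-plane is a real power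
    series converging on the unit disc, evaluated at [exp (i k tau)]. Cauchy's estimate comes from
    averaging over roots of unity, Schwarz's lemma from applying it to all powers of a series, and
    the Cayley transform carries an identity from the imaginary axis to the half-plane. The theta
    group has two cusps and is not the full modular group. A function therefore travels together
    with two conjugates, and [tau + 1] and [-1/tau] permute the three, so that the usual reduction
    to [|x| <= 1/2] and inversion suffices. Division by z and by powers of phi needs phi and psi to
    have no zeros in the disc. In place of product formulas, functional equations relating [q] to
    [q^2] bound the coefficients of the inverse series; the same equations show that certain series
    have nonnegative coefficients, and all sign statements about the residues rest on this. The
    constant in Poisson summation is found without Stirling's formula, by comparing two limits of
    one and the same sequence. *)

Section Summation.
Context {R : realType}.

Definition nnsum (T : choiceType) (f : T -> R) : \bar R :=
  \esum_(t in [set: T]) (f t)%:E.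

Definition asummable (T : choiceType) (f : T -> R) : Prop :=
  (nnsum (fun t => `|f t|%R) < +oo)%E.

(** [fine] sends an infinite sum to 0, so the value is meaningful for absolutely summable families
    only; totality keeps the rewriting free of side conditions. *)
Definition tsum (T : choiceType) (f : T -> R) : R :=
  fine (nnsum (fun t => Num.max (f t) 0)) -
  fine (nnsum (fun t => Num.max (- f t) 0)).

Section OneType.
Variable T : choiceType.
Implicit Types f g h : T -> R.

Lemma nnsum_ge0 f : (forall t, 0 <= f t) -> (0 <= nnsum f)%E.
Proof. by move=> f0; apply: esum_ge0 => t _; rewrite lee_fin. Qed.

Lemma nnsum_fin f : (forall t, 0 <= f t) -> asummable f -> nnsum f \is a fin_num.
Proof.
move=> f0 Sf; rewrite ge0_fin_numE ?nnsum_ge0//.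
by move: Sf; rewrite /asummable; under eq_fun do rewrite ger0_norm//.
Qed.

Lemma le_nnsum f g : (forall t, f t <= g t) -> (nnsum f <= nnsum g)%E.
Proof. by move=> fg; apply: le_esum => t _; rewrite lee_fin. Qed.

Lemma nnsumD f g : (forall t, 0 <= f t) -> (forall t, 0 <= g t) ->
  nnsum (fun t => f t + g t) = (nnsum f + nnsum g)%E.
Proof.
by move=> f0 g0; rewrite /nnsum -esumD// => t _; rewrite lee_fin.
Qed.

Lemma asummable_le f g : (forall t, `|f t| <= g t) -> asummable g -> asummable f.
Proof.
move=> fg; apply: le_lt_trans; apply: le_nnsum => t.
by rewrite (le_trans (fg t))// ler_norm.
Qed.

Lemma asummable_norm f : asummable f -> asummable (fun t => `|f t|).
Proof. by apply: le_lt_trans; apply: le_nnsum => t; rewrite normr_id. Qed.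

Lemma asummable_normP f : asummable (fun t => `|f t|) -> asummable f.
Proof. by apply: asummable_le => t. Qed.

Lemma asummableD f g : asummable f -> asummable g -> asummable (fun t => f t + g t).
Proof.
move=> Sf Sg; apply: (@asummable_le _ (fun t => `|f t| + `|g t|)).
  by move=> t; exact: ler_normD.
rewrite /asummable (_ : (fun _ => _) = (fun t => `|f t| + `|g t|)); last first.
  by apply/funext => t; rewrite ger0_norm ?addr_ge0.
by rewrite nnsumD// lte_add_pinfty.
Qed.

Lemma asummableN f : asummable f -> asummable (fun t => - f t).
Proof. by apply: le_lt_trans; apply: le_nnsum => t; rewrite normrN. Qed.

Lemma asummableB f g : asummable f -> asummable g -> asummable (fun t => f t - g t).
Proof. by move=> Sf /asummableN; exact: asummableD. Qed.

(** The parts [g] and [h] may overlap: adding the positive part of [f] to [h] and the negative part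
    to [g] gives the same nonnegative family. This freedom reduces linearity to nonnegative
    families. *)
Lemma tsum_decomp f g h : (forall t, 0 <= g t) -> (forall t, 0 <= h t) ->
  asummable g -> asummable h -> (forall t, f t = g t - h t) ->
  tsum f = fine (nnsum g) - fine (nnsum h).
Proof.
move=> g0 h0 Sg Sh fE.
have m0 (x : R) : 0 <= Num.max x 0 by rewrite le_max lexx orbT.
have Sp : asummable (fun t => Num.max (f t) 0).
  apply: asummable_le Sg => t; rewrite /= ger0_norm ?m0//.
  rewrite ge_max g0 andbT fE.
  by rewrite lerBlDr lerDl.
have Sm : asummable (fun t => Num.max (- f t) 0).
  apply: asummable_le Sh => t; rewrite /= ger0_norm ?m0// ge_max h0 andbT fE.
  by rewrite opprB lerBlDr lerDl.
rewrite /tsum; apply/eqP; rewrite subr_eq addrAC eq_sym subr_eq; apply/eqP.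
rewrite -!fineD ?nnsum_fin// -?nnsumD//.
congr (fine (nnsum _)); apply/funext => t; rewrite fE.
rewrite !maxElt; do 2 case: ifPn; rewrite -?leNgt => *; lra.
Qed.

Lemma tsum_nneg f : (forall t, 0 <= f t) -> tsum f = fine (nnsum f).
Proof.
move=> f0; rewrite /tsum [X in _ - fine X](_ : _ = 0%E); last first.
  by apply: esum1 => t _; rewrite max_r// oppr_le0.
by rewrite subr0; congr (fine (nnsum _)); apply/funext => t; rewrite max_l.
Qed.

Lemma tsumN f : tsum (fun t => - f t) = - tsum f.
Proof.
rewrite /tsum opprB.
by rewrite (_ : (fun t => Num.max (- - f t) 0) = (fun t => Num.max (f t) 0))//;
  apply/funext => t; rewrite opprK.
Qed.

Let ppart f t := Num.max (f t) 0.
Let npart f t := Num.max (- f t) 0.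
Let ppart_ge0 f t : 0 <= ppart f t. Proof. by rewrite le_max lexx orbT. Qed.
Let npart_ge0 f t : 0 <= npart f t. Proof. by rewrite le_max lexx orbT. Qed.
Let partE f t : f t = ppart f t - npart f t.
Proof. rewrite /ppart/npart !maxElt; do 2 case: ifPn; rewrite -?leNgt => *; lra. Qed.
Let part_norm f t : `|f t| = ppart f t + npart f t.
Proof.
rewrite /ppart/npart !maxElt.
by case: (ltrgt0P (f t)) => h; do ?case: ifPn; rewrite -?leNgt => *; lra.
Qed.
Let Sppart f : asummable f -> asummable (ppart f).
Proof.
move=> /asummable_norm; apply: asummable_le => t.
by rewrite ger0_norm// part_norm lerDl.
Qed.
Let Snpart f : asummable f -> asummable (npart f).
Proof.
move=> /asummable_norm; apply: asummable_le => t.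
by rewrite ger0_norm// part_norm lerDr.
Qed.

Lemma tsumD f g : asummable f -> asummable g ->
  tsum (fun t => f t + g t) = tsum f + tsum g.
Proof.
move=> Sf Sg.
rewrite (@tsum_decomp _ (fun t => ppart f t + ppart g t)
                        (fun t => npart f t + npart g t)).
- rewrite !nnsumD// !fineD ?nnsum_fin//; do ?[exact: Sppart|exact: Snpart].
  by rewrite /tsum -/(ppart f) -/(ppart g); ring.
- by move=> t; rewrite addr_ge0.
- by move=> t; rewrite addr_ge0.
- by apply: asummableD; exact: Sppart.
- by apply: asummableD; exact: Snpart.
- by move=> t; rewrite [f t]partE [g t]partE; ring.
Qed.

Lemma tsumB f g : asummable f -> asummable g ->
  tsum (fun t => f t - g t) = tsum f - tsum g.
Proof. by move=> Sf Sg; rewrite tsumD ?tsumN//; exact: asummableN. Qed.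

Lemma tsum_ge0 f : (forall t, 0 <= f t) -> 0 <= tsum f.
Proof. by move=> f0; rewrite tsum_nneg// fine_ge0// nnsum_ge0. Qed.

Lemma le_tsum f g : asummable f -> asummable g -> (forall t, f t <= g t) ->
  tsum f <= tsum g.
Proof.
move=> Sf Sg fg; rewrite -subr_ge0 -tsumB//.
by apply: tsum_ge0 => t; rewrite subr_ge0.
Qed.

Lemma ler_norm_tsum f : asummable f -> `|tsum f| <= tsum (fun t => `|f t|).
Proof.
move=> Sf; have Sn := asummable_norm Sf.
rewrite ler_norml -tsumN; apply/andP; split; apply: le_tsum => //.
- exact: asummableN.
- by move=> t; rewrite lerNl -normrN ler_norm.
- by move=> t; rewrite ler_norm.
Qed.

Lemma eq_tsum f g : (forall t, f t = g t) -> tsum f = tsum g.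
Proof. by move=> /funext->. Qed.

Lemma asummable0 : asummable (fun _ : T => 0).
Proof. by rewrite /asummable /nnsum esum1 ?ltry// => t _; rewrite normr0. Qed.

Lemma tsum0 : tsum (fun _ : T => 0) = 0.
Proof. by rewrite tsum_nneg// /nnsum esum1. Qed.

Let le_nnsumZ (d : R) f : 0 < d -> (forall t, 0 <= f t) ->
  (nnsum (fun t => d * f t)%R <= d%:E * nnsum f)%E.
Proof.
move=> d0 f0; apply: ge_ereal_sup => _ /= [A [finA _] <-].
rewrite (eq_fsbigr (fun i => (d%:E * (f i)%:E)%E))// -?ge0_mule_fsumr//.
rewrite lee_pmul2l//; apply: ereal_sup_ubound; exists A => //.
Qed.

(** The inequality missing from [le_nnsumZ] is that same inequality for [d^-1] and the family
    [d * f]. *)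
Lemma nnsumZ (d : R) f : 0 <= d -> (forall t, 0 <= f t) ->
  nnsum (fun t => d * f t)%R = (d%:E * nnsum f)%E.
Proof.
rewrite le_eqVlt => /predU1P[<-|d0] f0.
  by rewrite mul0e /nnsum esum1// => t _; rewrite mul0r.
apply/eqP; rewrite eq_le le_nnsumZ//=.
rewrite -(@lee_pmul2l _ (d^-1)%:E) ?lte_fin ?invr_gt0//.
rewrite muleA -EFinM mulVf ?gt_eqF// mul1e.
have df0 t : 0 <= d * f t by rewrite mulr_ge0// ltW.
have di0 : 0 < d^-1 by rewrite invr_gt0.
apply: le_trans (le_nnsumZ di0 df0).
rewrite [X in (_ <= nnsum X)%E](_ : _ = f)//.
by apply/funext => t; rewrite mulKf// gt_eqF.
Qed.

Lemma asummableZ (c : R) f : asummable f -> asummable (fun t => c * f t).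
Proof.
rewrite /asummable => Sf.
rewrite [X in nnsum X](_ : _ = (fun t => `|c| * `|f t|)); last first.
  by apply/funext => t; rewrite normrM.
by rewrite nnsumZ// lte_mul_pinfty// fin_numE.
Qed.

Lemma tsumZ (c : R) f : asummable f -> tsum (fun t => c * f t) = c * tsum f.
Proof.
suff H (d : R) : 0 <= d -> forall f, asummable f ->
    tsum (fun t => d * f t) = d * tsum f.
  move=> Sf; have [c0|c0] := leP 0 c; first exact: H.
  have := @H (- c) _ _ Sf; rewrite oppr_ge0 => /(_ (ltW c0)).
  move=> e; apply: oppr_inj; rewrite -tsumN -[RHS]mulNr -e.
  by apply: eq_tsum => t; rewrite mulNr.
move=> d0 g Sg.
rewrite (@tsum_decomp _ (fun t => d * ppart g t) (fun t => d * npart g t)).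
- by rewrite !nnsumZ// !fineM ?nnsum_fin ?mulrBr//; [exact: Snpart|exact: Sppart].
- by move=> t; rewrite mulr_ge0.
- by move=> t; rewrite mulr_ge0.
- by apply: asummableZ; exact: Sppart.
- by apply: asummableZ; exact: Snpart.
- by move=> t; rewrite -mulrBr -partE.
Qed.

Lemma nnsum_seq_le (s : seq T) f : (forall t, 0 <= f t) -> uniq s ->
  ((\sum_(t <- s) f t)%:E <= nnsum f)%E.
Proof.
move=> f0 us; apply: ereal_sup_ubound; exists [set` s] => //=.
by rewrite -(fsbig_seq _ (fun t => (f t)%:E) us) sumEFin.
Qed.

Lemma tsum_seq_le (s : seq T) f : asummable f -> (forall t, 0 <= f t) -> uniq s ->
  \sum_(t <- s) f t <= tsum f.
Proof.
move=> Sf f0 us; rewrite tsum_nneg// -lee_fin fineK ?nnsum_fin//.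
exact: nnsum_seq_le.
Qed.

Lemma tsum_le_seq f (M : R) : (forall t, 0 <= f t) ->
  (forall s : seq T, uniq s -> \sum_(t <- s) f t <= M) ->
  asummable f /\ tsum f <= M.
Proof.
move=> f0 H; have le : (nnsum f <= M%:E)%E.
  apply: ge_ereal_sup => _ /= [A [finA _] <-].
  have [s sE us] : exists2 s : seq T, A = [set` s] & uniq s.
    have /finite_seqP[s' s'E] := finA.
    exists (undup s'); last exact: undup_uniq.
    by rewrite s'E; apply/seteqP; split => x /=; rewrite mem_undup.
  by rewrite sE -(fsbig_seq _ (fun t => (f t)%:E) us) sumEFin lee_fin H.
have Sf : asummable f.
  rewrite /asummable [X in nnsum X](_ : _ = f).
    exact: le_lt_trans le (ltry _).
  by apply/funext => t; rewrite ger0_norm.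
by split=> //; rewrite tsum_nneg// -lee_fin fineK ?nnsum_fin.
Qed.

Lemma tsum_seq (s : seq T) f : uniq s -> (forall t, t \notin s -> f t = 0) ->
  asummable f /\ tsum f = \sum_(t <- s) f t.
Proof.
move=> us f0.
have nn g : (forall t, 0 <= g t) -> (forall t, t \notin s -> g t = 0) ->
    asummable g /\ tsum g = \sum_(t <- s) g t.
  move=> gp g0; have [|Sg le] := @tsum_le_seq g (\sum_(t <- s) g t) gp.
    move=> s' us'; rewrite (bigID (mem s))/= [X in _ + X]big1 ?addr0; last first.
      by move=> t /g0.
    rewrite -big_filter [leRHS](bigID (mem s'))/= ler_wpDr ?sumr_ge0//.
    rewrite -[X in _ <= X]big_filter (perm_big [seq t <- s | t \in s'])//.
    apply: uniq_perm; rewrite ?filter_uniq// => t.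
    by rewrite !mem_filter andbC.
  by split=> //; apply/eqP; rewrite eq_le le tsum_seq_le.
have [|Sp Ep] := @nn (ppart f) (ppart_ge0 f).
  by move=> t /f0 ft; rewrite /ppart ft maxxx.
have [|Sm Em] := @nn (npart f) (npart_ge0 f).
  by move=> t /f0 ft; rewrite /npart ft oppr0 maxxx.
split.
  rewrite (_ : f = (fun t => ppart f t - npart f t)); first exact: asummableB.
  by apply/funext => t; rewrite -partE.
rewrite (@eq_tsum _ (fun t => ppart f t - npart f t)) ?tsumB//.
by rewrite Ep Em -sumrB; apply: eq_bigr => t _; rewrite -partE.
Qed.

Lemma tsum_approx f (e : R) : (forall t, 0 <= f t) -> asummable f -> 0 < e ->
  exists2 s : seq T, uniq s & tsum f - \sum_(t <- s) f t < e.
Proof.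
move=> f0 Sf e0; apply: contrapT => H.
have [] := @tsum_le_seq f (tsum f - e) f0.
  move=> s us; rewrite leNgt; apply/negP => lt; apply: H; exists s => //.
  by rewrite ltrBlDr -ltrBlDl.
by move=> _; rewrite lerBrDr gerDl leNgt e0.
Qed.

End OneType.

Lemma asummable1 (T : choiceType) (t : T) (f : T -> R) :
  (forall u, u != t -> f u = 0) -> asummable f /\ tsum f = f t.
Proof.
move=> f0; have [//|u|Sf ->] := @tsum_seq T [:: t] f; last by rewrite big_seq1.
by rewrite inE => /f0.
Qed.

(** Fubini. The nonnegative case is the iterated [esum]; the signed case follows by splitting [f]
    into [(|f| + f) / 2] and [(|f| - f) / 2]. *)
Lemma tsum_iter (T U : choiceType) (f : T * U -> R) : asummable f ->
  [/\ forall t, asummable (fun u => f (t, u)),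
      asummable (fun t => tsum (fun u => f (t, u))) &
      tsum f = tsum (fun t => tsum (fun u => f (t, u)))].
Proof.
have E (g : T * U -> R) : (forall x, 0 <= g x) ->
    (\esum_(t in [set: T]) nnsum (fun u => g (t, u)) = nnsum g)%E.
  move=> g0; rewrite /nnsum (@esum_esum _ _ _ _ _ (fun t u => (g (t, u))%:E)).
    rewrite (_ : _ `*`` _ = [set: T * U]); last by apply/seteqP; split.
    by apply: eq_esum => -[].
  by move=> *; rewrite lee_fin.
have fib (g : T * U -> R) : asummable g -> forall t, asummable (fun u => g (t, u)).
  move=> Sg t; apply: le_lt_trans Sg; rewrite -E//.
  apply: ereal_sup_ubound; exists [set t]; first by split.
  by rewrite fsbig_set1.
have nnE (g : T * U -> R) : (forall x, 0 <= g x) -> asummable g ->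
    nnsum g = nnsum (fun t => tsum (fun u => g (t, u))).
  move=> g0 Sg; rewrite -E// /nnsum; apply: eq_esum => t _.
  by rewrite tsum_nneg// fineK// nnsum_fin//; exact: fib.
have nn (g : T * U -> R) : (forall x, 0 <= g x) -> asummable g ->
    asummable (fun t => tsum (fun u => g (t, u))) /\
    tsum g = tsum (fun t => tsum (fun u => g (t, u))).
  move=> g0 Sg; have t0 t : 0 <= tsum (fun u => g (t, u)) by rewrite tsum_ge0.
  rewrite !tsum_nneg// nnE//; split=> //; rewrite /asummable.
  rewrite [X in nnsum X](_ : _ = (fun t => tsum (fun u => g (t, u)))).
    by rewrite -nnE// ltey_eq nnsum_fin.
  by apply/funext => t; rewrite ger0_norm.
move=> Sf; split; first exact: fib.
  have [Sn _] := nn (fun x => `|f x|) (fun=> normr_ge0 _) (asummable_norm Sf).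
  by apply: asummable_le Sn => t; apply: ler_norm_tsum; exact: fib.
pose p x := (`|f x| + f x) / 2; pose m x := (`|f x| - f x) / 2.
have p0 x : 0 <= p x by rewrite divr_ge0// -lerBlDr sub0r -normrN ler_norm.
have m0 x : 0 <= m x by rewrite divr_ge0// subr_ge0 ler_norm.
have half (g : T * U -> R) : asummable g -> asummable (fun x => g x / 2).
  by move=> /(@asummableZ _ 2^-1); under eq_fun do rewrite mulrC.
have Sp : asummable p by apply: half; apply: asummableD => //; exact: asummable_norm.
have Sm : asummable m by apply: half; apply: asummableB => //; exact: asummable_norm.
have fE x : f x = p x - m x by rewrite /p /m; field.
rewrite (eq_tsum fE) tsumB// (nn _ p0 Sp).2 (nn _ m0 Sm).2 -tsumB; last first.
- exact: (nn _ m0 Sm).1.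
- exact: (nn _ p0 Sp).1.
by apply: eq_tsum => t; rewrite (eq_tsum (fun u => fE (t, u))) tsumB//; exact: fib.
Qed.

Lemma asummable_iter (T U : choiceType) (f : T * U -> R) :
  (forall t, asummable (fun u => f (t, u))) ->
  asummable (fun t => tsum (fun u => `|f (t, u)|)) -> asummable f.
Proof.
move=> Sf SS; rewrite /asummable /nnsum.
rewrite (_ : [set: T * U] = [set: T] `*`` (fun=> setT)); last by apply/seteqP; split.
rewrite (_ : (fun t : T * U => _) = (fun x => (`|f (x.1, x.2)|%:E))); last first.
  by apply/funext => -[].
rewrite -(@esum_esum _ _ _ _ _ (fun t u => (`|f (t, u)|)%:E))//.
apply: le_lt_trans SS; apply: le_esum => t _.
rewrite -/(nnsum (fun u => `|f (t, u)|)) ger0_norm ?tsum_ge0//.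
by rewrite tsum_nneg// fineK ?nnsum_fin//; exact: asummable_norm.
Qed.

End Summation.

(** * Reindexing, regrouping and dominated convergence *)

Section Reindexing.
Context {R : realType}.

Lemma asummable_inj (T U : choiceType) (e : T -> U) (f : U -> R) :
  injective e -> asummable f -> asummable (f \o e).
Proof.
move=> ie Sf; apply: asummable_normP.
apply: (proj1 (tsum_le_seq (M := tsum (fun u => `|f u|)) _ _)) => // s us.
rewrite -(big_map e xpredT (fun u => `|f u|)).
by apply: tsum_seq_le; [exact: asummable_norm| |rewrite map_inj_uniq].
Qed.

Lemma asummable_inj_supp (T U : choiceType) (e : T -> U) (f : U -> R) :
  injective e -> (forall u, (forall t, e t != u) -> f u = 0) ->
  asummable (f \o e) -> asummable f.
Proof.
move=> ie f0 Sf; apply: asummable_normP.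
apply: (proj1 (tsum_le_seq (M := tsum (fun t => `|f (e t)|)) _ _)) => // s us.
have [s' us' s'E] : exists2 s' : seq T, uniq s' &
    perm_eq [seq u <- s | f u != 0] [seq e t | t <- s'].
  have [s' s'E] : exists s' : seq T,
      [seq u <- s | f u != 0] = [seq e t | t <- s'].
    elim: s {us} => [|u s [s' IH]] /=; first by exists [::].
    case: ifPn => [fu|_]; last by exists s'.
    have [t eu] : exists t, e t = u.
      apply: contrapT => H; move/eqP: fu; apply; apply: f0 => t.
      by apply/eqP => et; apply: H; exists t.
    by exists (t :: s'); rewrite /= eu IH.
  exists s'; last by rewrite s'E.
  by apply: (@map_uniq _ _ e); rewrite -s'E filter_uniq.
rewrite (bigID (fun u => f u != 0))/= [X in _ + X]big1 ?addr0; last first.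
  by move=> u; rewrite negbK => /eqP->; rewrite normr0.
rewrite -big_filter (perm_big _ s'E)/= big_map.
by apply: tsum_seq_le => //; exact: asummable_norm.
Qed.

Lemma tsum_bij (T U : choiceType) (e : T -> U) (f : U -> R) :
  bijective e -> tsum (f \o e) = tsum f.
Proof.
move=> be; have sb : set_bij [set: T] [set: U] e.
  split=> // [x y _ _|u _]; first exact: (bij_inj be).
  by case: be => g _ ge; exists (g u).
by rewrite /tsum /nnsum; congr (fine _ - fine _);
  rewrite (reindex_esum _ _ _ _ sb).
Qed.

Lemma asummable_bij (T U : choiceType) (e : T -> U) (f : U -> R) :
  bijective e -> asummable (f \o e) -> asummable f.
Proof.
move=> be; apply: asummable_inj_supp; first exact: bij_inj.
by case: be => g _ ge u /(_ (g u)); rewrite ge eqxx.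
Qed.

Lemma swap_bij (T U : Type) : bijective (fun x : T * U => (x.2, x.1)).
Proof. by exists (fun x => (x.2, x.1)) => -[]. Qed.

Lemma asummable_swap (T U : choiceType) (f : T * U -> R) :
  asummable f -> asummable (fun x => f (x.2, x.1)).
Proof. by apply: (asummable_inj (e := fun x : U * T => (x.2, x.1))) => -[? ?] [? ?] /= [-> ->]. Qed.

Lemma tsum_exchange (T U : choiceType) (f : T -> U -> R) :
  asummable (fun x : T * U => f x.1 x.2) ->
  tsum (fun t => tsum (f t)) = tsum (fun u => tsum (fun t => f t u)).
Proof.
move=> Sf; have [_ _ /= <-] := tsum_iter Sf.
have [_ _ /= <-] := tsum_iter (asummable_swap Sf).
by rewrite -(tsum_bij (fun x => f x.1 x.2) (swap_bij U T)).
Qed.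

(** Fubini for the family on [T * U] that is supported on the graph of [p]: one order of summation
    gives back [f], the other groups it by the values of [p]. *)
Lemma tsum_fiber (T U : choiceType) (p : T -> U) (f : T -> R) :
  asummable f ->
  [/\ forall u, asummable (fun t => if p t == u then f t else 0),
      asummable (fun u => tsum (fun t => if p t == u then f t else 0)) &
      tsum f = tsum (fun u => tsum (fun t => if p t == u then f t else 0))].
Proof.
move=> Sf; pose g (x : T * U) := if p x.1 == x.2 then f x.1 else 0.
have g1 t : asummable (fun u => g (t, u)) /\ tsum (fun u => g (t, u)) = f t.
  have [|Sg ->] := @asummable1 R U (p t) (fun u => g (t, u)).
    by move=> u; rewrite /g /= eq_sym => /negbTE->.
  by rewrite /g /= eqxx.
have g2 t : tsum (fun u => `|g (t, u)|) = `|f t|.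
  have [|Sg ->] := @asummable1 R U (p t) (fun u => `|g (t, u)|).
    by move=> u; rewrite /g /= eq_sym => /negbTE->; rewrite normr0.
  by rewrite /g /= eqxx.
have Sg : asummable g.
  apply: asummable_iter => [t|]; first exact: (g1 t).1.
  by under eq_fun do rewrite g2; exact: asummable_norm.
have [H1 H2 H3] := tsum_iter (asummable_swap Sg); split=> //.
rewrite -[LHS](eq_tsum (fun t => (g1 t).2)).
exact: (tsum_exchange (f := fun t u => g (t, u))).
Qed.

Lemma tsum_inj (T U : choiceType) (e : T -> U) (f : U -> R) :
  injective e -> (forall u, (forall t, e t != u) -> f u = 0) ->
  asummable (f \o e) -> tsum f = tsum (f \o e).
Proof.
move=> ie f0 Sf; have [_ _ ->] := tsum_fiber e Sf.
apply: eq_tsum => u; have [[t eu]|H] := pselect (exists t, e t = u).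
  have [|_ ->] := @asummable1 R T t (fun t => if e t == u then (f \o e) t else 0).
    by move=> t' t't; rewrite -eu (inj_eq ie) (negbTE t't).
  by rewrite /= eu eqxx.
rewrite f0; last by move=> t; apply/eqP => et; apply: H; exists t.
rewrite (eq_tsum (g := fun=> 0)) ?tsum0// => t; case: eqP => // et.
by case: H; exists t.
Qed.

Lemma tsumZr (T : choiceType) (c : R) (f : T -> R) : asummable f ->
  tsum (fun t => f t * c) = tsum f * c.
Proof.
by move=> Sf; rewrite mulrC -tsumZ//; apply: eq_tsum => t; rewrite mulrC.
Qed.

Lemma asummableZr (T : choiceType) (c : R) (f : T -> R) : asummable f ->
  asummable (fun t => f t * c).
Proof. by move=> /(asummableZ c); under eq_fun do rewrite mulrC. Qed.

Lemma tsum_mul (T U : choiceType) (f : T -> R) (g : U -> R) :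
  asummable f -> asummable g ->
  asummable (fun x : T * U => f x.1 * g x.2) /\
  tsum (fun x : T * U => f x.1 * g x.2) = tsum f * tsum g.
Proof.
move=> Sf Sg; have S : asummable (fun x : T * U => f x.1 * g x.2).
  apply: asummable_iter => [t|/=]; first exact: (asummableZ (f t) Sg).
  rewrite (_ : (fun _ => _) = (fun t => `|f t| * tsum (fun u => `|g u|))).
    by apply: asummableZr; exact: asummable_norm.
  apply/funext => t; rewrite -tsumZ; last exact: asummable_norm.
  by apply: eq_tsum => u; rewrite normrM.
split=> //; have [_ _ ->/=] := tsum_iter S.
by rewrite -tsumZr//; apply: eq_tsum => t; rewrite tsumZ.
Qed.

Lemma tsum_nat_le (f : nat -> R) (M : R) : (forall i, 0 <= f i) ->
  (forall N, \sum_(i < N) f i <= M) -> asummable f /\ tsum f <= M.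
Proof.
move=> f0 H; apply: tsum_le_seq => // s us.
pose N := (\max_(i <- s) i).+1.
apply: le_trans (H N); rewrite -(big_mkord xpredT f) [leRHS](bigID (mem s))/=.
rewrite ler_wpDr ?sumr_ge0//.
rewrite -[leRHS]big_filter (perm_big [seq i <- index_iota 0 N | i \in s])//.
apply: uniq_perm; rewrite ?filter_uniq ?iota_uniq// => i.
rewrite mem_filter mem_index_iota /=; case: (boolP (i \in s)) => //= si.
by rewrite /N ltnS; apply/esym; rewrite (big_rem i si)/= leq_maxl.
Qed.

Lemma asummable_geometric (r : R) : 0 <= r -> r < 1 ->
  asummable (fun i => r ^+ i) /\ tsum (fun i => r ^+ i) <= (1 - r)^-1.
Proof.
move=> r0 r1; apply: tsum_nat_le => [i|N]; first exact: exprn_ge0.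
rewrite -[X in _ <= X]mul1r ler_pdivlMr ?subr_gt0//.
have -> : (\sum_(i < N) r ^+ i) * (1 - r) = 1 - r ^+ N.
  by rewrite mulrC -[1 - r]opprB mulNr -subrX1 opprB.
by rewrite gerBl exprn_ge0.
Qed.

(** A finite set [s] carries all of [h] up to [e / 4]. On [s] finitely many pointwise limits apply,
    off [s] the difference is at most [2 * h]; the total error stays below [3 * e / 4]. *)
Lemma tsum_cvg_dominated (T : choiceType) (f : nat -> T -> R) (g h : T -> R) :
  asummable h -> (\forall n \near \oo, forall t, `|f n t| <= h t) ->
  (forall t, (fun n => f n t) @ \oo --> g t) ->
  asummable g /\ (fun n => tsum (f n)) @ \oo --> tsum g.
Proof.
move=> Sh dom fg.
have h0 t : 0 <= h t.
  near \oo => n; have /(_ t) : forall t, `|f n t| <= h t by near: n.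
  exact: le_trans.
have gh t : `|g t| <= h t.
  have gn : (fun n => `|f n t|) @ \oo --> `|g t| by apply: cvg_norm; exact: fg.
  rewrite -(cvg_lim _ gn)//; apply: limr_le; first exact: cvgP gn.
  by near=> n; have : forall t, `|f n t| <= h t; [near: n|apply].
have Sg : asummable g by exact: asummable_le Sh.
split=> //; apply/cvgrPdist_lt => e e0.
have [|s us He] := @tsum_approx _ _ h (e / 4) h0 Sh; first by rewrite divr_gt0.
have dom' : \forall n \near \oo, \sum_(t <- s) `|g t - f n t| < e / 4.
  have : (fun n => \sum_(t <- s) `|g t - f n t|) @ \oo --> \sum_(t <- s) (0 : R).
    elim: (s) => [|t s' IH].
      rewrite big_nil (_ : (fun _ => _) = fun=> 0); first exact: cvg_cst.
      by apply/funext => n; rewrite big_nil.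
    rewrite big_cons (_ : (fun _ => _) = fun n => `|g t - f n t| +
        \sum_(t0 <- s') `|g t0 - f n t0|); last first.
      by apply/funext => n; rewrite big_cons.
    apply: cvgD IH; rewrite -(@normr0 _ R) -(subrr (g t)).
    by apply: cvg_norm; apply: cvgB; [exact: cvg_cst|exact: fg].
  rewrite big1// => /cvgrPdist_lt /(_ (e / 4)).
  rewrite divr_gt0// => /(_ isT); apply: filterS => n.
  by rewrite sub0r normrN ger0_norm// sumr_ge0.
near=> n.
have domn : forall t, `|f n t| <= h t by near: n.
have Sfn : asummable (f n) by exact: asummable_le Sh.
rewrite -tsumB//; apply: le_lt_trans (ler_norm_tsum (asummableB Sg Sfn)) _.
pose a t := if t \in s then `|g t - f n t| else 0.
pose b t := if t \in s then h t else 0.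
have [t ts|Sa Ea] := @tsum_seq _ _ s a us; first by rewrite /a (negbTE ts).
have [t ts|Sb Eb] := @tsum_seq _ _ s b us; first by rewrite /b (negbTE ts).
have Shb : asummable (fun t => 2 * (h t - b t)).
  by apply: asummableZ; exact: asummableB.
apply: (@le_lt_trans _ _ (tsum (fun t => a t + 2 * (h t - b t)))).
  apply: le_tsum => [||t].
  - by apply: asummable_norm; exact: asummableB.
  - exact: asummableD.
  rewrite /a /b; case: ifPn => _; first by rewrite subrr mulr0 addr0.
  rewrite subr0 add0r (le_trans (ler_normB _ _))// mulr2n mulrDl !mul1r.
  by rewrite lerD.
rewrite tsumD// tsumZ ?tsumB//; last exact: asummableB.
rewrite Ea Eb [X in X + _](_ : _ = \sum_(t <- s) `|g t - f n t|); last first.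
  by apply: eq_big_seq => t ts; rewrite /a ts.
rewrite [X in _ - X](_ : _ = \sum_(t <- s) h t); last first.
  by apply: eq_big_seq => t ts; rewrite /b ts.
have : \sum_(t <- s) `|g t - f n t| < e / 4 by near: n.
lra.
Unshelve. all: by end_near. Qed.

End Reindexing.

(** * Complex-valued sums *)

Section ComplexSums.
Context {R : realType}.
Local Notation C := (R[i]).
Implicit Types T U : choiceType.

Definition csummable T (f : T -> C) : Prop := asummable (fun t => normc (f t)).

Definition csum T (f : T -> C) : C :=
  (tsum (fun t => complex.Re (f t)) +i* tsum (fun t => complex.Im (f t)))%C.

Lemma normc_ge0 (x : C) : 0 <= normc x.
Proof. by case: x => a b /=; rewrite sqrtr_ge0. Qed.

Lemma Re_le_normc (x : C) : `|complex.Re x| <= normc x.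
Proof.
case: x => a b /=; rewrite -sqrtr_sqr ler_wsqrtr//.
by rewrite lerDl sqr_ge0.
Qed.

Lemma Im_le_normc (x : C) : `|complex.Im x| <= normc x.
Proof.
case: x => a b /=; rewrite -sqrtr_sqr ler_wsqrtr//.
by rewrite lerDr sqr_ge0.
Qed.

Lemma normc_real (x : R) : normc (x%:C)%C = `|x|.
Proof. by rewrite /= expr0n addr0 sqrtr_sqr. Qed.

Lemma normcX (x : C) n : normc (x ^+ n) = normc x ^+ n.
Proof.
elim: n => [|n IH]; first by rewrite !expr0 /= expr0n addr0 expr1n sqrtr1.
by rewrite !exprS normcM IH.
Qed.

Lemma csummable_Re T (f : T -> C) : csummable f -> asummable (fun t => complex.Re (f t)).
Proof. by apply: asummable_le => t; exact: Re_le_normc. Qed.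

Lemma csummable_Im T (f : T -> C) : csummable f -> asummable (fun t => complex.Im (f t)).
Proof. by apply: asummable_le => t; exact: Im_le_normc. Qed.

Lemma csummable_le T (f : T -> C) (g : T -> R) :
  (forall t, normc (f t) <= g t) -> asummable g -> csummable f.
Proof. by move=> fg; apply: asummable_le => t; rewrite ger0_norm ?normc_ge0. Qed.

Lemma eq_csum T (f g : T -> C) : (forall t, f t = g t) -> csum f = csum g.
Proof. by move=> /funext->. Qed.

Lemma csumD T (f g : T -> C) : csummable f -> csummable g ->
  csum (fun t => f t + g t) = csum f + csum g.
Proof.
move=> Sf Sg; rewrite /csum.
rewrite (eq_tsum (g := fun t => complex.Re (f t) + complex.Re (g t))); last first.
  by move=> t; case: (f t); case: (g t).
rewrite (eq_tsum (f := fun t => complex.Im (f t + g t))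
  (g := fun t => complex.Im (f t) + complex.Im (g t))); last first.
  by move=> t; case: (f t); case: (g t).
rewrite (tsumD (csummable_Re Sf) (csummable_Re Sg)).
by rewrite (tsumD (csummable_Im Sf) (csummable_Im Sg)).
Qed.

Lemma csumZ T (c : C) (f : T -> C) : csummable f ->
  csum (fun t => c * f t) = c * csum f.
Proof.
move=> Sf; have Sr := csummable_Re Sf; have Si := csummable_Im Sf.
case: c => a b; rewrite /csum.
rewrite (eq_tsum (g := fun t => a * complex.Re (f t) - b * complex.Im (f t))); last first.
  by move=> t; case: (f t).
rewrite (eq_tsum (f := fun t => complex.Im (_ * f t))
  (g := fun t => a * complex.Im (f t) + b * complex.Re (f t))); last first.
  by move=> t; case: (f t).
by rewrite tsumB ?tsumD ?tsumZ//; exact: asummableZ.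
Qed.

Lemma csum_real T (f : T -> R) : csum (fun t => ((f t)%:C)%C) = ((tsum f)%:C)%C.
Proof. by rewrite /csum /= tsum0. Qed.

(** After multiplication by the conjugate of the sum [S], the number [|S|^2] is a sum of real parts,
    each at most [|S|] times the modulus of a term. *)
Lemma normc_csum_le T (f : T -> C) : csummable f ->
  normc (csum f) <= tsum (fun t => normc (f t)).
Proof.
move=> Sf; set S := csum f; have [->|S0] := eqVneq (normc S) 0.
  by apply: tsum_ge0 => t; exact: normc_ge0.
have Sp : 0 < normc S by rewrite lt0r S0 normc_ge0.
rewrite -(ler_pM2l Sp) -tsumZ//.
have -> : normc S * normc S = complex.Re (conjc S * S).
  case: S {S0 Sp} => a b /=; rewrite -expr2 sqr_sqrtr ?addr_ge0 ?sqr_ge0//.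
  by ring.
have nJ : normc (conjc S) = normc S by case: (S) => a b /=; rewrite sqrrN.
have SJ : csummable (fun t => conjc S * f t).
  apply: (csummable_le (g := fun t => normc S * normc (f t))) => [t|].
    by rewrite normcM nJ.
  exact: asummableZ.
rewrite -csumZ//= /csum /=; apply: le_tsum => [||t].
- exact: csummable_Re SJ.
- exact: asummableZ.
- by rewrite (le_trans (ler_norm _))// (le_trans (Re_le_normc _))// normcM nJ.
Qed.

Lemma csum_iter T U (f : T * U -> C) : csummable f ->
  [/\ forall t, csummable (fun u => f (t, u)),
      csummable (fun t => csum (fun u => f (t, u))) &
      csum f = csum (fun t => csum (fun u => f (t, u)))].
Proof.
move=> Sf; have [H1 H2 H3] := tsum_iter Sf; split=> //.
  by apply: csummable_le H2 => t; exact: (normc_csum_le (H1 t)).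
have [_ _ Hr] := tsum_iter (csummable_Re Sf).
have [_ _ Hi] := tsum_iter (csummable_Im Sf).
by rewrite /csum Hr Hi.
Qed.

Lemma csum_exchange T U (f : T -> U -> C) :
  csummable (fun x : T * U => f x.1 x.2) ->
  csum (fun t => csum (f t)) = csum (fun u => csum (fun t => f t u)).
Proof.
move=> Sf; rewrite /csum /=; congr (_ +i* _)%C.
  exact: (tsum_exchange (csummable_Re Sf)).
exact: (tsum_exchange (csummable_Im Sf)).
Qed.

Lemma csum_fiber T U (p : T -> U) (f : T -> C) : csummable f ->
  csum f = csum (fun u => csum (fun t => if p t == u then f t else 0)).
Proof.
move=> Sf; rewrite /csum /=.
have [_ _ ->] := tsum_fiber p (csummable_Re Sf).
have [_ _ ->] := tsum_fiber p (csummable_Im Sf).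
by congr (_ +i* _)%C; apply: eq_tsum => u; apply: eq_tsum => t; case: ifP.
Qed.

Lemma csum_seq T (s : seq T) (f : T -> C) : uniq s ->
  (forall t, t \notin s -> f t = 0) -> csum f = \sum_(t <- s) f t.
Proof.
move=> us f0; rewrite /csum.
have [t ts|_ ->] := @tsum_seq _ _ s (fun t => complex.Re (f t)) us.
  by rewrite f0.
have [t ts|_ ->] := @tsum_seq _ _ s (fun t => complex.Im (f t)) us.
  by rewrite f0.
elim: (s) => [|t s' IH]; first by rewrite !big_nil.
by rewrite !big_cons -IH; case: (f t).
Qed.

End ComplexSums.

#[global] Opaque tsum.

(** * Formal power series *)

Section FormalSeries.
Context {F : fieldType}.

(** The wrapper is there so that the ring structure is the Cauchy product and not pointwise
    multiplication of functions. *)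
Record fps := Fps { fcoef :> nat -> F }.

HB.instance Definition _ := gen_eqMixin fps.
HB.instance Definition _ := gen_choiceMixin fps.

Implicit Types c d e : fps.

Lemma fpsP c d : (forall i, c i = d i) -> c = d.
Proof. by case: c d => c [d] /= /funext ->. Qed.

Definition fadd c d := Fps (fun i => c i + d i).
Definition fopp c := Fps (fun i => - c i).
Definition fC (a : F) := Fps (fun i => if i is 0%N then a else 0).
Definition fmul c d := Fps (fun n => \sum_(i < n.+1) c i * d (n - i)%N).

Fact faddA : associative fadd. Proof. by move=> *; apply: fpsP => i; exact: addrA. Qed.
Fact faddC : commutative fadd. Proof. by move=> *; apply: fpsP => i; exact: addrC. Qed.
Fact fadd0 : left_id (fC 0) fadd.
Proof. by move=> c; apply: fpsP => -[|i]; exact: add0r. Qed.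
Fact faddN : left_inverse (fC 0) fopp fadd.
Proof. by move=> c; apply: fpsP => -[|i]; exact: addNr. Qed.

HB.instance Definition _ := GRing.isZmodule.Build fps faddA faddC fadd0 faddN.

Definition ftrunc N c : {poly F} := \poly_(i < N) c i.

Lemma coef_ftrunc N c i : (i < N)%N -> (ftrunc N c)`_i = c i.
Proof. by rewrite coef_poly => ->. Qed.

(** Coefficient [n] of a product sees only coefficients up to [n], so ring laws and the substitution
    of [q^k] can be borrowed from polynomials. *)
Lemma coef_mul_ftrunc N c d (p q : {poly F}) n : (n < N)%N ->
  (forall i, (i < N)%N -> p`_i = c i) -> (forall i, (i < N)%N -> q`_i = d i) ->
  (p * q)`_n = fmul c d n.
Proof.
move=> nN pc qd; rewrite coefM; apply: eq_bigr => i _.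
by rewrite pc ?qd//; move: (ltn_ord i); lia.
Qed.

Fact fmulA : associative fmul.
Proof.
move=> c d e; apply: fpsP => n; have nN := ltnSn n.
have t k i : (i < n.+1)%N -> (ftrunc n.+1 k)`_i = k i by exact: coef_ftrunc.
rewrite -(@coef_mul_ftrunc n.+1 c (fmul d e) (ftrunc n.+1 c)
          (ftrunc n.+1 d * ftrunc n.+1 e))//; last 2 first.
- exact: t.
- by move=> i iN; apply: (@coef_mul_ftrunc n.+1) => // *; exact: t.
rewrite mulrA; apply: (@coef_mul_ftrunc n.+1) => // [i iN|*]; last exact: t.
by apply: (@coef_mul_ftrunc n.+1) => // *; exact: t.
Qed.

Fact fmulC : commutative fmul.
Proof.
move=> c d; apply: fpsP => n.
have t k i : (i < n.+1)%N -> (ftrunc n.+1 k)`_i = k i by exact: coef_ftrunc.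
rewrite -(@coef_mul_ftrunc n.+1 c d (ftrunc n.+1 c) (ftrunc n.+1 d))//; try exact: t.
by rewrite mulrC; apply: (@coef_mul_ftrunc n.+1) => //; exact: t.
Qed.

Fact fmul1 : left_id (fC 1) fmul.
Proof.
move=> c; apply: fpsP => n; rewrite /= big_ord_recl /= mul1r subn0 big1 ?addr0//.
by move=> i _; rewrite mul0r.
Qed.

Fact fmulDl : left_distributive fmul fadd.
Proof.
move=> c d e; apply: fpsP => n /=; rewrite -big_split /=.
by apply: eq_bigr => i _; rewrite mulrDl.
Qed.

Fact fone_neq0 : fC 1 != fC 0.
Proof. by apply/eqP => /(congr1 (fun c : fps => c 0%N))/eqP; rewrite oner_eq0. Qed.

HB.instance Definition _ :=
  GRing.Zmodule_isComNzRing.Build fps fmulA fmulC fmul1 fmulDl fone_neq0.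

Lemma fcoefD c d i : (c + d) i = c i + d i. Proof. by []. Qed.
Lemma fcoefN c i : (- c) i = - c i. Proof. by []. Qed.
Lemma fcoefB c d i : (c - d) i = c i - d i. Proof. by []. Qed.
Lemma fcoef0 i : (0 : fps) i = 0. Proof. by case: i. Qed.
Lemma fcoef1 i : (1 : fps) i = (i == 0%N)%:R. Proof. by case: i. Qed.
Lemma fcoefM c d n : (c * d) n = \sum_(i < n.+1) c i * d (n - i)%N.
Proof. by []. Qed.

Lemma fcoef_sum (I : Type) (s : seq I) (P : pred I) (f : I -> fps) i :
  (\sum_(j <- s | P j) f j) i = \sum_(j <- s | P j) f j i.
Proof. by elim/big_rec2: _ => [|j _ y _ <-//]; rewrite fcoef0. Qed.

Lemma fcoefCM a c i : (fC a * c) i = a * c i.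
Proof.
rewrite fcoefM big_ord_recl /= subn0 big1 ?addr0// => j _.
by rewrite mul0r.
Qed.

Lemma fC_is_zmod_morphism : zmod_morphism fC.
Proof. by move=> a b; apply: fpsP => -[|i]; rewrite fcoefB//= subr0. Qed.
Lemma fC_is_monoid_morphism : monoid_morphism fC.
Proof. by split=> // a b; apply: fpsP => -[|i]; rewrite fcoefCM//= mulr0. Qed.
HB.instance Definition _ := GRing.isZmodMorphism.Build F fps fC fC_is_zmod_morphism.
HB.instance Definition _ := GRing.isMonoidMorphism.Build F fps fC fC_is_monoid_morphism.

Lemma fcoefM0 c d : (c * d) 0%N = c 0%N * d 0%N.
Proof. by rewrite fcoefM big_ord1. Qed.

Lemma fcoefX0 c n : (c ^+ n) 0%N = c 0%N ^+ n.
Proof. by elim: n => [|n IH]; rewrite ?fcoef1// !exprS fcoefM0 IH. Qed.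

Definition fX := Fps (fun i => (i == 1)%:R).

Lemma fcoefXM c i : (fX * c) i = if i is j.+1 then c j else 0.
Proof.
case: i => [|i]; first by rewrite fcoefM0 mul0r.
rewrite fcoefM big_ord_recl mul0r add0r big_ord_recl /= mul1r subSS subn0 big1 ?addr0//.
by move=> j _; rewrite mul0r.
Qed.

Lemma fcoefXnM k c i : (fX ^+ k * c) i = if (i < k)%N then 0 else c (i - k)%N.
Proof.
elim: k i => [|k IH] i; first by rewrite mul1r subn0.
by rewrite exprS -mulrA fcoefXM; case: i => [//|i]; rewrite IH.
Qed.

Definition fshift k c := Fps (fun i => c (i + k)%N).

Lemma fX_lreg c d k : fX ^+ k * c = fX ^+ k * d -> c = d.
Proof.
move=> e; apply: fpsP => i; have := congr1 (fun c : fps => c (i + k)%N) e.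
by rewrite !fcoefXnM ltnNge leq_addl /= addnK.
Qed.

(* c(q^k) *)
Definition fdil k c := Fps (fun i => if (k %| i)%N then c (i %/ k)%N else 0).

Lemma fcoef_dil k c i : fdil k c i = if (k %| i)%N then c (i %/ k)%N else 0.
Proof. by []. Qed.

Lemma fdil_is_zmod_morphism k : zmod_morphism (fdil k).
Proof. by move=> c d; apply: fpsP => i; rewrite fcoefB/=; case: ifP; rewrite ?subr0. Qed.

Lemma fdil_is_monoid_morphism k : monoid_morphism (fdil k.+1).
Proof.
split=> [|c d]; apply: fpsP => n.
  rewrite fcoef_dil !fcoef1; case: n => [|n]; first by rewrite dvdn0 div0n.
  case: ifP => // H; rewrite (_ : (_ == 0%N) = false)//.
  by apply/negbTE; rewrite -lt0n divn_gt0// dvdn_leq.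
have t e i : (i < n.+1)%N -> (ftrunc n.+1 e \Po 'X^(k.+1))`_i = fdil k.+1 e i.
  move=> iN; rewrite coef_comp_poly_Xn//= coef_ftrunc//.
  exact: leq_ltn_trans (leq_div _ _) iN.
rewrite -[RHS](@coef_mul_ftrunc n.+1 _ _ (ftrunc n.+1 c \Po 'X^(k.+1))
  (ftrunc n.+1 d \Po 'X^(k.+1)))//; try exact: t.
rewrite -comp_polyM coef_comp_poly_Xn//=; case: ifP => // _.
apply/esym; apply: (@coef_mul_ftrunc n.+1) => [|i iN|i iN].
- by rewrite ltnS leq_div.
- exact: coef_ftrunc.
- exact: coef_ftrunc.
Qed.

HB.instance Definition _ k := GRing.isZmodMorphism.Build fps fps (fdil k) (fdil_is_zmod_morphism k).
HB.instance Definition _ k := GRing.isMonoidMorphism.Build fps fps (fdil k.+1) (fdil_is_monoid_morphism k).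

(* c(-q) *)
Definition fneg c := Fps (fun i => (-1) ^+ i * c i).

Lemma fneg_is_zmod_morphism : zmod_morphism fneg.
Proof. by move=> c d; apply: fpsP => i; rewrite fcoefB/= mulrBr. Qed.

Lemma fneg_is_monoid_morphism : monoid_morphism fneg.
Proof.
split=> [|c d]; apply: fpsP => n; first by case: n => [|n]; rewrite /= ?mulr1 ?mulr0.
rewrite /= mulr_sumr; apply: eq_bigr => i _.
have -> : (-1) ^+ n = (-1) ^+ i * (-1) ^+ (n - i) :> F.
  by rewrite -exprD subnKC// -ltnS.
by rewrite mulrACA.
Qed.

HB.instance Definition _ := GRing.isZmodMorphism.Build fps fps fneg fneg_is_zmod_morphism.
HB.instance Definition _ := GRing.isMonoidMorphism.Build fps fps fneg fneg_is_monoid_morphism.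

Lemma fnegK : involutive fneg.
Proof. by move=> c; apply: fpsP => i /=; rewrite mulrA -exprMn mulrNN mulr1 expr1n mul1r. Qed.

Lemma fdil_comp k l c : (0 < k)%N -> (0 < l)%N -> fdil k (fdil l c) = fdil (k * l) c.
Proof.
move=> k0 l0; apply: fpsP => i /=; case: (boolP (k %| i)%N) => [/dvdnP[j ->]|ki].
  rewrite mulnK// [(k * l)%N]mulnC dvdn_pmul2r//; case: ifP => // _.
  by rewrite divnMr.
by case: ifP => // kli; case/negP: ki; apply: dvdn_trans kli; rewrite dvdn_mulr.
Qed.

Lemma fdil_X k : (0 < k)%N -> fdil k fX = fX ^+ k.
Proof.
move=> k0; apply: fpsP => i; rewrite -[fX ^+ k]mulr1 fcoefXnM fcoef1 /=.
case: (boolP (k %| i)%N) => [/dvdnP[j ->]|ki].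
  rewrite mulnK//; case: ltnP => [|le].
    by rewrite -[X in (_ < X)%N]mul1n ltn_pmul2r// ltnS leqn0 => /eqP->.
  congr (_%:R); congr nat_of_bool; rewrite subn_eq0 -[X in (_ <= X)%N]mul1n leq_pmul2r//.
  rewrite -[X in (X <= _)%N]mul1n leq_pmul2r// in le.
  by apply/eqP/idP; lia.
case: ltnP => // le; rewrite subn_eq0; case: leqP => // ik.
by case/negP: ki; rewrite (_ : i = k)//; apply/eqP; rewrite eqn_leq ik.
Qed.

Lemma fdil_C k a : (0 < k)%N -> fdil k (fC a) = fC a.
Proof.
case: k => // k _; apply: fpsP => -[|i]; rewrite fcoef_dil ?dvdn0 ?div0n//.
by case: ifP => // /dvdnP[j jE]; rewrite jE mulnK//; case: j jE.
Qed.

Lemma fneg_X : fneg fX = - fX.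
Proof. by apply: fpsP => -[|[|i]] /=; rewrite ?fcoefN/= ?mulr0 ?oppr0// expr1 mulN1r. Qed.

Lemma fneg_dil2 c : fneg (fdil 2 c) = fdil 2 c.
Proof.
apply: fpsP => i /=; case: ifP; rewrite ?mulr0//.
by rewrite dvdn2 => /negbTE ev; rewrite -signr_odd ev mul1r.
Qed.

(** Course-of-values recursion: the list holds all earlier coefficients of the inverse. The
    recursion divides by nothing and is meant for constant term 1. *)
Fixpoint finv_list c n : seq F :=
  if n is m.+1 then
    let s := finv_list c m in
    rcons s (- \sum_(i < m.+1) s`_i * c (m.+1 - i)%N)
  else [:: 1].

Definition finv_coef c n := (finv_list c n)`_n.
Arguments finv_coef : simpl never.

Definition finv c := Fps (finv_coef c).

Lemma size_finv_list c n : size (finv_list c n) = n.+1.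
Proof. by elim: n => //= n IH; rewrite size_rcons IH. Qed.

Lemma nth_finv_list c n i : (i <= n)%N -> (finv_list c n)`_i = finv_coef c i.
Proof.
elim: n => [|n IH]; first by rewrite leqn0 => /eqP->.
rewrite leq_eqVlt => /orP[/eqP->//|].
by rewrite ltnS => ni; rewrite /= nth_rcons size_finv_list ltnS ni IH.
Qed.

Lemma finvS c n : finv_coef c n.+1 = - \sum_(i < n.+1) finv_coef c i * c (n.+1 - i)%N.
Proof.
rewrite /finv_coef /= nth_rcons size_finv_list ltnn eqxx; congr (- _).
by apply: eq_bigr => i _; rewrite nth_finv_list// -ltnS.
Qed.

Lemma finvl c : c 0%N = 1 -> finv c * c = 1.
Proof.
move=> c0; apply: fpsP => -[|n]; first by rewrite fcoefM0 c0 mulr1.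
by rewrite fcoefM big_ord_recr /= subnn c0 mulr1 finvS subrr.
Qed.

Lemma finvr c : c 0%N = 1 -> c * finv c = 1.
Proof. by rewrite mulrC; exact: finvl. Qed.

(* An inverse of c + d turns c^2 - d^2 = 0 into c = d. *)
Lemma fsqr_inj c d : c 0%N = 1 -> d 0%N = 1 -> (2 : F) != 0 ->
  c ^+ 2 = d ^+ 2 -> c = d.
Proof.
move=> c0 d0 n2 e; pose u := fC 2^-1 * (c + d).
have u0 : u 0%N = 1 by rewrite fcoefCM fcoefD c0 d0 mulVf.
have /(congr1 (fun t => t * finv u)) : (c - d) * u = 0.
  by rewrite /u mulrCA -subr_sqr e subrr mulr0.
by rewrite -mulrA finvr// mulr1 mul0r => /eqP; rewrite subr_eq0 => /eqP.
Qed.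

End FormalSeries.
Arguments fps : clear implicits.
Arguments fX {F}.

(** * Power series on the unit disc *)

Section DiscSeries.
Context {R : realType}.
Local Notation C := (R[i]).
Local Open Scope complex_scope.
Implicit Types (c d : fps R) (p : C).

(** Absolute convergence on the whole open disc. Such a series stands for a holomorphic function
    that is real on the real axis; [cev] and [fev] are its complex and real values. *)
Definition conv c : Prop :=
  forall r : R, 0 <= r -> r < 1 -> asummable (fun i => c i * r ^+ i).

Definition cev c p : C := csum (fun i => (c i)%:C * p ^+ i).
Definition fev c (x : R) : R := tsum (fun i => c i * x ^+ i).

Lemma convI c :
  (forall r : R, 0 < r -> r < 1 -> asummable (fun i => c i * r ^+ i)) -> conv c.
Proof.
move=> H r r0 r1; pose s := (r + 1) / 2.
have s0 : 0 < s by rewrite /s; lra.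
have s1 : s < 1 by rewrite /s; lra.
have rs : r <= s by rewrite /s; lra.
apply: asummable_le (asummable_norm (H s s0 s1)) => i.
rewrite !normrM ler_wpM2l// !normrX !ger0_norm ?(ltW s0)//.
by apply: lerXn2r; rewrite ?nnegrE// ltW.
Qed.

Lemma conv_csummable c p : conv c -> normc p < 1 ->
  csummable (fun i => (c i)%:C * p ^+ i).
Proof.
move=> cc p1; apply: asummable_le (asummable_norm (cc _ (normc_ge0 p) p1)) => i.
by rewrite normcM normcX normc_real ger0_norm ?mulr_ge0 ?exprn_ge0 ?normc_ge0//
  normrM (ger0_norm (exprn_ge0 _ (normc_ge0 _))).
Qed.

Lemma conv_summable c x : conv c -> `|x| < 1 -> asummable (fun i => c i * x ^+ i).
Proof.
move=> cc x1; apply: asummable_le (asummable_norm (cc _ (normr_ge0 x) x1)) => i.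
by rewrite !normrM !normrX normr_id.
Qed.

Lemma conv_norm c r : conv c -> 0 <= r -> r < 1 ->
  asummable (fun i => `|c i| * r ^+ i).
Proof.
move=> cc r0 r1; apply: asummable_le (asummable_norm (cc r r0 r1)) => i.
by rewrite !normrM normr_id.
Qed.

Lemma cev_real c x : cev c x%:C = (fev c x)%:C.
Proof.
rewrite /cev /fev -csum_real; apply: eq_csum => i.
by rewrite rmorphM rmorphXn.
Qed.

Lemma convD c d : conv c -> conv d -> conv (c + d).
Proof.
move=> cc cd r r0 r1.
rewrite (_ : (fun _ => _) = (fun i => c i * r ^+ i + d i * r ^+ i)).
  by apply: asummableD; [exact: cc|exact: cd].
by apply/funext => i; rewrite fcoefD mulrDl.
Qed.

Lemma convN c : conv c -> conv (- c).
Proof.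
move=> cc r r0 r1; apply: asummable_le (asummable_norm (cc r r0 r1)) => i.
by rewrite fcoefN mulNr normrN.
Qed.

Lemma convB c d : conv c -> conv d -> conv (c - d).
Proof. by move=> cc cd; apply: convD => //; exact: convN. Qed.

Lemma conv_fC a : conv (fC a).
Proof. by move=> r r0 r1; apply: (proj1 (asummable1 (t := 0%N) _)) => -[|i]//; rewrite mul0r. Qed.

Lemma conv0 : conv 0. Proof. exact: conv_fC. Qed.
Lemma conv1 : conv 1. Proof. exact: conv_fC. Qed.

Lemma conv_fX : conv fX.
Proof. by move=> r r0 r1; apply: (proj1 (asummable1 (t := 1%N) _)) => -[|[|i]]//; rewrite mul0r. Qed.

Lemma csum_mul (f g : nat -> C) : csummable f -> csummable g ->
  csummable (fun x : nat * nat => f x.1 * g x.2) /\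
  csum (fun x : nat * nat => f x.1 * g x.2) = csum f * csum g.
Proof.
move=> Sf Sg; have [S _] := tsum_mul Sf Sg.
have Sfg : csummable (fun x : nat * nat => f x.1 * g x.2).
  by apply: csummable_le S => x; rewrite normcM.
split=> //; have [_ _ ->] := csum_iter Sfg.
by rewrite [RHS]mulrC -csumZ//; apply: eq_csum => i /=; rewrite csumZ// mulrC.
Qed.

Lemma antidiag_inj n : injective (fun i : nat => (i, n - i)%N).
Proof. by move=> i j []. Qed.

Lemma csum_antidiag (f : nat * nat -> C) : csummable f ->
  csum f = csum (fun n => \sum_(i < n.+1) f (i : nat, n - i)%N).
Proof.
move=> Sf; rewrite (csum_fiber (fun x => x.1 + x.2)%N)//; apply: eq_csum => n.
pose s := [seq (i, n - i)%N | i <- iota 0 n.+1].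
have us : uniq s by rewrite map_inj_uniq ?iota_uniq//; exact: antidiag_inj.
rewrite (csum_seq us); last first.
  move=> [i j] ijs /=; case: eqP => // ijn; case/negP: ijs.
  by apply/mapP; exists i; [rewrite mem_iota|congr pair]; lia.
rewrite big_map -[iota 0 n.+1]/(index_iota 0 n.+1) big_mkord.
by apply: eq_bigr => i _ /=; rewrite subnKC ?eqxx// -ltnS.
Qed.

Lemma asummable_antidiag (f : nat * nat -> R) : asummable f ->
  asummable (fun n => \sum_(i < n.+1) `|f (i : nat, n - i)%N|).
Proof.
move=> /asummable_norm Sf.
have [_ + _] := tsum_fiber (fun x => x.1 + x.2)%N Sf.
apply: asummable_le => n; rewrite ger0_norm ?sumr_ge0//.
pose s := [seq (i, n - i)%N | i <- iota 0 n.+1].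
have us : uniq s by rewrite map_inj_uniq ?iota_uniq//; exact: antidiag_inj.
have [|_ ->] := @tsum_seq R _ s (fun t => if (t.1 + t.2)%N == n then `|f t| else 0) us.
  move=> [i j] ijs /=; case: eqP => // ijn; case/negP: ijs.
  by apply/mapP; exists i; [rewrite mem_iota|congr pair]; lia.
rewrite big_map -[iota 0 n.+1]/(index_iota 0 n.+1) big_mkord.
by apply: ler_sum => i _ /=; rewrite subnKC ?eqxx// -ltnS.
Qed.

Lemma convM c d : conv c -> conv d -> conv (c * d).
Proof.
move=> cc cd r r0 r1.
have [S _] := tsum_mul (conv_norm cc r0 r1) (conv_norm cd r0 r1).
apply: asummable_le (asummable_antidiag S) => n.
rewrite fcoefM mulr_suml (le_trans (ler_norm_sum _ _ _))// ler_sum// => i _ /=.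
have -> : r ^+ n = r ^+ i * r ^+ (n - i) by rewrite -exprD subnKC// -ltnS.
by rewrite !normrM !normr_id mulrACA.
Qed.

Lemma cevM c d p : conv c -> conv d -> normc p < 1 ->
  cev (c * d) p = cev c p * cev d p.
Proof.
move=> cc cd p1.
have [S <-] := csum_mul (conv_csummable cc p1) (conv_csummable cd p1).
rewrite csum_antidiag//; apply: eq_csum => n.
rewrite fcoefM rmorph_sum mulr_suml; apply: eq_bigr => i _ /=.
by rewrite rmorphM mulrACA -exprD subnKC// -ltnS.
Qed.

Lemma cevD c d p : conv c -> conv d -> normc p < 1 ->
  cev (c + d) p = cev c p + cev d p.
Proof.
move=> cc cd p1; rewrite -csumD; do ?exact: conv_csummable.
by apply: eq_csum => i; rewrite fcoefD rmorphD mulrDl.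
Qed.

Lemma cev_fC a p : cev (fC a) p = a%:C.
Proof.
rewrite /cev (csum_seq (s := [:: 0%N]))// ?big_seq1 ?mulr1// => -[|i]//= _.
by rewrite rmorph0 mul0r.
Qed.

Lemma cev_fX p : cev fX p = p.
Proof.
rewrite /cev (csum_seq (s := [:: 1%N]))// ?big_seq1 ?mul1r// => -[|[|i]]//= _;
by rewrite mul0r.
Qed.

Lemma convX c n : conv c -> conv (c ^+ n).
Proof.
by move=> cc; elim: n => [|n IH]; [exact: conv1|rewrite exprS; exact: convM].
Qed.

Lemma conv_sum (I : Type) (s : seq I) (P : pred I) (f : I -> fps R) :
  (forall i, P i -> conv (f i)) -> conv (\sum_(i <- s | P i) f i).
Proof. by move=> cf; elim/big_ind: _ => //; [exact: conv0|exact: convD]. Qed.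

Lemma cevX c n p : conv c -> normc p < 1 -> cev (c ^+ n) p = cev c p ^+ n.
Proof.
move=> cc p1; elim: n => [|n IH]; first by rewrite !expr0 cev_fC.
by rewrite !exprS cevM ?IH//; exact: convX.
Qed.

Lemma fev_morph (x : R) : `|x| < 1 ->
  [/\ forall c d, conv c -> conv d -> fev (c + d) x = fev c x + fev d x,
      forall c d, conv c -> conv d -> fev (c * d) x = fev c x * fev d x &
      forall c n, conv c -> fev (c ^+ n) x = fev c x ^+ n].
Proof.
move=> x1; have n1 : normc x%:C < 1 by rewrite normc_real.
split=> [c d cc cd|c d cc cd|c n cc]; apply: (@complexI R).
- by rewrite [RHS]rmorphD /= -!cev_real cevD.
- by rewrite [RHS]rmorphM /= -!cev_real cevM.
- by rewrite [RHS]rmorphXn /= -!cev_real cevX.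
Qed.

Lemma fevD c d (x : R) : `|x| < 1 -> conv c -> conv d ->
  fev (c + d) x = fev c x + fev d x.
Proof. by move=> /fev_morph[H _ _]; exact: H. Qed.
Lemma fevM c d (x : R) : `|x| < 1 -> conv c -> conv d ->
  fev (c * d) x = fev c x * fev d x.
Proof. by move=> /fev_morph[_ H _]; exact: H. Qed.
Lemma fevX c n (x : R) : `|x| < 1 -> conv c -> fev (c ^+ n) x = fev c x ^+ n.
Proof. by move=> /fev_morph[_ _ H]; exact: H. Qed.
Lemma fev_fC a (x : R) : fev (fC a) x = a.
Proof. by apply: (@complexI R); rewrite -cev_real cev_fC. Qed.
Lemma fev_fX (x : R) : fev fX x = x.
Proof. by apply: (@complexI R); rewrite -cev_real cev_fX. Qed.
Lemma fev0 (x : R) : fev 0 x = 0. Proof. exact: fev_fC. Qed.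
Lemma fev1 (x : R) : fev 1 x = 1. Proof. exact: fev_fC. Qed.
Lemma fevN c (x : R) : fev (- c) x = - fev c x.
Proof. by rewrite /fev -tsumN; apply: eq_tsum => i; rewrite fcoefN mulNr. Qed.
Lemma fevB c d (x : R) : `|x| < 1 -> conv c -> conv d ->
  fev (c - d) x = fev c x - fev d x.
Proof. by move=> x1 cc cd; rewrite fevD ?fevN//; exact: convN. Qed.
Lemma fev_sum (I : Type) (s : seq I) (f : I -> fps R) (x : R) : `|x| < 1 ->
  (forall i, conv (f i)) ->
  fev (\sum_(i <- s) f i) x = \sum_(i <- s) fev (f i) x.
Proof.
move=> x1 cf; elim: s => [|i s IH]; first by rewrite !big_nil fev0.
by rewrite !big_cons fevD ?IH//; apply: conv_sum.
Qed.

Lemma conv_fneg c : conv c -> conv (fneg c).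
Proof.
move=> cc r r0 r1; apply: asummable_le (asummable_norm (cc r r0 r1)) => i.
by rewrite /= !normrM normrX normrN normr1 expr1n mul1r.
Qed.

Lemma fev_fneg c (x : R) : fev (fneg c) x = fev c (- x).
Proof. by apply: eq_tsum => i /=; rewrite [in RHS]exprNn mulrCA mulrA. Qed.

Lemma fdil_sum k c (x : R) : (0 < k)%N -> conv c -> `|x| < 1 ->
  asummable (fun i => fdil k c i * x ^+ i) /\ fev (fdil k c) x = fev c (x ^+ k).
Proof.
move=> k0 cc x1; have ik : injective (muln k).
  by move=> i j /eqP; rewrite eqn_pmul2l// => /eqP.
have xk1 : `|x ^+ k| < 1 by rewrite normrX exprn_ilt1// -lt0n.
have f0 u : (forall t, (k * t)%N != u) -> fdil k c u * x ^+ u = 0.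
  move=> H; rewrite fcoef_dil; case: ifP => [/dvdnP[j uE]|_]; last by rewrite mul0r.
  by have := H j; rewrite uE mulnC eqxx.
have E : (fun i => fdil k c i * x ^+ i) \o muln k = (fun i => c i * (x ^+ k) ^+ i).
  by apply/funext => i /=; rewrite dvdn_mulr// mulKn// exprM.
have S := conv_summable cc xk1; split.
  by apply: (asummable_inj_supp ik f0); rewrite E.
by rewrite /fev (tsum_inj ik f0) E.
Qed.

Lemma conv_fdil k c : (0 < k)%N -> conv c -> conv (fdil k c).
Proof. by move=> k0 cc r r0 r1; apply: (fdil_sum k0 cc _).1; rewrite ger0_norm. Qed.

Lemma fev_fdil k c (x : R) : (0 < k)%N -> conv c -> `|x| < 1 ->
  fev (fdil k c) x = fev c (x ^+ k).
Proof. by move=> k0 cc x1; have [] := fdil_sum k0 cc x1. Qed.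

Lemma conv_fshift k c : conv c -> conv (fshift k c).
Proof.
move=> cc; apply: convI => r r0 r1.
have S : asummable ((fun i => c i * r ^+ i) \o (addn k)).
  by apply: asummable_inj; [exact: addnI|apply: cc => //; exact: ltW].
apply: asummable_le (asummable_norm (asummableZ (r ^- k) S)) => i /=.
rewrite [X in _ <= `|X|](_ : _ = c (i + k)%N * r ^+ i)//.
rewrite addnC exprD mulrCA [r ^- k * _]mulrC mulfK//.
by rewrite expf_neq0// gt_eqF.
Qed.

Lemma normc_cev_le c p (r : R) : conv c -> normc p <= r -> r < 1 ->
  normc (cev c p) <= tsum (fun i => `|c i| * r ^+ i).
Proof.
move=> cc pr r1; have p1 : normc p < 1 by exact: le_lt_trans r1.
have r0 : 0 <= r by exact: le_trans (normc_ge0 _) pr.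
apply: le_trans (normc_csum_le (conv_csummable cc p1)) _.
apply: le_tsum => [||i]; first exact: conv_csummable.
  exact: conv_norm.
rewrite normcM normcX normc_real ler_wpM2l//.
by apply: lerXn2r; rewrite ?nnegrE ?normc_ge0.
Qed.

Lemma fcoef_shift1 c : c = fC (c 0%N) + fX * fshift 1 c.
Proof.
by apply: fpsP => -[|i]; rewrite fcoefD fcoefXM/= ?addr0// add0r addn1.
Qed.

Lemma fev_shift1 c x : conv c -> `|x| < 1 -> fev c x = c 0%N + x * fev (fshift 1 c) x.
Proof.
move=> cc x1; have cs := conv_fshift 1 cc; rewrite {1}[c]fcoef_shift1.
rewrite fevD//; [|exact: conv_fC|by apply: convM => //; exact: conv_fX].
by rewrite fev_fC fevM// ?fev_fX//; exact: conv_fX.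
Qed.

(** A zero at [x] bounds [|c 0|] by [x * K], where [K] bounds the rest of the series on [[0, 1/2]];
    a small enough [x] contradicts [c 0 != 0]. *)
Lemma fev_eq0_at0 c (e : R) : conv c -> 0 < e ->
  (forall x, 0 < x -> x < e -> fev c x = 0) -> c 0%N = 0.
Proof.
move=> cc e0 H; have cs := conv_fshift 1 cc.
pose K := tsum (fun i => `|fshift 1 c i| * 2^-1 ^+ i).
have K0 : 0 <= K by apply: tsum_ge0 => i; rewrite mulr_ge0// exprn_ge0// invr_ge0.
have K1 : 0 < K + 1 by rewrite ltr_wpDl.
apply/eqP; apply: contraT => c0; have cp : 0 < `|c 0%N| by rewrite normr_gt0.
have [x [x0 xe x2 xK]] : exists x, [/\ 0 < x, x < e, x <= 2^-1 & x * (K + 1) <= `|c 0%N| / 2].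
  pose m := Num.min (e / 2) 2^-1; exists (Num.min m (`|c 0%N| / 2 / (K + 1))).
  split; rewrite ?lt_min ?gt_min ?ge_min ?lexx ?orbT//.
  - by rewrite (divr_gt0 e0)// invr_gt0 ltr0n/= !divr_gt0.
  - by rewrite (_ : e / 2 < e) //; lra.
  - by rewrite -ler_pdivlMr// ge_min lexx orbT.
have x1 : `|x| < 1 by rewrite ger0_norm ?ltW//; lra.
have := H x x0 xe; rewrite fev_shift1// => /eqP; rewrite addr_eq0 => /eqP c0E.
have : `|c 0%N| <= x * K.
  rewrite c0E normrN normrM gtr0_norm// ler_pM2l//.
  have := @normc_cev_le _ x%:C 2^-1 cs.
  by rewrite cev_real !normc_real (gtr0_norm x0); apply => //; lra.
by move=> le; exfalso; nra.
Qed.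

(** Identity theorem at the origin: once the constant coefficient is known to vanish, the shifted
    series vanishes at the same points. An identity of series can thus be checked at small positive
    reals. *)
Lemma fev_eq0 c (e : R) : conv c -> 0 < e ->
  (forall x, 0 < x -> x < e -> fev c x = 0) -> c = 0.
Proof.
move=> cc e0 H; apply: fpsP => n; rewrite fcoef0.
have [e' [e'0 e'1 {e0}H]] : exists e', [/\ 0 < e', e' < 1 & forall x, 0 < x -> x < e' -> fev c x = 0].
  exists (Num.min e 2^-1); split; rewrite ?lt_min ?gt_min ?e0 /=.
  - by rewrite invr_gt0 ltr0n.
  - by apply/orP; right; lra.
  - by move=> x x0; rewrite lt_min => /andP[xe _]; exact: H.
elim: n c cc H => [|n IH] c cc H; first exact: (fev_eq0_at0 cc e'0 H).
rewrite -addn1; apply: (IH (fshift 1 c)); first exact: conv_fshift.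
move=> x x0 xe; have x1 : `|x| < 1 by rewrite ger0_norm ?(ltW x0)//; lra.
have := H x x0 xe; rewrite fev_shift1// (fev_eq0_at0 cc e'0 H) add0r.
by move/eqP; rewrite mulf_eq0 gt_eqF//= => /eqP.
Qed.

Lemma fev_inj c d (e : R) : conv c -> conv d -> 0 < e -> e <= 1 ->
  (forall x, 0 < x -> x < e -> fev c x = fev d x) -> c = d.
Proof.
move=> cc cd e0 e1 H; apply/eqP; rewrite -subr_eq0; apply/eqP.
apply: (fev_eq0 (convB cc cd) e0) => x x0 xe.
by rewrite fevB ?H ?subrr// ger0_norm ?(ltW x0)//; lra.
Qed.

End DiscSeries.

(** * Roots of unity *)

Section UnitCircle.
Context {R : realType}.
Local Notation C := (R[i]).
Local Open Scope complex_scope.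

Definition cis (t : R) : C := cos t +i* sin t.

Lemma cis0 : cis 0 = 1.
Proof. by rewrite /cis cos0 sin0. Qed.

Lemma cisD s t : cis (s + t) = cis s * cis t.
Proof.
rewrite /cis cosD sinD; simpc; congr (_ +i* _); ring.
Qed.

Lemma cisX t n : cis t ^+ n = cis (t * n%:R).
Proof.
elim: n => [|n IH]; first by rewrite mulr0 cis0.
by rewrite exprS IH -cisD -natr1 mulrDr mulr1 addrC.
Qed.

Lemma normc_cis t : normc (cis t) = 1.
Proof. by rewrite /= cos2Dsin2 sqrtr1. Qed.

Lemma cis2pi_nat n : cis (2 * pi * n%:R) = 1.
Proof.
elim: n => [|n IH]; first by rewrite mulr0 cis0.
have -> : 2 * pi * n.+1%:R = 2 * pi * n%:R + pi *+ 2 :> R.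
  by rewrite -[n.+1%:R]natr1 -[pi *+ 2]mulr_natl mulrDr mulr1.
by rewrite /cis cosD2pi sinD2pi.
Qed.

Lemma cis_neq1 (t : R) : 0 < t -> t < 2 * pi -> cis t != 1.
Proof.
move=> t0 t2; have s0 : 0 < sin (t / 2) by apply: sin_gt0_pi; lra.
apply/eqP => -[c1 _]; have : cos (t / 2 + t / 2) = 1 by rewrite -splitr.
rewrite cosD -[X in X - _]expr2 cos2sin2; nra.
Qed.

Lemma sum_cis N m : (0 < N)%N ->
  \sum_(k < N) cis (2 * pi * m%:R / N%:R) ^+ k =
    if (N %| m)%N then N%:R else 0 :> C.
Proof.
move=> N0; have Nn : N%:R != 0 :> R by rewrite pnatr_eq0 -lt0n.
have zN : cis (2 * pi * m%:R / N%:R) ^+ N = 1.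
  by rewrite cisX divfK// cis2pi_nat.
case: ifP => [/dvdnP[j ->]|Nm].
  have -> : 2 * pi * (j * N)%:R / N%:R = 2 * pi * j%:R :> R by rewrite natrM mulrA mulfK.
  rewrite cis2pi_nat; under eq_bigr do rewrite expr1n.
  by rewrite sumr_const card_ord.
have z1 : cis (2 * pi * m%:R / N%:R) != 1.
  have -> : 2 * pi * m%:R / N%:R = 2 * pi * (m %/ N)%:R + 2 * pi * (m %% N)%:R / N%:R :> R.
    by rewrite {1}(divn_eq m N) natrD natrM mulrDr mulrDl mulrA mulfK.
  have p0 := pi_gt0 R; have Np : 0 < N%:R :> R by rewrite ltr0n.
  have mp : 0 < (m %% N)%:R :> R.
    by rewrite ltr0n lt0n; apply/eqP => m0; rewrite /dvdn m0 eqxx in Nm.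
  rewrite cisD cis2pi_nat mul1r; apply: cis_neq1.
    by rewrite divr_gt0 ?mulr_gt0.
  rewrite ltr_pdivrMr// ltr_pM2l ?mulr_gt0// ltr_nat.
  exact: ltn_pmod.
apply/eqP; have := subrX1 (cis (2 * pi * m%:R / N%:R)) N.
by rewrite zN subrr => /esym/eqP; rewrite mulf_eq0 subr_eq0 (negbTE z1).
Qed.

End UnitCircle.

(** * Cauchy's estimate and Schwarz's lemma *)

Section MaximumPrinciple.
Context {R : realType}.
Local Notation C := (R[i]).
Local Open Scope complex_scope.
Implicit Types (c d : fps R) (p : C) (r s M : R).

Lemma csummable_sum (I : Type) (s : seq I) (f : I -> nat -> C) :
  (forall i, csummable (f i)) ->
  csummable (fun n => \sum_(i <- s) f i n) /\
  csum (fun n => \sum_(i <- s) f i n) = \sum_(i <- s) csum (f i).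
Proof.
move=> Sf; elim: s => [|i s [IH1 IH2]].
  rewrite (_ : (fun _ => _) = (fun=> 0)); last by apply/funext => n; rewrite big_nil.
  rewrite big_nil; split; last by rewrite (csum_seq (s := [::]))// big_nil.
  by apply: csummable_le (@asummable0 R _) => n; rewrite normc0.
rewrite (_ : (fun _ => _) = (fun n => f i n + \sum_(i <- s) f i n)); last first.
  by apply/funext => n; rewrite big_cons.
rewrite big_cons -IH2 csumD//; split=> //.
apply: csummable_le (asummableD (Sf i) IH1) => n; exact: le_normcD.
Qed.

Lemma tsum_tail_lt (f : nat -> R) (e : R) : asummable f -> (forall i, 0 <= f i) ->
  0 < e -> exists N0, forall N, (N0 <= N)%N ->
    tsum (fun i => if (i < N)%N then 0 else f i) < e.
Proof.
move=> Sf f0 e0.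
have dom N i : `|if (i < N)%N then 0 else f i| <= f i.
  by case: ifP; rewrite ?normr0 ?ger0_norm.
have [||_] := @tsum_cvg_dominated R _ (fun N i => if (i < N)%N then 0 else f i) (fun=> 0) f Sf.
- by near=> N => i.
- move=> i; apply: cvg_near_cst; near=> N.
  by rewrite ifT//; near: N; exact: nbhs_infty_gt.
rewrite tsum0 => /cvgrPdist_lt /(_ e e0) [N0 _ H]; exists N0 => N NN.
have := H N NN; rewrite sub0r normrN ger0_norm// tsum_ge0// => i.
by case: ifP.
Unshelve. all: by end_near. Qed.

(** The contour integral is replaced by the mean over the [N]-th roots of unity. It returns
    coefficient [j] together with those of index congruent to [j] modulo [N]. These lie in the tail
    of the series, and [N] is chosen so that the tail is smaller than the amount by which the
    estimate is supposed to fail. *)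
Lemma cauchy_estimate c r M j : conv c -> 0 <= r -> r < 1 ->
  (forall t, normc (cev c (r%:C * cis t)) <= M) -> `|c j| * r ^+ j <= M.
Proof.
move=> cc r0 r1 HM.
have Sc := conv_norm cc r0 r1.
have c0 i : 0 <= `|c i| * r ^+ i by rewrite mulr_ge0// exprn_ge0.
rewrite leNgt; apply/negP => lt.
have [|N0 HN] := @tsum_tail_lt _ (`|c j| * r ^+ j - M) Sc c0; first by rewrite subr_gt0.
pose N := maxn N0 j.+1.
have N1 : (0 < N)%N by rewrite /N leq_max orbT.
have jN : (j < N)%N by rewrite /N leq_max leqnn orbT.
have Nr : N%:R != 0 :> C by rewrite pnatr_eq0 -lt0n.
pose z : C := cis (2 * pi / N%:R).
have zE m k : cis (2 * pi * m%:R / N%:R) ^+ k = z ^+ (k * m).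
  by rewrite /z !cisX natrM; congr cis; ring.
have nz k : normc (z ^+ k) = 1 by rewrite /z cisX normc_cis.
have rz k : r%:C * z ^+ k = r%:C * cis (2 * pi / N%:R * k%:R) by rewrite /z cisX.
have nrz k : normc (r%:C * z ^+ k) < 1 by rewrite normcM nz mulr1 normc_real ger0_norm.
(* The factor [z ^+ (k * (N - j))] is [z] to the power [- k * j], since [z ^+ N = 1]. *)
pose A : C := \sum_(k < N) z ^+ (k * (N - j)) * cev c (r%:C * z ^+ k).
have nA : normc A <= N%:R * M.
  apply: (@le_trans _ _ (\sum_(k < N) M)); last by rewrite sumr_const card_ord mulr_natl.
  rewrite /A; elim/big_ind2: _ => [|x a y b xa yb|k _]; first by rewrite normc0.
    by rewrite (le_trans (le_normcD _ _))// lerD.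
  by rewrite normcM nz mul1r rz.
pose g i : C := if (N %| i + (N - j))%N then (c i * r ^+ i)%:C else 0.
have AE : A = N%:R * csum g.
  have Sk (k : 'I_N) : csummable (fun i => z ^+ (k * (N - j)) * ((c i)%:C * (r%:C * z ^+ k) ^+ i)).
    apply: csummable_le (conv_csummable cc (nrz k)) => i.
    by rewrite normcM nz mul1r.
  rewrite /A (eq_bigr (fun k : 'I_N => csum (fun i => z ^+ (k * (N - j)) * ((c i)%:C * (r%:C * z ^+ k) ^+ i)))); last first.
    by move=> k _; rewrite csumZ//; exact: conv_csummable.
  have [S <-] := csummable_sum (index_enum 'I_N) Sk.
  have Sg : csummable g.
    apply: csummable_le Sc => i; rewrite /g; case: ifP => _; last by rewrite normc0.
    by rewrite normc_real normrM (ger0_norm (exprn_ge0 _ r0)).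
  rewrite -csumZ//; apply: eq_csum => i.
  rewrite (eq_bigr (fun k : 'I_N => (c i * r ^+ i)%:C * cis (2 * pi * (i + (N - j))%:R / N%:R) ^+ k)); last first.
    move=> k _; rewrite zE exprMn -exprM mulnDr exprD rmorphM rmorphXn /=; ring.
  rewrite -mulr_sumr sum_cis// /g; case: ifP => _; last by rewrite !mulr0.
  by rewrite mulrC.
have gj : g j = (c j * r ^+ j)%:C by rewrite /g subnKC ?dvdnn// ltnW.
have gE i : g i = (if i == j then g j else 0) + (if i == j then 0 else g i).
  by have [->|] := eqVneq i j; rewrite ?addr0 ?add0r.
have Sg2 : csummable (fun i => if i == j then 0 else g i).
  apply: csummable_le Sc => i; case: ifP => _; rewrite ?normc0//.
  rewrite /g; case: ifP => _; rewrite ?normc0//.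
  by rewrite normc_real normrM (ger0_norm (exprn_ge0 _ r0)).
have Sg1 : csummable (fun i => if i == j then g j else 0).
  apply: (proj1 (asummable1 (t := j) _)) => i ij.
  by rewrite (negbTE ij) normc0.
have gs : csum g = g j + csum (fun i => if i == j then 0 else g i).
  rewrite (eq_csum gE) csumD//; congr (_ + _).
  rewrite (csum_seq (s := [:: j]))// ?big_seq1 ?eqxx// => i.
  by rewrite inE => /negbTE->.
have tail : normc (csum (fun i => if i == j then 0 else g i)) <
    `|c j| * r ^+ j - M.
  apply: le_lt_trans (HN N (leq_maxl _ _)).
  apply: le_trans (normc_csum_le Sg2) _; apply: le_tsum => // [|i].
    by apply: asummable_le Sc => i; case: ifP; rewrite ?normr0 ?(ger0_norm (c0 i)).
  have [->|ij] := eqVneq i j; first by rewrite ?eqxx normc0 jN.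
  rewrite /g; case: ifP => dv; last by rewrite normc0; case: ifP.
  (* [N] divides [i + N - j]; the quotient is not 0, quotient 1 means [i = j], and a larger one
     gives [i >= N + j]. *)
  have Ni : (i < N)%N = false.
    apply: contraNF ij => iN; move: dv => /dvdnP[[|[|q]]] E; [lia|apply/eqP; lia|].
    have := leq_mul2r N 2 q.+2; lia.
  by rewrite Ni normc_real normrM (ger0_norm (exprn_ge0 _ r0)).
have nN : normc (N%:R : C) = N%:R by rewrite -(rmorph_nat (real_complex R)) normc_real ger0_norm.
have : normc (csum g) <= M.
  have Np : 0 < N%:R :> R by rewrite ltr0n.
  by rewrite -(ler_pM2l Np) -{1}nN -normcM -AE.
have : normc (g j) <= normc (csum g) + normc (csum (fun i => if i == j then 0 else g i)).
  have -> : g j = csum g - csum (fun i => if i == j then 0 else g i) by rewrite gs addrK.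
  by rewrite (le_trans (le_normcD _ _))// normcN.
rewrite gj normc_real normrM (ger0_norm (exprn_ge0 _ r0)).
lra.
Qed.

(** Otherwise the powers of [a / b > 1] would be bounded by [K], against Bernoulli's inequality.
    Used to get rid of a constant by passing to high powers. *)
Lemma pow_le_le (a b K : R) : 0 <= a -> 0 <= b ->
  (forall n, a ^+ n <= K * b ^+ n) -> a <= b.
Proof.
move=> a0 b0 H; rewrite leNgt; apply/negP => ba.
have K0 : 1 <= K by have := H 0%N; rewrite !expr0 mulr1.
move: b0; rewrite le_eqVlt => /predU1P[b0|bp].
  by have := H 1%N; rewrite -b0 expr1 expr0n mulr0 leNgt b0 ba.
pose x := a / b - 1.
have x0 : 0 < x by rewrite subr_gt0 ltr_pdivlMr ?mul1r.
have ber n : 1 + n%:R * x <= (1 + x) ^+ n.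
  elim: n => [|n IH]; first by rewrite mul0r addr0.
  rewrite exprS -natr1; have n0 : 0 <= n%:R :> R by [].
  apply: le_trans (_ : (1 + x) * (1 + n%:R * x) <= _); last by rewrite ler_pM2l//; lra.
  by nra.
have nK n : 1 + n%:R * x <= K.
  apply: le_trans (ber n) _; rewrite addrC subrK expr_div_n ler_pdivrMr ?exprn_gt0//.
pose n := Num.truncn (K / x).
have := nK n.+1; rewrite leNgt => /negP; apply.
have : K / x < n.+1%:R by rewrite truncnS_gt.
by rewrite ltr_pdivrMr// => ?; lra.
Qed.

Lemma fcoefX_low c n j : c 0%N = 0 -> (j < n)%N -> (c ^+ n) j = 0.
Proof.
move=> c0; have -> : c = fX * fshift 1 c by rewrite -{1}[c]add0r {1}[c]fcoef_shift1 c0 rmorph0 !add0r.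
by move=> jn; rewrite exprMn fcoefXnM jn.
Qed.

Lemma geometric_tail_le (t : R) n : 0 <= t -> t < 1 ->
  asummable (fun i => if (i < n)%N then 0 else t ^+ i) /\
  tsum (fun i => if (i < n)%N then 0 else t ^+ i) <= t ^+ n / (1 - t).
Proof.
move=> t0 t1; have [Sg Eg] := asummable_geometric t0 t1.
have S : asummable (fun i => if (i < n)%N then 0 else t ^+ i).
  apply: asummable_le Sg => i; case: ifP; rewrite ?normr0 ?exprn_ge0//.
  by rewrite ger0_norm ?exprn_ge0.
split=> //.
have S2 : asummable ((fun i => if (i < n)%N then 0 else t ^+ i) \o addn n).
  by apply: asummable_inj S; exact: addnI.
rewrite (tsum_inj (e := addn n))//; first last.
- move=> u H; case: ltnP => // nu; have := H (u - n)%N.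
  by rewrite subnKC ?eqxx.
- exact: addnI.
rewrite (eq_tsum (g := fun i => t ^+ n * t ^+ i)); last first.
  by move=> i /=; rewrite ltnNge leq_addr /= exprD.
by rewrite tsumZ// ler_wpM2l ?exprn_ge0.
Qed.

(** Division by [p] is avoided. The power [c ^+ n] starts at degree [n], and its coefficients are at
    most [M ^+ n / r ^+ i], so [|c(p)|^n] is at most [(M |p| / r)^n] times a constant independent of
    [n]. The constant disappears by [pow_le_le]. *)
Lemma schwarz c r M p : conv c -> c 0%N = 0 -> 0 < r -> r < 1 ->
  (forall t, normc (cev c (r%:C * cis t)) <= M) -> normc p < r ->
  normc (cev c p) <= M * (normc p / r).
Proof.
move=> cc c0 r0 r1 HM pr.
have M0 : 0 <= M by apply: le_trans (HM 0); exact: normc_ge0.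
have p1 : normc p < 1 by exact: lt_trans r1.
set t := normc p / r.
have t0 : 0 <= t by rewrite divr_ge0 ?normc_ge0 ?ltW.
have t1 : t < 1 by rewrite ltr_pdivrMr ?mul1r.
apply: (@pow_le_le _ _ (1 - t)^-1) => [||n]; [exact: normc_ge0|exact: mulr_ge0|].
rewrite -normcX -cevX//; have cn := convX n cc.
apply: le_trans (normc_csum_le (conv_csummable cn p1)) _.
have [St Et] := geometric_tail_le n t0 t1.
have est j : `|(c ^+ n) j| * r ^+ j <= M ^+ n.
  apply: cauchy_estimate => //; first exact: ltW.
  move=> s; have rs : normc (r%:C * cis s) < 1.
    by rewrite normcM normc_cis mulr1 normc_real ger0_norm// ltW.
  by rewrite cevX// normcX; apply: lerXn2r; rewrite ?nnegrE ?normc_ge0.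
apply: le_trans (_ : tsum (fun i => M ^+ n * (if (i < n)%N then 0 else t ^+ i)) <= _).
  apply: le_tsum => [||i]; [exact: conv_csummable|exact: asummableZ|].
  case: ltnP => ni; first by rewrite fcoefX_low// rmorph0 mul0r normc0 mulr0.
  rewrite normcM normc_real normcX.
  have ri : 0 < r ^+ i by rewrite exprn_gt0.
  have -> : normc p ^+ i = r ^+ i * t ^+ i by rewrite -exprMn /t mulrC divfK ?gt_eqF.
  by rewrite mulrA ler_wpM2r ?exprn_ge0.
rewrite tsumZ// exprMn.
apply: le_trans (_ : M ^+ n * (t ^+ n / (1 - t)) <= _).
  by rewrite ler_wpM2l ?exprn_ge0.
by rewrite [leRHS]mulrC mulrA.
Qed.

End MaximumPrinciple.

(** * The complex exponential as a power series *)

Section ComplexExponential.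
Context {R : realType}.
Local Notation C := (R[i]).
Local Open Scope complex_scope.

Lemma tsum_series (f : nat -> R) : asummable f -> series f @ \oo --> tsum f.
Proof.
move=> Sf.
have [||_] := @tsum_cvg_dominated R _ (fun N i => if (i < N)%N then f i else 0) f
  (fun i => `|f i|) (asummable_norm Sf).
- by near=> N => i; case: ifP; rewrite ?normr0.
- move=> i; apply: cvg_near_cst; near=> N.
  by rewrite ifT//; near: N; exact: nbhs_infty_gt.
apply: cvg_trans; apply: near_eq_cvg; near=> N.
have [|_ ->] := @tsum_seq R _ (iota 0 N) (fun i => if (i < N)%N then f i else 0) (iota_uniq _ _).
  by move=> i; rewrite mem_iota /= => /negbTE->.
rewrite /series /= /index_iota subn0; apply: eq_big_seq => i.
by rewrite mem_iota /= => ->.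
Unshelve. all: by end_near. Qed.

Lemma exp_coeff_sum (x : R) : asummable (exp_coeff x) /\ tsum (exp_coeff x) = expR x.
Proof.
have S : asummable (exp_coeff x).
  apply: asummable_normP.
  apply: (proj1 (@tsum_nat_le R (fun i => `|exp_coeff x i|) (expR `|x|) _ _)) => // N.
  rewrite (eq_bigr (fun i : 'I_N => exp_coeff `|x| i)); last first.
    by move=> i _; rewrite /exp_coeff /= normrM normrX normfV (ger0_norm (ler0n _ _)).
  rewrite -(big_mkord xpredT (exp_coeff `|x|)).
  apply: (nondecreasing_cvgn_le _ (is_cvg_series_exp_coeff `|x|)).
  apply/nondecreasing_seqP => n; rewrite /series /= big_nat_recr//= lerDl.
  exact: exp_coeff_ge0.
split=> //; apply: cvg_unique (tsum_series S) _ => //.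
exact: is_cvg_series_exp_coeff.
Qed.

Definition cexp (z : C) : C := csum (fun n => (n`!%:R^-1 : R)%:C * z ^+ n).

Lemma csummable_cexp (z : C) : csummable (fun n => (n`!%:R^-1 : R)%:C * z ^+ n).
Proof.
apply: csummable_le (exp_coeff_sum (normc z)).1 => n.
by rewrite normcM normcX normc_real /exp_coeff /= mulrC ger0_norm// invr_ge0.
Qed.

Lemma cexpD (y z : C) : cexp (y + z) = cexp y * cexp z.
Proof.
have [S <-] := csum_mul (csummable_cexp y) (csummable_cexp z).
rewrite csum_antidiag//; apply: eq_csum => n /=.
rewrite addrC exprDn mulr_sumr; apply: eq_bigr => i _.
have iN : (i <= n)%N by rewrite -ltnS.
have fE : (n`!%:R^-1 * 'C(n, i)%:R : R) = i`!%:R^-1 * (n - i)`!%:R^-1.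
  have nz k : k`!%:R != 0 :> R by rewrite pnatr_eq0 -lt0n fact_gt0.
  rewrite -(bin_fact iN) 2!natrM !invfM mulrAC mulVf ?mul1r// pnatr_eq0 -lt0n.
  by rewrite bin_gt0.
rewrite mulrnAr -mulrnAl -rmorphMn -mulr_natr fE rmorphM -!mulrA; congr (_ * _).
by rewrite [LHS]mulrA [LHS]mulrC.
Qed.

Lemma complexi_pow n : ('i : C) ^+ n =
  ((~~ odd n)%:R * (-1) ^+ n./2) +i* ((odd n)%:R * (-1) ^+ n.-1./2).
Proof.
have e k : ('i : C) ^+ k.*2 = ((-1) ^+ k)%:C.
  by rewrite -mul2n exprM sqr_i rmorphXn rmorphN rmorph1.
rewrite -{1}(odd_double_half n); case: (boolP (odd n)) => on.
  have -> : n.-1./2 = n./2 by lia.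
  by rewrite add1n exprS e /=; simpc.
by rewrite add0n e /=; simpc.
Qed.

Lemma cexpi (b : R) : cexp (0 +i* b) = cis b.
Proof.
have bE : (0 +i* b : C) = b%:C * 'i by simpc.
have S := csummable_cexp (0 +i* b).
have E n : (n`!%:R^-1 : R)%:C * (0 +i* b) ^+ n = cos_coeff b n +i* sin_coeff b n :> C.
  rewrite bE exprMn -rmorphXn complexi_pow mulrA -rmorphM; simpc.
  rewrite /cos_coeff /sin_coeff /=; rewrite -?exprnP; congr (_ +i* _); ring.
rewrite /cexp /csum /cis; congr (_ +i* _).
  rewrite cos.unlock; apply/esym/cvg_lim => //.
  rewrite (_ : cos_coeff b = (fun n => complex.Re ((n`!%:R^-1 : R)%:C * (0 +i* b) ^+ n))).
    exact: tsum_series (csummable_Re S).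
  by apply/funext => n; rewrite E.
rewrite sin.unlock; apply/esym/cvg_lim => //.
rewrite (_ : sin_coeff b = (fun n => complex.Im ((n`!%:R^-1 : R)%:C * (0 +i* b) ^+ n))).
  exact: tsum_series (csummable_Im S).
by apply/funext => n; rewrite E.
Qed.

Lemma cexpE (a b : R) : cexp (a +i* b) = (expR a)%:C * cis b.
Proof.
have -> : (a +i* b : C) = a%:C + (0 +i* b) by simpc.
rewrite cexpD cexpi; congr (_ * _); rewrite /cexp.
rewrite -(exp_coeff_sum a).2 -csum_real; apply: eq_csum => n.
by rewrite /exp_coeff /= mulrC rmorphM rmorphXn.
Qed.

End ComplexExponential.

(** * Composition of series and the Cayley transform *)

Section Composition.
Context {R : realType}.
Local Notation C := (R[i]).
Local Open Scope complex_scope.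
Implicit Types (c d e : fps R) (p : C) (r : R).

Definition fnorm d r := tsum (fun i => `|d i| * r ^+ i).

Lemma fnorm_ge0 d r : 0 <= r -> 0 <= fnorm d r.
Proof. by move=> r0; apply: tsum_ge0 => i; rewrite mulr_ge0 ?exprn_ge0. Qed.

Lemma fnormX_le d r m : conv d -> 0 <= r -> r < 1 ->
  fnorm (d ^+ m) r <= fnorm d r ^+ m.
Proof.
move=> cd r0 r1; pose a : fps R := Fps (fun i => `|d i|).
have ca : conv a.
  by move=> s s0 s1; exact: conv_norm.
have le k i : `|(d ^+ k) i| <= (a ^+ k) i.
  elim: k i => [|k IH] i; first by rewrite !expr0 fcoef1 ger0_norm.
  rewrite !exprS !fcoefM (le_trans (ler_norm_sum _ _ _))// ler_sum// => j _.
  by rewrite normrM ler_wpM2l.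
have rn : `|r| < 1 by rewrite ger0_norm.
rewrite -[X in _ <= X ^+ _]/(fev a r) -fevX//.
apply: le_tsum => [||i].
- by apply: conv_norm => //; exact: convX.
- by apply: conv_summable => //; exact: convX.
- by rewrite ler_wpM2r ?exprn_ge0.
Qed.

(** Composition in the analytic sense: [e] may have a nonzero constant term, so every coefficient is
    an infinite sum and convergence has to be proved. *)
Definition fcomp c e := Fps (fun j => tsum (fun m => c m * (e ^+ m) j)).

Lemma fcomp_spec c e : conv e ->
  (forall r, 0 <= r -> r < 1 -> asummable (fun m => `|c m| * fnorm (e ^+ m) r)) ->
  conv (fcomp c e) /\
  forall p, normc p < 1 ->
    cev (fcomp c e) p = csum (fun m => (c m)%:C * cev e p ^+ m).
Proof.
move=> ce H.
have Sr r : 0 <= r -> r < 1 -> asummable (fun x : nat * nat => c x.1 * ((e ^+ x.1) x.2 * r ^+ x.2)).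
  move=> r0 r1; have cm m := conv_norm (convX m ce) r0 r1.
  have cm' m := convX m ce r0 r1.
  apply: asummable_iter => [m /=|/=]; first exact: asummableZ.
  apply: asummable_le (H r r0 r1) => m.
  rewrite ger0_norm; last by apply: tsum_ge0.
  rewrite /fnorm -tsumZ//; apply: le_tsum => [||i].
  - by apply: asummable_norm; exact: asummableZ.
  - exact: asummableZ.
  - by rewrite normrM normrM (ger0_norm (exprn_ge0 _ r0)).
have Sc j : asummable (fun m => c m * (e ^+ m) j).
  have [] := @tsum_iter R _ _ _ (asummable_swap (Sr 2^-1 _ _)) => [||/(_ j) S _ _]; [by []|lra|].
  have := asummable_norm (asummableZr (2^-1 ^- j) S); apply: asummable_le => m /=.
  have h0 : (2^-1 : R) ^+ j != 0 by rewrite expf_neq0// invr_eq0 pnatr_eq0.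
  by rewrite mulrA mulfK.
split.
  apply: convI => r r0 r1; have [_ + _] := tsum_iter (asummable_swap (Sr r (ltW r0) r1)).
  move=> /asummable_norm; apply: asummable_le => j /=; rewrite -tsumZr// le_eqVlt; apply/orP; left; apply/eqP.
  by congr Num.norm; apply: eq_tsum => m; rewrite mulrA.
move=> p p1; have p0 := normc_ge0 p.
have S : csummable (fun x : nat * nat => (c x.1)%:C * (((e ^+ x.1) x.2)%:C * p ^+ x.2)).
  apply: asummable_le (asummable_norm (Sr _ p0 p1)) => x.
  by rewrite ger0_norm ?normc_ge0// !normcM !normc_real normcX !normrM
    (ger0_norm (exprn_ge0 _ p0)).
transitivity (csum (fun j => csum (fun m => (c m)%:C * (((e ^+ m) j)%:C * p ^+ j)))).
  apply: eq_csum => j; rewrite /= -csum_real mulrC -csumZ.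
    by apply: eq_csum => m; rewrite rmorphM /=; ring.
  by apply: csummable_le (asummable_norm (Sc j)) => m; rewrite normc_real.
rewrite -(csum_exchange S); apply: eq_csum => m.
rewrite csumZ; last by apply: conv_csummable => //; exact: convX.
by rewrite -cevX.
Qed.

(** The expansion of [(1 + p) / (1 - p)], which maps the unit disc onto the right half-plane. *)
Definition cayley : fps R := Fps (fun i => if i is 0%N then 1 else 2).

Lemma conv_cayley : conv cayley.
Proof.
move=> r r0 r1; apply: asummable_le (asummableZ 2 (asummable_geometric r0 r1).1) => i.
rewrite normrM (ger0_norm (exprn_ge0 _ r0)) ler_wpM2r ?exprn_ge0//.
by case: i => [|i] /=; rewrite ger0_norm// ler1n.
Qed.

Lemma cev_cayley p : normc p < 1 -> cev cayley p = (1 + p) / (1 - p).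
Proof.
move=> p1; have np1 : 1 - p != 0.
  rewrite subr_eq0; apply/eqP => p1'; move: p1.
  by rewrite -p1' -[normc 1]/(normc 1%:C) normc_real normr1 ltxx.
apply: (mulIf np1); rewrite divfK//.
have cX : conv (1 - fX : fps R) by apply: convB; [exact: conv1|exact: conv_fX].
have -> : 1 - p = cev (1 - fX : fps R) p.
  rewrite cevD//; [|exact: conv1|by apply: convN; exact: conv_fX].
  rewrite -[(1 : fps R)]/(fC 1) cev_fC; congr (_ + _).
  rewrite -{1}(cev_fX p) /cev -[LHS]mulN1r -csumZ; last by apply: conv_csummable => //; exact: conv_fX.
  by apply: eq_csum => i; rewrite fcoefN rmorphN mulrA mulN1r.
rewrite -cevM//; last exact: conv_cayley.
have -> : cayley * (1 - fX) = 1 + fX.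
  rewrite mulrBr mulr1 mulrC; apply: fpsP => i.
  rewrite fcoefB fcoefXM fcoefD fcoef1; case: i => [|[|i]] /=; lra.
rewrite cevD//; [|exact: conv1|exact: conv_fX].
by rewrite cev_fX -[(1 : fps R)]/(fC 1) cev_fC.
Qed.

Lemma cevE c p : cev c p = csum (fun i => (c i)%:C * p ^+ i).
Proof. by []. Qed.

Local Opaque cev fev expR.

(** This is [exp (i k tau)] at [tau = x + i y]: the nome for [k = pi], and its fourth root, the
    local variable at the other cusp, for [k = pi / 4]. *)
Definition halfplane_pt (k x y : R) : C := (expR (- (k * y)))%:C * cis (k * x).

Lemma normc_halfplane_pt k x y : normc (halfplane_pt k x y) = expR (- (k * y)).
Proof. by rewrite normcM normc_cis mulr1 normc_real ger0_norm ?expR_ge0. Qed.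

Lemma halfplane_pt0 k y : halfplane_pt k 0 y = (expR (- (k * y)))%:C.
Proof. by rewrite /halfplane_pt mulr0 cis0 mulr1. Qed.

Lemma cexp_halfplane_pt k x y :
  cexp ((- (k * y)) +i* (k * x)) = halfplane_pt k x y.
Proof. exact: cexpE. Qed.

Local Opaque halfplane_pt.

Definition inv_fact : fps R := Fps (fun n => n`!%:R^-1).

(** The function [exp (i k tau)] in the disc variable [p], where [tau = i (1 + p) / (1 - p)]. *)
Definition disc_nome k : fps R := fcomp inv_fact (fC (- k) * cayley).

Lemma disc_nome_spec k : conv (disc_nome k) /\
  forall p u v, normc p < 1 -> (1 + p) / (1 - p) = u +i* v ->
    cev (disc_nome k) p = halfplane_pt k (- v) u.
Proof.
have cB : conv (fC (- k) * cayley) by apply: convM; [exact: conv_fC|exact: conv_cayley].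
have [|cE EE] := @fcomp_spec inv_fact _ cB.
  move=> r r0 r1; have := (exp_coeff_sum (fnorm (fC (- k) * cayley) r)).1.
  apply: asummable_le => m; rewrite ger0_norm ?mulr_ge0 ?fnorm_ge0//.
  rewrite /exp_coeff /= mulrC ger0_norm ?invr_ge0// ler_wpM2r ?invr_ge0//.
  exact: fnormX_le.
split=> // p u v p1 E; rewrite (EE p p1) -/(cexp _).
rewrite cevM//; [|exact: conv_fC|exact: conv_cayley].
rewrite cev_fC cev_cayley// E.
have -> : (- k)%:C * (u +i* v) = (- (k * u)) +i* (k * (- v)) :> C by simpc; congr (_ +i* _); ring.
exact: cexp_halfplane_pt.
Qed.

Lemma normc_lt1_sqr (a b : R) : normc (a +i* b) < 1 -> a ^+ 2 + b ^+ 2 < 1.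
Proof.
move=> /= H; rewrite -[X in X < _]sqr_sqrtr ?addr_ge0 ?sqr_ge0// -[1](expr1n _ 2).
by apply: ltrXn2r; rewrite ?nnegrE ?sqrtr_ge0.
Qed.

Lemma cayleyE (a b : R) : a ^+ 2 + b ^+ 2 < 1 ->
  (1 + (a +i* b)) / (1 - (a +i* b)) =
  ((1 - a ^+ 2 - b ^+ 2) / ((1 - a) ^+ 2 + b ^+ 2)) +i*
  (2 * b / ((1 - a) ^+ 2 + b ^+ 2)) :> C.
Proof.
move=> ab; have D0 : (1 - a) ^+ 2 + b ^+ 2 != 0.
  apply/eqP => D; have := sqr_ge0 (1 - a); have := sqr_ge0 b; nra.
have np : 1 - (a +i* b) != 0 :> C.
  apply: contra D0; rewrite eq_complex /= => /andP[/eqP a1 /eqP b1].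
  by rewrite a1 -[b]opprK -[- b]add0r b1 oppr0 expr0n addr0.
apply: (mulIf np); rewrite divfK//.
have -> : 1 = 1 +i* 0 :> C by [].
by simpc; congr (_ +i* _); field.
Qed.

(** The real part is [(1 - |p|^2) / |1 - p|^2], and the denominator is at most 4. *)
Lemma cayley_Re_ge (p : C) s u v : normc p <= s -> s < 1 ->
  (1 + p) / (1 - p) = u +i* v -> (1 - s ^+ 2) / 4 <= u.
Proof.
case: p => a b ps s1; have s0 : 0 <= s by exact: le_trans (normc_ge0 _) ps.
have ab1 := normc_lt1_sqr (le_lt_trans ps s1).
have ab : a ^+ 2 + b ^+ 2 <= s ^+ 2.
  rewrite -[X in X <= _]sqr_sqrtr ?addr_ge0 ?sqr_ge0//.
  by apply: lerXn2r; rewrite ?nnegrE ?sqrtr_ge0.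
rewrite cayleyE// => -[<- _].
have D0 : 0 < (1 - a) ^+ 2 + b ^+ 2.
  rewrite lt0r addr_ge0 ?sqr_ge0// andbT; apply/eqP => D.
  have := sqr_ge0 (1 - a); have := sqr_ge0 b; nra.
rewrite ler_pdivlMr// mulrAC ler_pdivrMr//.
apply: (@le_trans _ _ ((1 - s ^+ 2) * 4)); last by rewrite ler_wpM2r//; lra.
rewrite ler_wpM2l//; last by have := sqr_ge0 (1 + a); nra.
by rewrite subr_ge0; nra.
Qed.

(** On a circle of radius [s] between [r] and 1 the modulus of [disc_nome k] is at most some
    [rho < 1]. Cauchy's estimate then bounds the coefficients of its [m]-th power by
    [rho ^+ m / s ^+ j], and the double series is dominated by the product of the series of [c] at
    [rho] and a geometric series in [r / s]. *)
Lemma disc_nome_comp k c : 0 < k -> conv c ->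
  conv (fcomp c (disc_nome k)) /\
  forall p u v, normc p < 1 -> (1 + p) / (1 - p) = u +i* v ->
    cev (fcomp c (disc_nome k)) p = cev c (halfplane_pt k (- v) u).
Proof.
move=> k0 cc; have [cE EE] := disc_nome_spec k.
have [r r0 r1|cF FE] := @fcomp_spec c _ cE; last first.
  split; first exact: cF.
  move=> p u v p1 E.
  rewrite -(EE _ _ _ p1 E).
  by apply: etrans (FE p p1) _; rewrite cevE.
pose s := (r + 1) / 2.
have s0 : 0 < s by rewrite /s; lra.
have s1 : s < 1 by rewrite /s; lra.
have rs : r < s by rewrite /s; lra.
pose rho := expR (- (k * ((1 - s ^+ 2) / 4))).
have rho1 : rho < 1.
  by rewrite expR_lt1 oppr_lt0 mulr_gt0// divr_gt0// subr_gt0 expr_lt1 ?ltW.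
have rho0 : 0 <= rho by exact: expR_ge0.
have bound m j : `|(disc_nome k ^+ m) j| * s ^+ j <= rho ^+ m.
  apply: cauchy_estimate => //; [exact: convX|exact: ltW|move=> t].
  have ns : normc (s%:C * cis t) = s by rewrite normcM normc_cis mulr1 normc_real gtr0_norm.
  have p1 : normc (s%:C * cis t) < 1 by rewrite ns.
  rewrite cevX// normcX; apply: lerXn2r; rewrite ?nnegrE ?normc_ge0//.
  case E : ((1 + s%:C * cis t) / (1 - s%:C * cis t)) => [u v].
  rewrite (EE _ _ _ p1 E) normc_halfplane_pt ler_expR lerN2 ler_pM2l//.
  by apply: cayley_Re_ge E => //; rewrite ns.
have t0 : 0 <= r / s by rewrite divr_ge0// ltW.
have t1 : r / s < 1 by rewrite ltr_pdivrMr// mul1r.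
have [Sg _] := asummable_geometric t0 t1.
apply: asummable_le (asummableZr (tsum (fun i => (r / s) ^+ i)) (conv_norm cc rho0 rho1)) => m.
rewrite normrM normr_id (ger0_norm (fnorm_ge0 _ _))// -mulrA ler_wpM2l//.
rewrite -tsumZ//; apply: le_tsum => [||i]; last first.
- have si : 0 < s ^+ i by rewrite exprn_gt0.
  have -> : r ^+ i = s ^+ i * (r / s) ^+ i by rewrite -exprMn mulrC divfK ?gt_eqF.
  by rewrite mulrA ler_wpM2r ?exprn_ge0.
- exact: asummableZ.
- by apply: conv_norm => //; exact: convX.
Qed.

Local Opaque disc_nome fcomp.

(* Both sides, pulled back to the unit disc by the Cayley transform, become power
   series, so their equality propagates from the imaginary axis to the half plane. *)
Lemma halfplane_continuation k l c d : 0 < k -> 0 < l -> conv c -> conv d ->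
  (forall y, 0 < y -> fev c (expR (- (k * y))) = fev d (expR (- (l / y)))) ->
  forall x y, 0 < y -> cev c (halfplane_pt k x y) =
    cev d (halfplane_pt l (- x / (x ^+ 2 + y ^+ 2)) (y / (x ^+ 2 + y ^+ 2))).
Proof.
move=> k0 l0 cc cd H.
have [cE EE] := disc_nome_comp k0 cc; have [dE DE] := disc_nome_comp l0 cd.
have real_pt m y : halfplane_pt m 0 y = (expR (- (m * y)))%:C.
  exact: halfplane_pt0.
(* In the disc variable the inversion [tau -> -1/tau] is [p -> -p], because it sends
   [(1 + p) / (1 - p)] to its inverse. *)
have key : fcomp c (disc_nome k) = fneg (fcomp d (disc_nome l)).
  apply: (@fev_inj R _ _ 1) => //; first exact: conv_fneg.
  move=> w w0 w1; rewrite fev_fneg.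
  have wn : normc w%:C < 1 by rewrite normc_real gtr0_norm.
  have wn' : normc (- w)%:C < 1 by rewrite normc_real normrN gtr0_norm.
  have E (a : R) : `|a| < 1 -> (1 + a%:C) / (1 - a%:C) = ((1 + a) / (1 - a)) +i* 0 :> C.
    move=> a1; rewrite -[0 in RHS]/(0 : R) complexr0 rmorphM fmorphV rmorphD rmorphB rmorph1.
    by [].
  have L : fev (fcomp c (disc_nome k)) w = fev c (expR (- (k * ((1 + w) / (1 - w))))).
    apply: (@complexI R); rewrite -!cev_real.
    have w1' : `|w| < 1 by rewrite gtr0_norm.
    by rewrite (EE _ _ _ wn (E w w1')) oppr0 real_pt.
  have L' : fev (fcomp d (disc_nome l)) (- w) = fev d (expR (- (l * ((1 - w) / (1 + w))))).
    apply: (@complexI R); rewrite -!cev_real.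
    have w1' : `|- w| < 1 by rewrite normrN gtr0_norm.
    by rewrite (DE _ _ _ wn' (E (- w) w1')) oppr0 opprK real_pt.
  have y0 : 0 < (1 + w) / (1 - w) by apply: divr_gt0; lra.
  by apply: (etrans L); apply: etrans (esym L'); rewrite (H _ y0) invf_div.
move=> x y y0; pose D := x ^+ 2 + (y + 1) ^+ 2.
have D0 : 0 < D by rewrite ltr_wpDl ?sqr_ge0// exprn_gt0//; lra.
have N0 : 0 < x ^+ 2 + y ^+ 2 by rewrite ltr_wpDl ?sqr_ge0// exprn_gt0.
(* The preimage [(w - 1) / (w + 1)] of [w = y - i x] under the Cayley transform. *)
pose a := (x ^+ 2 + y ^+ 2 - 1) / D; pose b := - (2 * x) / D.
have ab : a ^+ 2 + b ^+ 2 < 1.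
  rewrite /a /b !expr_div_n -mulrDl ltr_pdivrMr ?exprn_gt0// mul1r /D; nra.
have p1 : normc (a +i* b) < 1 by rewrite /= -sqrtr1 ltr_sqrt.
have p1' : normc (- (a +i* b)) < 1 by rewrite normcN.
have Dn : D != 0 by rewrite gt_eqF.
have Nn : x ^+ 2 + y ^+ 2 != 0 by rewrite gt_eqF.
have num : 1 - a ^+ 2 - b ^+ 2 = 4 * y / D.
  by apply: (mulIf (expf_neq0 2 Dn)); rewrite /a /b /D; field; exact: Dn.
have den1 : (1 - a) ^+ 2 + b ^+ 2 = 4 / D.
  by apply: (mulIf (expf_neq0 2 Dn)); rewrite /a /b /D; field; exact: Dn.
have den2 : (1 - - a) ^+ 2 + b ^+ 2 = 4 * (x ^+ 2 + y ^+ 2) / D.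
  by apply: (mulIf (expf_neq0 2 Dn)); rewrite /a /b /D; field; exact: Dn.
have E1 : (1 + (a +i* b)) / (1 - (a +i* b)) = y +i* (- x) :> C.
  by rewrite cayleyE// num den1 /b; congr (_ +i* _); field.
have E2 : (1 + - (a +i* b)) / (1 - - (a +i* b)) =
    (y / (x ^+ 2 + y ^+ 2)) +i* (x / (x ^+ 2 + y ^+ 2)) :> C.
  rewrite -[- (a +i* b)]/((- a) +i* (- b)) cayleyE ?sqrrN//.
  by rewrite num den2 /b; congr (_ +i* _); field; rewrite Nn Dn.
rewrite -[x in LHS]opprK -(EE _ _ _ p1 E1) mulNr -(DE _ _ _ p1' E2) key.
rewrite !cevE; apply: eq_csum => i /=.
by rewrite [in RHS]exprNn rmorphM rmorphXn rmorphN rmorph1 mulrCA mulrA.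
Qed.

End Composition.

(** * The maximum principle for the theta group *)

Section ModularLiouville.
Context {R : realType}.
Local Open Scope complex_scope.
Implicit Types (c d : fps R) (x y M k : R).

Local Opaque cev fev expR.

Lemma halfplane_pt_translate x y : halfplane_pt pi (x + 1) y = - halfplane_pt pi x y.
Proof.
rewrite /halfplane_pt mulrDr mulr1 cisD mulrA.
have -> : cis pi = -1 :> R[i] by rewrite /cis cospi sinpi; simpc.
by rewrite mulrN1.
Qed.

Lemma cev_fneg c (p : R[i]) : cev (fneg c) p = cev c (- p).
Proof.
rewrite !cevE; apply: eq_csum => i /=.
by rewrite [in RHS]exprNn rmorphM rmorphXn rmorphN rmorph1 mulrCA mulrA.
Qed.

Lemma halfplane_pt_polar k y t : 0 < k ->
  (expR (- (k * y)))%:C * cis t = halfplane_pt k (t / k) y.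
Proof. by move=> k0; rewrite /halfplane_pt mulrCA divff ?mulr1// gt_eqF. Qed.

Local Opaque halfplane_pt.

Definition on_halfplane c k x y := cev c (halfplane_pt k x y).

(** A horizontal line is a circle for [exp (i k tau)], so a function vanishing at the cusp decays
    exponentially above any line on which it is bounded. *)
Lemma schwarz_halfplane c k M y0 y x : 0 < k -> conv c -> c 0%N = 0 ->
  0 < y0 -> y0 < y ->
  (forall x, normc (on_halfplane c k x y0) <= M) ->
  normc (on_halfplane c k x y) <= M * expR (- (k * (y - y0))).
Proof.
move=> k0 cc c0 y00 yy HM.
have r1 : expR (- (k * y0)) < 1 by rewrite expR_lt1 oppr_lt0 mulr_gt0.
have := @schwarz R c (expR (- (k * y0))) M (halfplane_pt k x y) cc c0 (expR_gt0 _) r1.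
rewrite normc_halfplane_pt ltr_expR ltrN2 ltr_pM2l// => /(_ _ yy).
rewrite -expRN -expRD; have -> : - (k * y) + - - (k * y0) = - (k * (y - y0)) by ring.
by apply => t; rewrite halfplane_pt_polar//; exact: HM.
Qed.

Lemma fev_eq0_halfplane c k y0 : 0 < k -> conv c ->
  (forall y, y0 <= y -> on_halfplane c k 0 y = 0) -> c = 0.
Proof.
move=> k0 cc H; apply: (@fev_eq0 _ _ (expR (- (k * y0)))) => //; first exact: expR_gt0.
move=> q q0 qr; apply: (@complexI R); rewrite -cev_real.
have qE : q = expR (- (k * (- ln q / k))).
  by rewrite mulrC divfK ?gt_eqF// opprK lnK.
rewrite qE -halfplane_pt0 -/(on_halfplane _ _ _ _) H// ler_pdivlMr// lerNr mulrC.
by rewrite -(expRK (- (k * y0))) ler_ln ?posrE ?expR_gt0// ltW.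
Qed.

Definition sqmod x y := x ^+ 2 + y ^+ 2.

Lemma normc_on_halfplane_le c k x y r : conv c -> expR (- (k * y)) <= r ->
  r < 1 -> normc (on_halfplane c k x y) <= tsum (fun i => `|c i| * r ^+ i).
Proof. by move=> cc le r1; apply: normc_cev_le; rewrite ?normc_halfplane_pt. Qed.

Lemma on_halfplane_translate c x y :
  on_halfplane c pi (x + 1) y = on_halfplane (fneg c) pi x y.
Proof. by rewrite /on_halfplane halfplane_pt_translate cev_fneg. Qed.

Section Functions.
Variables (c d : fps R).
Hypotheses (cc : conv c) (cd : conv d) (c0 : c 0%N = 0) (d0 : d 0%N = 0).
Hypothesis inv_c : forall y, 0 < y ->
  fev c (expR (- (pi * y))) = fev c (expR (- (pi / y))).
Hypothesis inv_d : forall y, 0 < y ->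
  fev (fneg c) (expR (- (pi * y))) = fev d (expR (- (pi / 4 / y))).

(** Translation by 1 exchanges [G0] and [G1] and fixes [G2]; inversion fixes [G0] and exchanges [G1]
    and [G2]. A common bound for the three is therefore a bound invariant under the full modular
    group. *)
Local Notation G0 := (on_halfplane c pi).
Local Notation G1 := (on_halfplane (fneg c) pi).
Local Notation G2 := (on_halfplane d (pi / 4)).
Local Notation N := sqmod.

Let pi4 : 0 < pi / 4 :> R. Proof. by rewrite divr_gt0// pi_gt0. Qed.

Let N_gt0 x y : 0 < y -> 0 < N x y.
Proof. by move=> y0; rewrite /sqmod ltr_wpDl ?sqr_ge0// exprn_gt0. Qed.

Let G0T x y : G0 (x + 1) y = G1 x y.
Proof. exact: on_halfplane_translate. Qed.

Let G1T x y : G1 (x + 1) y = G0 x y.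
Proof. by rewrite on_halfplane_translate fnegK. Qed.

Let G0S x y : 0 < y -> G0 x y = G0 (- x / N x y) (y / N x y).
Proof. exact: (halfplane_continuation (pi_gt0 R) (pi_gt0 R) cc cc inv_c). Qed.

Let G1S x y : 0 < y -> G1 x y = G2 (- x / N x y) (y / N x y).
Proof. exact: (halfplane_continuation (pi_gt0 R) pi4 (conv_fneg cc) cd inv_d). Qed.

Let NS x y : 0 < y -> N (- x / N x y) (y / N x y) = (N x y)^-1.
Proof.
move=> y0; have := N_gt0 x y0 => /gt_eqF/negbT Nn; move: (Nn); rewrite /sqmod => Nn'.
by field.
Qed.

Let SS x y : 0 < y ->
  - (- x / N x y) / N (- x / N x y) (y / N x y) = x /\
  (y / N x y) / N (- x / N x y) (y / N x y) = y.
Proof.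
move=> y0; have := N_gt0 x y0 => /gt_eqF/negbT Nn.
by rewrite NS// !invrK !mulNr opprK !divfK.
Qed.

Let G2S x y : 0 < y -> G2 x y = G1 (- x / N x y) (y / N x y).
Proof.
move=> y0; have y'0 : 0 < y / N x y by rewrite divr_gt0// N_gt0.
by have [Ex Ey] := SS x y0; rewrite (G1S _ y'0) Ex Ey.
Qed.

(* The relation (ST)^3 = 1 forces d to be invariant under translation by 1. *)
Let G2T x y : 0 < y -> G2 (x + 1) y = G2 x y.
Proof.
move=> y0; have Np := N_gt0 x y0; have Mp := N_gt0 (x + 1) y0.
have yM : 0 < y / N (x + 1) y by rewrite divr_gt0.
have Nn := negbT (gt_eqF Np); have Mn := negbT (gt_eqF Mp).
have NE : N (- (x + 1) / N (x + 1) y + 1) (y / N (x + 1) y) = N x y / N (x + 1) y.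
  by apply: (mulIf (expf_neq0 2 Mn)); move: Mn; rewrite /sqmod => Mn; field.
have -> : G2 x y = G0 (- x / N x y - 1) (y / N x y) by rewrite (G2S x y0) -G1T subrK.
rewrite (G2S _ y0) -G0T (G0S _ yM) NE.
have -> : - (- (x + 1) / N (x + 1) y + 1) / (N x y / N (x + 1) y) = - x / N x y - 1.
  by move: Nn Mn; rewrite /sqmod => Nn Mn; field; rewrite Nn Mn.
by congr (G0 _ _); rewrite invf_div mulrA divfK.
Qed.

Local Opaque on_halfplane.

Let bounded M x y :=
  [/\ normc (G0 x y) <= M, normc (G1 x y) <= M & normc (G2 x y) <= M].

Let bounded_translate M x y (n : int) : 0 < y -> bounded M (x + n%:~R) y -> bounded M x y.
Proof.
move=> y0; have up u : bounded M (u + 1) y -> bounded M u y.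
  by case; rewrite G0T G1T G2T.
have down u : bounded M u y -> bounded M (u + 1) y.
  by case=> ? ? ?; split; rewrite ?G0T ?G1T ?G2T.
have upn u m : bounded M (u + m%:R) y -> bounded M u y.
  elim: m => [|m IH]; first by rewrite addr0.
  by rewrite -natr1 addrA => /up.
have downn u m : bounded M u y -> bounded M (u + m%:R) y.
  elim: m => [|m IH]; first by rewrite addr0.
  by rewrite -natr1 addrA => /IH; exact: down.
case: n => m; first by rewrite -[(Posz m)%:~R]/(m%:R); exact: upn.
by rewrite NegzE rmorphN /= => /(downn _ m.+1); rewrite -addrA -[(Posz _)%:~R]/(m.+1%:R) addNr addr0.
Qed.

(** Both [4 / 5] and [17 / 20] lie below [sqrt 3 / 2], the least height in the fundamental domain.
    Above [17 / 20] Schwarz's lemma from the line [4 / 5] gains at least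
    [exp (- (pi / 4) * (1 / 20))]. A point between the two heights, translated to [|x| <= 1/2] and
    inverted, lands above [17 / 20]. *)
Let contraction M : 0 <= M -> (forall x y, 4 / 5 <= y -> bounded M x y) ->
  forall x y, 4 / 5 <= y -> bounded (M * expR (- (pi / 80))) x y.
Proof.
move=> M0 H.
have high x y : 17 / 20 <= y -> bounded (M * expR (- (pi / 80))) x y.
  move=> y1; have y45 : 4 / 5 < y by lra.
  have p0 := pi_gt0 R.
  have le k : pi / 4 <= k -> M * expR (- (k * (y - 4 / 5))) <= M * expR (- (pi / 80)).
    by move=> kp; rewrite ler_wpM2l// ler_expR lerN2; nra.
  have c450 : 0 < 4 / 5 :> R by lra.
  have base u := H u (4 / 5) (lexx (4 / 5)).
  have b0 u : normc (G0 u (4 / 5)) <= M by have [b _ _] := base u; exact: b.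
  have b1 u : normc (G1 u (4 / 5)) <= M by have [_ b _] := base u; exact: b.
  have b2 u : normc (G2 u (4 / 5)) <= M by have [_ _ b] := base u; exact: b.
  have pp : pi / 4 <= pi :> R by lra.
  have f0 : fneg c 0%N = 0 by rewrite /= c0 mulr0.
  have := schwarz_halfplane x (pi_gt0 R) cc c0 c450 y45 b0.
  have := schwarz_halfplane x (pi_gt0 R) (conv_fneg cc) f0 c450 y45 b1.
  have := schwarz_halfplane x pi4 cd d0 c450 y45 b2.
  move=> s2 s1 s0; split.
  - exact: le_trans s0 (le _ pp).
  - exact: le_trans s1 (le _ pp).
  - exact: le_trans s2 (le _ (lexx _)).
move=> x y y45; have y0 : 0 < y by lra.
have [|ylt] := leP (17 / 20) y; first exact: high.
pose n := Num.floor (x + 1 / 2).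
have /andP[n1 n2] := floor_itv (x + 1 / 2); rewrite -/n in n1 n2.
rewrite rmorphD/= in n2.
apply: (bounded_translate (n := - n)) => //; rewrite rmorphN /=.
set u := x - n%:~R; have u1 : - (1 / 2) <= u by rewrite /u; lra.
have u2 : u <= 1 / 2 by rewrite /u; lra.
have uN : N u y <= 1 / 4 + y ^+ 2 by rewrite /sqmod lerD2r; nra.
have yN : 17 / 20 <= y / N u y by rewrite ler_pdivlMr ?N_gt0//; nra.
have [b0 b1 b2] := high (- u / N u y) _ yN.
by split; rewrite ?(G0S u y0) ?(G1S u y0) ?(G2S u y0).
Qed.

(** Some finite bound exists because each series is dominated by its absolute series at the height
    [4 / 5]; iterating the contraction drives it to 0. *)
Let bounded0 x y : 4 / 5 <= y -> bounded 0 x y.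
Proof.
have [M M0 HM] : exists2 M, 0 <= M & forall x y, 4 / 5 <= y -> bounded M x y.
  have p0 := pi_gt0 R.
  pose r := expR (- (pi / 4 * (4 / 5))) : R.
  have r1 : r < 1 by rewrite /r expR_lt1 oppr_lt0 !mulr_gt0.
  pose B (e : fps R) := tsum (fun i => `|e i| * r ^+ i).
  have B0 e : 0 <= B e by apply: tsum_ge0 => i; rewrite mulr_ge0 ?exprn_ge0 ?expR_ge0.
  have HB e k u v : conv e -> pi / 4 <= k -> 4 / 5 <= v ->
      normc (on_halfplane e k u v) <= B e.
    move=> ce kp v45; apply: normc_on_halfplane_le => //.
    by rewrite ler_expR lerN2; nra.
  exists (B c + B (fneg c) + B d); first exact: (addr_ge0 (addr_ge0 (B0 _) (B0 _)) (B0 _)).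
  move=> {}x {}y y45; have cn := conv_fneg cc.
  have pp : pi / 4 <= pi :> R by lra.
  have bc := B0 c; have bn := B0 (fneg c); have bd := B0 d.
  split.
  - by apply: le_trans (HB c pi x y cc pp y45) _; rewrite -addrA lerDl (addr_ge0 bn bd).
  - by apply: le_trans (HB _ pi x y cn pp y45) _; rewrite addrAC lerDr (addr_ge0 bc bd).
  - by apply: le_trans (HB d _ x y cd (lexx _) y45) _; rewrite lerDr (addr_ge0 bc bn).
move=> y45; pose t := expR (- (pi / 80)) : R.
have Ht n : forall x y, 4 / 5 <= y -> bounded (M * t ^+ n) x y.
  elim: n => [|n IH]; first by rewrite mulr1.
  rewrite exprSr mulrA; apply: contraction => //.
  by rewrite mulr_ge0// exprn_ge0// expR_ge0.
have t1 : t < 1 by rewrite expR_lt1 oppr_lt0 divr_gt0// pi_gt0.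
have small a : 0 <= a -> (forall n, a <= M * t ^+ n) -> a <= 0.
  move=> a0 Ha; rewrite leNgt; apply/negP => ap.
  suff : 1 <= t by rewrite leNgt t1.
  apply: (@pow_le_le R 1 t (M / a)) => [||n]; [exact: ler01|exact: expR_ge0|].
  by rewrite expr1n mulrAC ler_pdivlMr ?mul1r.
split; (apply: small => [|n]; first exact: normc_ge0).
- by have [h _ _] := Ht n x y y45; exact: h.
- by have [_ h _] := Ht n x y y45; exact: h.
- by have [_ _ h] := Ht n x y y45; exact: h.
Qed.

Theorem modular_liouville : c = 0 /\ d = 0.
Proof.
split.
  apply: (fev_eq0_halfplane (y0 := 4 / 5) (pi_gt0 R) cc) => y y45.
  have [H _ _] := bounded0 0 y45; apply: eq0_normc.
  by apply/eqP; rewrite eq_le H normc_ge0.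
apply: (fev_eq0_halfplane (y0 := 4 / 5) pi4 cd) => y y45.
have [_ _ H] := bounded0 0 y45; apply: eq0_normc.
by apply/eqP; rewrite eq_le H normc_ge0.
Qed.

End Functions.
End ModularLiouville.

(** * Poisson summation *)

Section PolyaWeights.
Context {R : realType}.
Implicit Types (x y s : R) (m n N : nat).

Lemma onem_le_expR s : 1 - s <= expR (- s).
Proof. exact: expR_ge1Dx. Qed.

Lemma expR_le_onem s : s < 1 -> expR (- (s / (1 - s))) <= 1 - s.
Proof.
move=> s1; have s0 : 0 < 1 - s by lra.
rewrite expRN -[leRHS]invrK lef_pV2 ?posrE ?invr_gt0 ?expR_gt0//.
apply: le_trans (expR_ge1Dx _); rewrite le_eqVlt; apply/orP; left; apply/eqP.
by field; rewrite gt_eqF.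
Qed.

Lemma sin_ge_mul_cos y : 0 <= y -> y <= pi / 2 -> y * cos y <= sin y.
Proof.
rewrite le_eqVlt => /predU1P[<-|y0 yp]; first by rewrite sin0 mul0r.
have [|t] := @MVT R sin cos 0 y y0.
  by apply: continuous_subspaceT; exact: continuous_sin.
rewrite in_itv /= => /andP[t0 ty]; rewrite sin0 !subr0 => ->.
rewrite mulrC ler_pM2r//; have p0 := pi_gt0 R.
by rewrite ltW// ltr_cos// in_itv/=; apply/andP; split; lra.
Qed.

(** From [sin x = 2 sin (x/2) cos (x/2)] and [t cos t <= sin t] at [t = x/2]. The lower bound loses
    nothing as [x] tends to 0 and still controls large [x], which the limit and the domination
    require respectively. *)
Lemma sin_bounds x : `|x| <= pi ->
  x ^+ 2 * cos (x / 2) ^+ 4 <= sin x ^+ 2 <= x ^+ 2.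
Proof.
wlog x0 : x / 0 <= x.
  move=> W; case: (leP 0 x) => x0; first exact: W.
  have := W (- x); rewrite oppr_ge0 ltW// normrN mulNr cosN sinN !sqrrN.
  by apply.
rewrite ger0_norm// => xp; have p0 := pi_gt0 R.
have h := @sin_ge_mul_cos (x / 2).
have c0 : 0 <= cos (x / 2) by apply: cos_ge0_pihalf; apply/andP; split; lra.
have h1 : x / 2 * cos (x / 2) <= sin (x / 2) by apply: h; lra.
have s2 : sin x = 2 * (sin (x / 2) * cos (x / 2)).
  by rewrite {1}(splitr x) sinD; ring.
have lo : x * cos (x / 2) ^+ 2 <= sin x.
  by rewrite s2 expr2 mulrA [leRHS]mulrA ler_wpM2r//; lra.
have up : sin x <= x.
  move: x0; rewrite le_eqVlt => /predU1P[<-|x0]; first by rewrite sin0.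
  have [|t] := @MVT R sin cos 0 x x0.
    by apply: continuous_subspaceT; exact: continuous_sin.
  by move=> _; rewrite sin0 !subr0 => ->; rewrite ler_piMl// ?cos_le1// ltW.
have lo0 : 0 <= x * cos (x / 2) ^+ 2 by rewrite mulr_ge0 ?sqr_ge0.
apply/andP; split.
  have -> : x ^+ 2 * cos (x / 2) ^+ 4 = (x * cos (x / 2) ^+ 2) ^+ 2 by ring.
  by apply: lerXn2r; rewrite ?nnegrE//; exact: le_trans lo.
by apply: lerXn2r; rewrite ?nnegrE//; exact: le_trans lo.
Qed.

Lemma expRN_mulrn (m : nat) x : expR (- (m%:R * x)) = expR (- x) ^+ m.
Proof. by rewrite -expRM_natl mulrN. Qed.

Lemma cos_pow_bounds m x : sin x ^+ 2 < 1 ->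
  expR (- (m%:R * (sin x ^+ 2 / (1 - sin x ^+ 2)))) <= cos x ^+ (2 * m) /\
  cos x ^+ (2 * m) <= expR (- (m%:R * sin x ^+ 2)).
Proof.
move=> s1; rewrite exprM !expRN_mulrn cos2sin2.
split; apply: lerXn2r; rewrite ?nnegrE ?expR_ge0 ?onem_le_expR ?expR_le_onem//;
  by rewrite subr_ge0 ltW.
Qed.

Lemma cos_pow_le m x : `|cos x ^+ (2 * m)| <= expR (- (m%:R * sin x ^+ 2)).
Proof.
rewrite exprM (ger0_norm (exprn_ge0 m (sqr_ge0 (cos x)))) expRN_mulrn cos2sin2.
apply: lerXn2r; rewrite ?nnegrE ?expR_ge0 ?onem_le_expR//.
Qed.

(* Polya's proof of the theta transformation: these weights tend to Gaussians by the local
   limit theorem, and their sums over residue classes are finite trigonometric sums. *)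
Definition polya_weight m n : R := 'C(2 * m, m + n)%:R / 'C(2 * m, m)%:R.

Lemma central_bin_gt0 m : 0 < 'C(2 * m, m)%:R :> R.
Proof. by rewrite ltr0n bin_gt0 leq_pmull. Qed.

Lemma polya_weight_ge0 m n : 0 <= polya_weight m n.
Proof. by rewrite divr_ge0. Qed.

Lemma polya_weight0 m : polya_weight m 0 = 1.
Proof. by rewrite /polya_weight addn0 divff// gt_eqF// central_bin_gt0. Qed.

Lemma polya_weight_gt m n : (m < n)%N -> polya_weight m n = 0.
Proof. by move=> mn; rewrite /polya_weight bin_small ?mul0r//; lia. Qed.

Lemma polya_weightS m n :
  polya_weight m n.+1 = polya_weight m n * ((m - n)%:R / (m + n).+1%:R).
Proof.
have := mul_bin_left (2 * m) (m + n).
have -> : (2 * m - (m + n) = m - n)%N by lia.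
move=> /(congr1 (fun k => k%:R : R)); rewrite !natrM => E.
rewrite /polya_weight addnS mulrAC; congr (_ / _).
apply: (mulfI (_ : (m + n).+1%:R != 0 :> R)); first by rewrite pnatr_eq0.
by rewrite E [RHS]mulrCA [(m + n).+1%:R * _]mulrC divfK ?pnatr_eq0// mulrC.
Qed.

Lemma polya_ratio m n : (n < m)%N ->
  (m - n)%:R / (m + n).+1%:R = 1 - (2 * n%:R + 1) / (m + n).+1%:R :> R.
Proof.
move=> nm; have np : (m + n).+1%:R != 0 :> R by rewrite pnatr_eq0.
apply: (mulIf np); rewrite mulrBl (divfK np) (divfK np) mul1r.
apply/eqP; rewrite eq_sym subr_eq -natrM natr1 -natrD; apply/eqP; congr (_%:R).
lia.
Qed.

(** The ratio of consecutive weights is [1 - (2 n + 1) / (m + n + 1)], at most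
    [exp (- (2 n + 1) / (m + N))]; the odd numbers add up to the square in the exponent. *)
Lemma polya_weight_le m N n : (n <= N)%N ->
  polya_weight m n <= expR (- (n%:R ^+ 2 / (m + N)%:R)).
Proof.
elim: n => [|n IH] nN; first by rewrite polya_weight0 expr0n mul0r oppr0 expR0.
have [mn|nm] := leqP m n; first by rewrite polya_weight_gt ?expR_ge0.
rewrite polya_weightS.
have Np : 0 < (m + N)%:R :> R by rewrite ltr0n; lia.
have np : 0 < (m + n).+1%:R :> R by [].
have -> : n.+1%:R ^+ 2 / (m + N)%:R = n%:R ^+ 2 / (m + N)%:R + (2 * n%:R + 1) / (m + N)%:R :> R.
  by rewrite -mulrDl -natr1; congr (_ / _); ring.
rewrite opprD expRD; apply: ler_pM; rewrite ?polya_weight_ge0 ?divr_ge0//.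
  by apply: IH; exact: ltnW.
apply: le_trans (onem_le_expR _).
rewrite (polya_ratio nm).
rewrite lerD2l lerN2 ler_wpM2l ?addr_ge0 ?mulr_ge0//.
by rewrite lef_pV2 ?posrE// ler_nat; lia.
Qed.

(** The same product from below, with [1 - s >= exp (- s / (1 - s))]; here [s / (1 - s)] equals
    [(2 n + 1) / (m - n)]. *)
Lemma polya_weight_ge m N n : (n <= N)%N -> (N <= m)%N ->
  expR (- (n%:R ^+ 2 / (m - N).+1%:R)) <= polya_weight m n.
Proof.
move=> + Nm; elim: n => [|n IH] nN.
  by rewrite polya_weight0 expr0n mul0r oppr0 expR0.
rewrite polya_weightS.
have Np : 0 < (m - N).+1%:R :> R by [].
have np : 0 < (m + n).+1%:R :> R by [].
have mn : 0 < (m - n)%:R :> R by rewrite ltr0n; lia.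
have -> : n.+1%:R ^+ 2 / (m - N).+1%:R = n%:R ^+ 2 / (m - N).+1%:R + (2 * n%:R + 1) / (m - N).+1%:R :> R.
  by rewrite -mulrDl -natr1; congr (_ / _); ring.
rewrite opprD expRD; apply: ler_pM; rewrite ?expR_ge0//.
  by apply: IH; exact: ltnW.
have nm : (n < m)%N by lia.
have s1E := polya_ratio nm; rewrite s1E.
set s := (2 * n%:R + 1) / (m + n).+1%:R in s1E *; move/esym: s1E => s1E.
have s1 : s < 1 by rewrite -subr_gt0 s1E divr_gt0.
apply: le_trans (expR_le_onem s1); rewrite ler_expR lerN2 s1E /s invf_div mulrA divfK ?gt_eqF//.
rewrite ler_wpM2l ?addr_ge0 ?mulr_ge0//.
by rewrite lef_pV2 ?posrE// ler_nat; lia.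
Qed.

End PolyaWeights.

(** * The finite identity behind Poisson summation *)

Section PolyaIdentity.
Context {R : realType}.
Local Notation C := (R[i]).
Local Open Scope complex_scope.
Implicit Types (x t : R).

Lemma cis2pi_int (n : int) : cis (2 * pi * n%:~R) = 1 :> C.
Proof.
case: n => n; first exact: cis2pi_nat.
rewrite NegzE rmorphN /= mulrN -[(n.+1%:Z)%:~R]/(n.+1%:R).
have := cisD (2 * pi * n.+1%:R : R) (- (2 * pi * n.+1%:R)).
by rewrite subrr cis0 cis2pi_nat mul1r => <-.
Qed.

Lemma cos_add_2piz x (n : int) : cos (x + 2 * pi * n%:~R) = cos x.
Proof. by have := cisD x (2 * pi * n%:~R); rewrite cis2pi_int mulr1 => -[]. Qed.

Lemma sum_cos_int l (d : int) x : (0 < l)%N ->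
  \sum_(k < l) cos (2 * pi * k%:R * d%:~R / l%:R + x) =
  if (l%:Z %| d)%Z then l%:R * cos x else 0.
Proof.
move=> l0; have ln : l%:R != 0 :> R by rewrite pnatr_eq0 -lt0n.
pose d' := (absz ((d %% l)%Z)); pose q := (d %/ l)%Z.
have lz : l%:Z != 0 by case: l l0 {ln d' q}.
have dE : d = q * l%:Z + d'%:Z.
  by rewrite /d' gez0_abs ?modz_ge0//; exact: divz_eq.
have dvE : (l%:Z %| d)%Z = (l %| d')%N.
  by rewrite dE -[(l %| d')%N]/(l%:Z %| d'%:Z)%Z rpredDl// dvdz_mull.
have zE : cis (2 * pi * d%:~R / l%:R) = cis (2 * pi * d'%:R / l%:R) :> C.
  have -> : 2 * pi * d%:~R / l%:R = 2 * pi * q%:~R + 2 * pi * d'%:R / l%:R :> R.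
    by rewrite {1}dE rmorphD rmorphM /= mulrDr mulrDl mulrA mulfK.
  by rewrite cisD cis2pi_int mul1r.
transitivity (complex.Re (cis x * \sum_(k < l) cis (2 * pi * d'%:R / l%:R) ^+ k)).
  rewrite mulr_sumr.
  have -> (s : seq 'I_l) (f : 'I_l -> C) : complex.Re (\sum_(k <- s) f k) =
      \sum_(k <- s) complex.Re (f k).
    by elim: s => [|k s IH]; rewrite ?big_nil// !big_cons -IH; case: (f k); case: (\sum_(_ <- _) _).
  apply: eq_bigr => k _; rewrite -zE cisX -cisD /=; congr cos.
  by rewrite addrC; congr (_ + _); field.
rewrite sum_cis// dvE; case: ifP => _; last by rewrite mulr0.
have -> : (l%:R : C) = (l%:R : R)%:C by rewrite rmorph_nat.
by simpc; rewrite mulrC.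
Qed.

Lemma cos_pow_expand m (a b : R) :
  4 ^+ m * cos a ^+ (2 * m) * cos b =
  \sum_(i < (2 * m).+1) 'C(2 * m, i)%:R * cos (2 * a * (i%:R - m%:R) + b).
Proof.
have E : ((2 * cos a)%:C) = cis (- a) + cis a :> C.
  by rewrite /cis cosN sinN; simpc; congr (_ +i* _); ring.
have := congr1 (fun z => complex.Re (z ^+ (2 * m) * cis b)) E.
rewrite -rmorphXn exprMn exprM -[2 ^+ 2]/(2 * 2 : R) -natrM /=.
rewrite mul0r subr0 => ->; rewrite exprDn mulr_suml.
have -> (s : seq 'I_(2 * m).+1) (f : 'I_(2 * m).+1 -> C) : complex.Re (\sum_(k <- s) f k) =
      \sum_(k <- s) complex.Re (f k).
  by elim: s => [|k s IH]; rewrite ?big_nil// !big_cons -IH; case: (f k); case: (\sum_(_ <- _) _).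
apply: eq_bigr => i _; rewrite !cisX -cisD [X in complex.Re X]mulrnAl -cisD.
have -> (z : C) n : complex.Re (z *+ n) = n%:R * complex.Re z.
  elim: n => [|n IH]; first by rewrite mul0r.
  by rewrite mulrS -natr1 mulrDl mul1r -IH addrC {IH}; move: (z *+ n) => w; case: z => ? ?; case: w.
rewrite /=; congr (_ * cos _).
have iN : (i <= 2 * m)%N by rewrite -ltnS.
by rewrite natrB// natrM; ring.
Qed.

(** The window is one full period of [k] modulo [l]. Its position is free in the identity; in the
    limit [h] is half of [l], which centres it at the peak of the power of the cosine. *)
Definition polya_window l m h (r : int) (xi th : R) (k : int) : R :=
  if (- h%:Z <= k) && (k < l%:Z - h%:Z) then
    cos (pi * (k%:~R + xi) / l%:R) ^+ (2 * m) *
    cos (2 * pi * (th - (k%:~R + xi) * (r%:~R / l%:R)))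
  else 0.

Definition polya_term l m (r : int) (xi th : R) (v : int) : R :=
  polya_weight m (absz (r + l%:Z * v)) * cos (2 * pi * (v%:~R * xi + th)).

(** Expand the power of the cosine by the binomial theorem and sum over [k] first: orthogonality
    keeps the indices with [i - m = r + l v], whose binomial coefficients are the Polya weights. *)
Lemma polya_identity l m h r xi th : (0 < l)%N ->
  4 ^+ m / 'C(2 * m, m)%:R / l%:R * tsum (polya_window l m h r xi th) =
  tsum (polya_term l m r xi th).
Proof.
move=> l0; have ln : l%:R != 0 :> R by rewrite pnatr_eq0 -lt0n.
have lz : l%:Z != 0 by case: l l0 {ln}.
have Cn : 'C(2 * m, m)%:R != 0 :> R by rewrite gt_eqF// central_bin_gt0.
pose s := [seq k%:Z - h%:Z | k <- iota 0 l].
have us : uniq s.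
  by rewrite map_inj_uniq ?iota_uniq// => i j /addIr [].
have [k ks|_ ->] := @tsum_seq R _ s (polya_window l m h r xi th) us.
  rewrite /polya_window; case: ifP => // /andP[k1 k2]; case/negP: ks.
  by apply/mapP; exists (absz (k + h%:Z)); [rewrite mem_iota|]; lia.
pose g (j : int) : R := if (l%:Z %| j)%Z then
  polya_weight m (absz (r + j)) * cos (2 * pi * (j%:~R / l%:R * xi + th)) else 0.
pose e (v : int) := l%:Z * v.
have ie : injective e by move=> u v /(mulfI lz).
pose s' := [seq i%:Z - m%:Z - r | i <- iota 0 (2 * m).+1].
have us' : uniq s'.
  by rewrite map_inj_uniq ?iota_uniq// => i j /addIr /addIr [].
have [j js|Sg Eg] := @tsum_seq R _ s' g us'.
  rewrite /g; case: ifP => // _; rewrite polya_weight_gt ?mul0r// ltnNge.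
  apply: contra js => jm; apply/mapP; exists (absz (j + r + m%:Z)); last by lia.
  by rewrite mem_iota; lia.
have geE : g \o e = polya_term l m r xi th.
  apply/funext => v; rewrite /g /e /polya_term /= dvdz_mulr//.
  have -> : (l%:Z * v)%:~R / l%:R = v%:~R :> R.
    by rewrite rmorphM /= [X in X / _]mulrC -[(l%:Z)%:~R]/(l%:R : R) mulfK.
  by [].
have <- : tsum g = tsum (polya_term l m r xi th).
  rewrite -geE; apply: (tsum_inj ie); last by apply: asummable_inj.
  move=> u H; rewrite /g; case: ifP => // /dvdzP[v uE].
  by have := H v; rewrite uE mulrC eqxx.
have big_iota n (F : nat -> R) : \sum_(i <- iota 0 n) F i = \sum_(i < n) F i.
  by rewrite -{1}(subn0 n) -/(index_iota 0 n) big_mkord.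
rewrite Eg /s /s' !big_map !big_iota.
apply: (mulfI ln); apply: (mulfI Cn).
rewrite (mulrA l%:R) (mulrCA l%:R) divff// mulr1.
rewrite mulrA (mulrCA 'C(_, _)%:R) divff// mulr1 mulr_sumr.
rewrite [LHS](eq_bigr (fun k : 'I_l => \sum_(i < (2 * m).+1) 'C(2 * m, i)%:R *
  cos (2 * pi * k%:R * (i%:Z - m%:Z - r)%:~R / l%:R +
       2 * pi * ((xi - h%:R) * (i%:Z - m%:Z - r)%:~R / l%:R + th)))); last first.
  move=> k _; rewrite /polya_window ifT; last by move: (ltn_ord k); lia.
  rewrite mulrA cos_pow_expand; apply: eq_bigr => i _; congr (_ * cos _).
  by rewrite !rmorphB /=; field.
rewrite exchange_big /= !mulr_sumr; apply: eq_bigr => i _.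
rewrite -mulr_sumr sum_cos_int// /g; case: ifP => dv; last by rewrite !mulr0.
have [v dE] := dvdzP dv; rewrite dE rmorphM /= mulfK//.
have -> : 2 * pi * ((xi - h%:R) * (v%:~R * l%:R) / l%:R + th) =
    2 * pi * (v%:~R * xi + th) + 2 * pi * (- h%:Z * v)%:~R :> R.
  by rewrite rmorphM rmorphN /=; field.
rewrite cos_add_2piz [RHS]mulrCA [LHS]mulrCA; congr (_ * _).
rewrite mulrA; congr (_ * _); rewrite /polya_weight mulrC divfK//; congr (_%:R).
have -> : (absz (r + v * l)) = (absz (i%:Z - m%:Z)) by rewrite -dE; lia.
have [im|mi] := leqP m i; first by congr ('C(_, _)); lia.
have iN : (i <= 2 * m)%N by lia.
rewrite -(bin_sub iN); congr ('C(_, _)); lia.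
Qed.

End PolyaIdentity.

(** * Gaussian limits and Poisson summation on the line *)

Section PoissonLine.
Context {R : realType}.
Implicit Types (a b c x y xi th : R) (k : nat) (v : int).

Lemma cvg_continuous (f : R -> R) (u : nat -> R) (l : R) :
  continuous f -> u @ \oo --> l -> (fun k => f (u k)) @ \oo --> f l.
Proof. by move=> cf; apply: continuous_cvg; exact: cf. Qed.

Lemma asummable_int (f : int -> R) :
  asummable (fun n : nat => f n) -> asummable (fun n : nat => f (Negz n)) -> asummable f.
Proof.
move=> Sp Sn.
have S1 : asummable (fun v => if v is Posz n then f v else 0).
  by apply: (asummable_inj_supp (e := Posz)) => // [m n []|[n|n] H]//; have := H n; rewrite eqxx.
have S2 : asummable (fun v => if v is Negz n then f v else 0).
  by apply: (asummable_inj_supp (e := Negz)) => // [m n []|[n|n] H]//; have := H n; rewrite eqxx.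
rewrite (_ : f = (fun v => (if v is Posz n then f v else 0) + (if v is Negz n then f v else 0))).
  exact: asummableD.
by apply/funext => -[n|n]; rewrite ?addr0 ?add0r.
Qed.

Lemma asummable_pow_absz (t : R) : 0 <= t -> t < 1 ->
  asummable (fun v : int => t ^+ absz v).
Proof.
move=> t0 t1; have [S _] := asummable_geometric t0 t1.
apply: asummable_int => //.
by apply: asummable_le S => n /=; rewrite ger0_norm ?exprn_ge0// exprS ler_piMl ?exprn_ge0// ltW.
Qed.

Lemma abszR v : (absz v)%:R = `|v%:~R| :> R.
Proof. by rewrite -intr_norm -abszE. Qed.

(** From [t^2 >= t - 1/4]. The majorant is geometric in [|v|] and uniform in bounded [x], as
    dominated convergence with moving shifts requires. *)
Lemma gauss_le_pow b x X v : 0 < b -> `|x| <= X ->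
  expR (- (b * (v%:~R + x) ^+ 2)) <= expR (b * (X + 1 / 4)) * expR (- b) ^+ absz v.
Proof.
move=> b0 xX; rewrite -expRM_natl -expRD ler_expR abszR.
have : `|v%:~R : R| - X - 1 / 4 <= (v%:~R + x) ^+ 2.
  have h : `|v%:~R : R| <= `|v%:~R + x| + `|x|.
    by rewrite -{1}[v%:~R](addrK x) ler_normB.
  have := sqr_ge0 (`|v%:~R + x| - 1 / 2); have := real_normK (num_real (v%:~R + x)).
  by move=> E; rewrite -E; lra.
by move=> h; nra.
Qed.

Lemma asummable_gauss b c : 0 < b ->
  asummable (fun v => expR (- (b * (v%:~R + c) ^+ 2))).
Proof.
move=> b0; have e1 : expR (- b) < 1 :> R by rewrite expR_lt1 oppr_lt0.
apply: asummable_le (asummableZ _ (asummable_pow_absz (expR_ge0 _) e1)) => v.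
by rewrite ger0_norm ?expR_ge0//; apply: gauss_le_pow.
Qed.

(** With [m = k + 1], a length close to [sqrt (pi a m)] turns the weight [exp (- n^2 / m)] at
    [n = l (v + c)] into [exp (- pi a (v + c)^2)]. The successor keeps the length positive and at
    least [sqrt (pi a m)]. *)
Definition polya_len a k : nat := (Num.truncn (Num.sqrt (pi * a * k.+1%:R))).+1.
Definition polya_shift a c k : int := Num.floor (c * (polya_len a k)%:R).

Local Notation rootn k := (Num.sqrt k.+1%:R : R).

Lemma rootn_gt0 k : 0 < rootn k. Proof. by rewrite sqrtr_gt0. Qed.

Lemma sqr_rootn k : rootn k ^+ 2 = k.+1%:R. Proof. by rewrite sqr_sqrtr. Qed.

Lemma cvg_inv_rootn : (fun k => (rootn k)^-1) @ \oo --> (0 : R).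
Proof.
have := cvg_continuous (@sqrt_continuous R) (@cvg_harmonic R).
rewrite [X in _ --> X]sqrtr0; apply: cvg_trans; apply: near_eq_cvg; near=> k.
by rewrite /harmonic /= sqrtrV.
Unshelve. all: by end_near. Qed.

Section FixedA.
Variable a : R.
Hypothesis a0 : 0 < a.
Local Notation L := (polya_len a).

Let pia : 0 < pi * a. Proof. by rewrite mulr_gt0// pi_gt0. Qed.
Let sa : 0 < Num.sqrt (pi * a). Proof. by rewrite sqrtr_gt0. Qed.

Let L0 k : 0 < (L k)%:R :> R. Proof. by rewrite ltr0n. Qed.

Lemma polya_len_bounds k :
  Num.sqrt (pi * a) <= (L k)%:R / rootn k /\
  (L k)%:R / rootn k <= Num.sqrt (pi * a) + (rootn k)^-1.
Proof.
have sE : Num.sqrt (pi * a * k.+1%:R) = Num.sqrt (pi * a) * rootn k.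
  by rewrite sqrtrM// ltW.
have /andP[t1 t2] := truncn_itv (sqrtr_ge0 (pi * a * k.+1%:R)); rewrite sE in t1 t2.
have rp := rootn_gt0 k; split.
  by rewrite ler_pdivlMr// /polya_len sE; exact: ltW.
rewrite ler_pdivrMr// mulrDl [_^-1 * _]mulVf ?gt_eqF//.
by rewrite /polya_len sE -natr1 lerD2r.
Qed.

Lemma cvg_polya_len : (fun k => (L k)%:R / rootn k) @ \oo --> Num.sqrt (pi * a).
Proof.
apply: (@squeeze_cvgr _ _ _ _ (fun=> Num.sqrt (pi * a))
  (fun k => Num.sqrt (pi * a) + (rootn k)^-1)).
- by near=> k; have [-> ->] := polya_len_bounds k.
- exact: cvg_cst.
- rewrite -[X in _ --> X]addr0; apply: cvgD; [exact: cvg_cst|exact: cvg_inv_rootn].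
Unshelve. all: by end_near. Qed.

Lemma cvg_inv_polya_len : (fun k => ((L k)%:R)^-1) @ \oo --> (0 : R).
Proof.
have H := cvgM cvg_inv_rootn (cvgV (negbT (gt_eqF sa)) cvg_polya_len).
rewrite mul0r in H.
rewrite (_ : (fun _ => _) = (fun k => (rootn k)^-1 * ((L k)%:R / rootn k)^-1)); first exact: H.
apply/funext => k; rewrite invf_div mulrA mulVf ?mul1r// gt_eqF.
Qed.

Lemma polya_len_large (X : R) : \forall k \near \oo, X <= (L k)%:R.
Proof.
have X1 : 0 < (`|X| + 1)^-1 by rewrite invr_gt0 ltr_wpDl.
have := cvg_inv_polya_len => /cvgrPdist_lt /(_ _ X1); apply: filterS => k.
rewrite sub0r normrN gtr0_norm ?invr_gt0// ltf_pV2 ?posrE ?ltr_wpDl// => h.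
by have := ler_norm X; lra.
Qed.

Lemma polya_shift_dist c k : `|(polya_shift a c k)%:~R / (L k)%:R - c| <= ((L k)%:R)^-1.
Proof.
have /andP[f1 f2] := floor_itv (c * (L k)%:R); rewrite rmorphD /= in f2.
have -> : (polya_shift a c k)%:~R / (L k)%:R - c =
    ((polya_shift a c k)%:~R - c * (L k)%:R) / (L k)%:R.
  by rewrite mulrBl mulfK// gt_eqF.
rewrite normrM.
rewrite (ger0_norm (_ : 0 <= ((L k)%:R)^-1)) ?invr_ge0// ler_piMl ?invr_ge0//.
by rewrite ler_norml /polya_shift; apply/andP; split; lra.
Qed.

Lemma cvg_polya_shift c : (fun k => (polya_shift a c k)%:~R / (L k)%:R) @ \oo --> c.
Proof.
apply/cvgrPdist_le => e e0; have := cvg_inv_polya_len => /cvgrPdist_le /(_ _ e0).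
apply: filterS => k; rewrite sub0r normrN gtr0_norm ?invr_gt0// => h.
by rewrite distrC (le_trans (polya_shift_dist c k)).
Qed.

Lemma cvg_polya_term c xi th :
  (fun k => tsum (polya_term (L k) k.+1 (polya_shift a c k) xi th)) @ \oo -->
  tsum (fun v => expR (- (pi * a * (v%:~R + c) ^+ 2)) * cos (2 * pi * (v%:~R * xi + th))).
Proof.
(* Half of the limiting rate, because a nonzero weight has [n <= m] and then
   [n^2 / (m + n) >= n^2 / (2 m)]. *)
pose b := pi * a / 2; have b0 : 0 < b by rewrite divr_gt0.
have e1 : expR (- b) < 1 :> R by rewrite expR_lt1 oppr_lt0.
have Sh := asummableZ (expR (b * ((`|c| + 1) + 1 / 4))) (asummable_pow_absz (expR_ge0 _) e1).
apply: (proj2 (tsum_cvg_dominated Sh _ _)).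
  near=> k => v; rewrite /polya_term normrM.
  apply: (@le_trans _ _ (polya_weight k.+1 (absz (polya_shift a c k + (L k)%:Z * v)))).
    by rewrite ger0_norm ?polya_weight_ge0// ler_piMr ?polya_weight_ge0// ler_norml cos_geN1 cos_le1.
  set n := absz _; have [nk|kn] := leqP n k.+1; last first.
    by rewrite polya_weight_gt// mulr_ge0 ?exprn_ge0 ?expR_ge0.
  apply: le_trans (polya_weight_le _ (leqnn n)) _.
  have xX : `|(polya_shift a c k)%:~R / (L k)%:R : R| <= `|c| + 1.
    rewrite -[X in `|X|](subrK c) (le_trans (ler_normD _ _))// addrC lerD2l.
    by rewrite (le_trans (polya_shift_dist c k))// invf_le1// ler1n.
  apply: le_trans (gauss_le_pow v b0 xX); rewrite ler_expR lerN2.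
  have nE : n%:R = (L k)%:R * `|v%:~R + (polya_shift a c k)%:~R / (L k)%:R| :> R.
    rewrite -{1}(gtr0_norm (L0 k)) -normrM mulrDr mulrCA divff ?gt_eqF// mulr1.
    by rewrite /n abszR rmorphD rmorphM /= addrC.
  rewrite nE exprMn real_normK ?num_real// [leRHS]mulrAC ler_wpM2r ?sqr_ge0//.
  rewrite ler_pdivlMr ?ltr0n//; have [h _] := polya_len_bounds k.
  have h2 : pi * a * k.+1%:R <= (L k)%:R ^+ 2.
    rewrite -(sqr_sqrtr (ltW pia)) -sqr_rootn -exprMn; apply: lerXn2r; rewrite ?nnegrE ?mulr_ge0 ?sqrtr_ge0//.
    by rewrite -ler_pdivlMr ?rootn_gt0.
  have h3 : (k.+1 + n)%:R <= 2 * k.+1%:R :> R by rewrite -natrM ler_nat; lia.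
  apply: le_trans h2; have -> : pi * a * k.+1%:R = b * (2 * k.+1%:R) by rewrite /b; field.
  by rewrite ler_pM2l.
move=> v; pose B := Num.sqrt (pi * a) * `|v%:~R + c|.
pose n k := absz (polya_shift a c k + (L k)%:Z * v).
have nE k : (n k)%:R / rootn k = (L k)%:R / rootn k * `|v%:~R + (polya_shift a c k)%:~R / (L k)%:R| :> R.
  rewrite mulrAC; congr (_ / _).
  rewrite -{1}(gtr0_norm (L0 k)) -normrM mulrDr mulrCA divff ?gt_eqF// mulr1.
  by rewrite /n abszR rmorphD rmorphM /= addrC.
have nB : (fun k => (n k)%:R / rootn k) @ \oo --> B.
  under eq_fun do rewrite nE.
  apply: cvgM; first exact: cvg_polya_len.
  by apply: cvg_norm; apply: cvgD; [exact: cvg_cst|exact: cvg_polya_shift].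
have n0 : (fun k => (n k)%:R / rootn k * (rootn k)^-1) @ \oo --> (0 : R).
  by rewrite -(mulr0 B); apply: cvgM => //; exact: cvg_inv_rootn.
have B2 : - (pi * a * (v%:~R + c) ^+ 2) = - (B ^+ 2 / 1).
  by rewrite divr1 /B exprMn sqr_sqrtr ?ltW// real_normK ?num_real.
have sq : (fun k => ((n k)%:R / rootn k) ^+ 2) @ \oo --> B ^+ 2.
  by rewrite expr2; under eq_fun do rewrite expr2; exact: cvgM.
apply: cvgM; last exact: cvg_cst.
(* The two bounds are those on the Polya weights with [N = n]; their denominators [m - n + 1] and
   [m + n] are divided by [m], since only [n / sqrt m] has a nonzero limit. *)
rewrite B2; apply: (@squeeze_cvgr _ _ _ _
  (fun k => expR (- (((n k)%:R / rootn k) ^+ 2 /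
     (1 - (n k)%:R / rootn k * (rootn k)^-1 + (rootn k)^-1 ^+ 2))))
  (fun k => expR (- (((n k)%:R / rootn k) ^+ 2 / (1 + (n k)%:R / rootn k * (rootn k)^-1))))).
- near=> k.
  have rp := rootn_gt0 k; have rn := negbT (gt_eqF rp).
  have nk : (n k <= k.+1)%N.
    have : `|0 - (n k)%:R / rootn k * (rootn k)^-1| < 1.
      by near: k; move/cvgrPdist_lt: n0 => /(_ _ ltr01).
    rewrite sub0r normrN ger0_norm; last by rewrite !mulr_ge0 ?invr_ge0 ?sqrtr_ge0.
    rewrite -mulrA -invfM -expr2 sqr_rootn ltr_pdivrMr// mul1r ltr_nat; exact: ltnW.
  have E1 : (n k)%:R / rootn k * (rootn k)^-1 = (n k)%:R / k.+1%:R.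
    by rewrite -mulrA -invfM -expr2 sqr_rootn.
  have E2 : ((n k)%:R / rootn k) ^+ 2 = (n k)%:R ^+ 2 / k.+1%:R.
    by rewrite expr_div_n sqr_rootn.
  have E3 : (rootn k)^-1 ^+ 2 = (k.+1%:R)^-1 by rewrite exprVn sqr_rootn.
  have kn : k.+1%:R != 0 :> R by rewrite pnatr_eq0.
  apply/andP; split.
    apply: le_trans (polya_weight_ge (leqnn _) nk); rewrite ler_expR lerN2 E1 E2 E3.
    have -> : 1 - (n k)%:R / k.+1%:R + (k.+1%:R)^-1 = (k.+1 - n k).+1%:R / k.+1%:R :> R.
      by rewrite -[(k.+1 - n k).+1%:R]natr1 (natrB _ nk); field.
    by rewrite invf_div mulrA divfK.
  apply: le_trans (polya_weight_le _ (leqnn _)) _; rewrite ler_expR lerN2 E1 E2.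
  have -> : 1 + (n k)%:R / k.+1%:R = (k.+1 + n k)%:R / k.+1%:R :> R.
    by rewrite natrD mulrDl divff.
  by rewrite invf_div mulrA divfK.
- apply: (cvg_continuous (@continuous_expR R)); apply: cvgN; apply: cvgM => //.
  apply: cvgV; first exact: oner_neq0.
  rewrite -[X in _ --> X]addr0 -[X in _ --> X + _]subr0.
  apply: cvgD; first by apply: cvgB => //; exact: cvg_cst.
  rewrite -[X in _ --> X](mulr0 0); under eq_fun do rewrite expr2.
  by apply: cvgM; exact: cvg_inv_rootn.
- apply: (cvg_continuous (@continuous_expR R)); apply: cvgN; apply: cvgM => //.
  apply: cvgV; first exact: oner_neq0.
  rewrite -[X in _ --> X]addr0; apply: cvgD => //; exact: cvg_cst.
Unshelve. all: by end_near. Qed.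

End FixedA.
End PoissonLine.

Section PoissonLineLimit.
Context {R : realType}.
Implicit Types (a b c x y xi th : R) (k : nat) (v : int).

Local Notation rootn k := (Num.sqrt k.+1%:R : R).

Lemma cvg_seqM (u v : nat -> R) (l m : R) : u @ \oo --> l -> v @ \oo --> m ->
  (fun k => u k * v k) @ \oo --> l * m.
Proof. exact: cvgM. Qed.

Lemma le_cos x y : 0 <= y -> y <= x -> x <= pi -> cos x <= cos y.
Proof.
move=> y0; rewrite le_eqVlt => /predU1P[->//|yx] xp.
by rewrite ltW// ltr_cos// in_itv/=; apply/andP; split; lra.
Qed.

Lemma cvg_polya_window a c xi th : 0 < a ->
  (fun k => tsum (polya_window (polya_len a k) k.+1 (polya_len a k)./2
     (polya_shift a c k) xi th)) @ \oo -->
  tsum (fun v => expR (- (pi * (v%:~R + xi) ^+ 2 / a)) *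
                 cos (2 * pi * (th - (v%:~R + xi) * c))).
Proof.
move=> a0; have p0 := pi_gt0 R.
pose L := polya_len a.
have L0 k : 0 < (L k)%:R :> R by rewrite ltr0n.
have sa : 0 < Num.sqrt (pi * a) by rewrite sqrtr_gt0 mulr_gt0.
(* For large lengths the window satisfies [|v + xi| <= 3 l / 4], so the half angle stays below
   [3 pi / 8] and its cosine above [kap]. *)
pose kap := cos (3 * pi / 8 : R).
have kap0 : 0 < kap by apply: cos_gt0_pihalf; apply/andP; split; lra.
pose b := pi ^+ 2 * kap ^+ 4 / (Num.sqrt (pi * a) + 1) ^+ 2.
have b0 : 0 < b by rewrite divr_gt0 ?mulr_gt0 ?exprn_gt0//; lra.
have e1 : expR (- b) < 1 :> R by rewrite expR_lt1 oppr_lt0.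
have Sh := asummableZ (expR (b * (`|xi| + 1 / 4))) (asummable_pow_absz (expR_ge0 _) e1).
have mE k x : k.+1%:R * (pi * x / (L k)%:R) ^+ 2 = pi ^+ 2 * x ^+ 2 / ((L k)%:R / rootn k) ^+ 2.
  rewrite !expr_div_n exprMn sqr_rootn invf_div; field.
  by rewrite !gt_eqF.
apply: (proj2 (tsum_cvg_dominated Sh _ _)).
  near=> k => v; rewrite /polya_window; case: ifP => [/andP[v1 v2]|_]; last first.
    by rewrite normr0 mulr_ge0 ?exprn_ge0 ?expR_ge0.
  rewrite normrM; apply: le_trans (gauss_le_pow v b0 (lexx `|xi|)).
  have c1 t : `|cos t| <= 1 :> R by rewrite ler_norml cos_geN1 cos_le1.
  apply: le_trans (ler_wpM2l (normr_ge0 _) (c1 _)) _.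
  rewrite mulr1; apply: le_trans (cos_pow_le _ _) _; rewrite ler_expR lerN2.
  set x := pi * _ / _.
  have vR : `|v%:~R + xi| <= 3 / 4 * (L k)%:R.
    have L4 : 4 * (`|xi| + 1) <= (L k)%:R by near: k; exact: polya_len_large.
    have hL : (2 * (L k)./2 <= L k)%N /\ (L k <= 2 * (L k)./2 + 1)%N by lia.
    have h1 : 2 * ((L k)./2)%:R <= (L k)%:R :> R by rewrite -natrM ler_nat; lia.
    have h2 : (L k)%:R <= 2 * ((L k)./2)%:R + 1 :> R by rewrite -natrM natr1 ler_nat; lia.
    have w1 : - ((L k)./2)%:R <= v%:~R :> R by rewrite -[_%:R]/((Posz _)%:~R) -rmorphN ler_int.
    have w2 : v%:~R <= (L k)%:R - ((L k)./2)%:R :> R.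
      by rewrite -[(L k)%:R]/((Posz _)%:~R) -[((L k)./2)%:R]/((Posz _)%:~R) -rmorphB ler_int; exact: (ltW v2).
    have := ler_norm xi; have := ler_norm (- xi); rewrite normrN => *.
    by rewrite ler_norml; apply/andP; split; lra.
  have xb : `|x| <= 3 * pi / 4.
    rewrite /x !normrM (gtr0_norm p0) (ger0_norm (_ : 0 <= ((L k)%:R)^-1)) ?invr_ge0//.
    by rewrite ler_pdivrMr//; nra.
  have /andP[s1 _] : x ^+ 2 * cos (x / 2) ^+ 4 <= sin x ^+ 2 <= x ^+ 2.
    by apply: sin_bounds; lra.
  have kc : kap <= cos (x / 2).
    have -> : cos (x / 2) = cos (`|x| / 2).
      by case: (ger0P x) => // _; rewrite mulNr cosN.
    by apply: le_cos; [rewrite divr_ge0|lra|lra].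
  have k4 : kap ^+ 4 <= cos (x / 2) ^+ 4.
    by apply: lerXn2r; rewrite ?nnegrE ?(ltW kap0)//; exact: le_trans (ltW kap0) kc.
  apply: (@le_trans _ _ (k.+1%:R * (x ^+ 2 * kap ^+ 4))); last first.
    rewrite ler_pM2l ?ltr0n//; apply: le_trans s1.
    by rewrite ler_wpM2l ?sqr_ge0.
  rewrite mulrA /x mE /b.
  have [_ lb] := polya_len_bounds a0 k; rewrite -/(L k) in lb.
  have r1 : (rootn k)^-1 <= 1.
    by rewrite invf_le1 ?rootn_gt0// -[X in X <= _]sqrtr1 ler_wsqrtr// ler1n.
  have u0 : 0 < (L k)%:R / rootn k by rewrite divr_gt0// rootn_gt0.
  have u2 : ((L k)%:R / rootn k) ^+ 2 <= (Num.sqrt (pi * a) + 1) ^+ 2.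
    by apply: lerXn2r; rewrite ?nnegrE ?(ltW u0)//; lra.
  have -> : pi ^+ 2 * kap ^+ 4 / (Num.sqrt (pi * a) + 1) ^+ 2 * (v%:~R + xi) ^+ 2 =
    pi ^+ 2 * (v%:~R + xi) ^+ 2 * kap ^+ 4 / (Num.sqrt (pi * a) + 1) ^+ 2 by ring.
  rewrite [leRHS]mulrAC ler_wpM2l//.
    by rewrite mulr_ge0 ?exprn_ge0 ?(ltW kap0)// mulr_ge0 ?sqr_ge0.
  by rewrite lef_pV2 ?posrE ?exprn_gt0//; lra.
move=> v; set w := v%:~R + xi.
pose x k := pi * w / (L k)%:R.
have x0 : x @ \oo --> (0 : R).
  by rewrite -(mulr0 (pi * w)); apply: cvgM; [exact: cvg_cst|exact: cvg_inv_polya_len].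
have mx : (fun k => k.+1%:R * x k ^+ 2) @ \oo --> pi * w ^+ 2 / a.
  have -> : pi * w ^+ 2 / a = pi ^+ 2 * w ^+ 2 / Num.sqrt (pi * a) ^+ 2.
    rewrite (sqr_sqrtr (ltW (mulr_gt0 p0 a0))).
    have aux (P : R) : P != 0 -> P * w ^+ 2 / a = P ^+ 2 * w ^+ 2 / (P * a).
      by move=> Pn; field; rewrite Pn lt0r_neq0.
    by apply: aux; rewrite lt0r_neq0.
  under eq_fun do rewrite mE.
  apply: cvgM; first exact: cvg_cst.
  apply: cvgV; first by rewrite expf_neq0// gt_eqF.
  by rewrite expr2; under eq_fun do rewrite expr2; apply: cvgM; exact: cvg_polya_len.
have s0 : (fun k => sin (x k) ^+ 2) @ \oo --> (0 : R).
  have -> : 0 = sin 0 * sin 0 :> R by rewrite sin0 mulr0.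
  under eq_fun do rewrite expr2.
  by apply: cvgM; apply: (cvg_continuous (@continuous_sin R)).
have ms : (fun k => k.+1%:R * sin (x k) ^+ 2) @ \oo --> pi * w ^+ 2 / a.
  apply: (@squeeze_cvgr _ _ _ _ (fun k => k.+1%:R * x k ^+ 2 * cos (x k / 2) ^+ 4)
    (fun k => k.+1%:R * x k ^+ 2)) => //.
    near=> k.
    have /andP[h1 h2] : x k ^+ 2 * cos (x k / 2) ^+ 4 <= sin (x k) ^+ 2 <= x k ^+ 2.
      apply: sin_bounds; apply: ltW; rewrite -normrN -sub0r.
      by near: k; move/cvgrPdist_lt: x0; apply.
    by rewrite -mulrA !ler_pM2l ?ltr0n// h1 h2.
  rewrite -[X in _ --> X]mulr1; apply: cvgM => //.
  have c1 : (fun k => cos (x k / 2)) @ \oo --> (1 : R).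
    rewrite -[X in _ --> X]cos0; apply: (cvg_continuous (@continuous_cos R)).
    have x2 := @cvgM _ _ _ _ x (fun=> 2^-1) _ _ x0 (cvg_cst _).
    by rewrite mul0r in x2; exact: x2.
  have c2 := cvg_seqM c1 c1; have c4 := cvg_seqM c2 c2; rewrite !mulr1 in c4.
  rewrite (_ : (fun _ => _) = (fun k => cos (x k / 2) * cos (x k / 2) *
    (cos (x k / 2) * cos (x k / 2)))); first exact: c4.
  by apply/funext => k; rewrite -!expr2 -exprM.
have cp : (fun k => cos (x k) ^+ (2 * k.+1)) @ \oo --> expR (- (pi * w ^+ 2 / a)).
  apply: (@squeeze_cvgr _ _ _ _
    (fun k => expR (- (k.+1%:R * sin (x k) ^+ 2 / (1 - sin (x k) ^+ 2))))
    (fun k => expR (- (k.+1%:R * sin (x k) ^+ 2)))).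
  - near=> k; have s1 : sin (x k) ^+ 2 < 1.
      apply: le_lt_trans (ler_norm _) _; rewrite -normrN -sub0r.
      by near: k; move/cvgrPdist_lt: s0; apply.
    by have [h1 h2] := @cos_pow_bounds R k.+1 _ s1; rewrite -mulrA h1 h2.
  - apply: (cvg_continuous (@continuous_expR R)); apply: cvgN.
    rewrite -[X in _ --> X]divr1; apply: cvgM => //; apply: cvgV; first exact: oner_neq0.
    by rewrite -[X in _ --> X]subr0; apply: cvgB => //; exact: cvg_cst.
  - by apply: (cvg_continuous (@continuous_expR R)); apply: cvgN.
have cc : (fun k => cos (2 * pi * (th - w * ((polya_shift a c k)%:~R / (L k)%:R)))) @ \oo -->
    cos (2 * pi * (th - w * c)).
  apply: (cvg_continuous (@continuous_cos R)); apply: cvgM; first exact: cvg_cst.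
  apply: cvgB; first exact: cvg_cst.
  by apply: cvgM; [exact: cvg_cst|exact: cvg_polya_shift].
have := cvg_seqM cp cc; apply: cvg_trans; apply: near_eq_cvg; near=> k.
rewrite /polya_window ifT//.
have : 2 * ((absz v)%:R + 2) <= (L k)%:R :> R by near: k; exact: polya_len_large.
rewrite -natrD -natrM ler_nat -/(L k).
by move: (L k) => l; lia.
Unshelve. all: by end_near. Qed.

Definition theta_const a : R := tsum (fun v => expR (- (pi * a * (v%:~R + 0) ^+ 2))).

Lemma theta_const_gt0 a : 0 < a -> 0 < theta_const a.
Proof.
move=> a0; have S := @asummable_gauss R (pi * a) 0 (mulr_gt0 (pi_gt0 R) a0).
have := @tsum_seq_le _ _ [:: 0 : int] _ S (fun=> expR_ge0 _) isT.
by rewrite big_seq1; apply: lt_le_trans; exact: expR_gt0.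
Qed.

(** The limit of the normalising constant is read off the Polya identity with all shifts zero. The
    sequence does not depend on [a], although its limit is written in terms of [a]. *)
Lemma polya_const_cvg a : 0 < a ->
  (fun k => 4 ^+ k.+1 / 'C(2 * k.+1, k.+1)%:R / rootn k) @ \oo -->
  Num.sqrt (pi * a) * (theta_const a / theta_const a^-1).
Proof.
move=> a0; have ia0 : 0 < a^-1 by rewrite invr_gt0.
have W := @cvg_polya_term R a a0 0 0 0.
have V := @cvg_polya_window a 0 0 0 a0.
have wE : tsum (fun v => expR (- (pi * a * (v%:~R + 0) ^+ 2)) *
    cos (2 * pi * (v%:~R * 0 + 0))) = theta_const a.
  by apply: eq_tsum => v; rewrite mulr0 !addr0 mulr0 cos0 mulr1.
have vE : tsum (fun v => expR (- (pi * (v%:~R + 0) ^+ 2 / a)) *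
    cos (2 * pi * (0 - (v%:~R + 0) * 0))) = theta_const a^-1.
  apply: eq_tsum => v; rewrite !addr0 mulr0 subr0 mulr0 cos0 mulr1.
  by congr (expR (- _)); rewrite mulrAC.
rewrite wE in W; rewrite vE in V.
have tn : theta_const a^-1 != 0 by rewrite gt_eqF// theta_const_gt0.
pose w k : R := tsum (polya_window (polya_len a k) k.+1 (polya_len a k)./2 (polya_shift a 0 k) 0 0).
pose t k : R := tsum (polya_term (polya_len a k) k.+1 (polya_shift a 0 k) 0 0).
have wpos : \forall k \near \oo, 0 < w k.
  move/cvgrPdist_lt: V => /(_ _ (theta_const_gt0 ia0)); apply: filterS => k.
  by rewrite -/(w k) ltr_norml => /andP[_]; lra.
have V' : (fun k => (w k)^-1) @ \oo --> (theta_const a^-1)^-1 by exact: cvgV.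
have : (fun k => (polya_len a k)%:R / rootn k * (t k * (w k)^-1)) @ \oo -->
    Num.sqrt (pi * a) * (theta_const a / theta_const a^-1).
  by apply: cvg_seqM; [exact: cvg_polya_len|exact: cvg_seqM].
apply: cvg_trans; apply: near_eq_cvg; near=> k.
have l0 : (0 < polya_len a k)%N by [].
have ln : (polya_len a k)%:R != 0 :> R by rewrite pnatr_eq0 -lt0n.
rewrite /t /w -(polya_identity _ (polya_len a k)./2 _ _ _ l0).
have t0 : 0 < w k by near: k.
by rewrite -/(w k) mulfK ?gt_eqF// mulrC mulrA divfK.
Unshelve. all: by end_near. Qed.

(** The limits found for [a] and for 1 agree, and at 1 the quotient of theta constants is 1. *)
Lemma theta_constV a : 0 < a -> theta_const a / theta_const a^-1 = (Num.sqrt a)^-1.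
Proof.
move=> a0; have h1 := polya_const_cvg a0; have h2 := @polya_const_cvg 1 ltr01.
have : Num.sqrt (pi * a) * (theta_const a / theta_const a^-1) =
    Num.sqrt (pi * 1) * (theta_const 1 / theta_const 1^-1).
  by apply: (cvg_unique _ h1 h2).
rewrite invr1 divff ?gt_eqF ?theta_const_gt0// !mulr1.
rewrite sqrtrM ?ltW ?pi_gt0// => E.
have sp : Num.sqrt pi != 0 :> R by rewrite gt_eqF// sqrtr_gt0 pi_gt0.
have sa : Num.sqrt a != 0 by rewrite gt_eqF// sqrtr_gt0.
by apply: (mulfI sa); apply: (mulfI sp); rewrite [LHS]mulrA E divff// mulr1.
Qed.

Theorem poisson_line a c xi th : 0 < a ->
  tsum (fun v => expR (- (pi * a * (v%:~R + c) ^+ 2)) * cos (2 * pi * (v%:~R * xi + th))) =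
  (Num.sqrt a)^-1 * tsum (fun v => expR (- (pi * (v%:~R + xi) ^+ 2 / a)) *
                                   cos (2 * pi * (th - (v%:~R + xi) * c))).
Proof.
move=> a0; have W := @cvg_polya_term R a a0 c xi th.
have V := @cvg_polya_window a c xi th a0.
have lim1 : (fun k => 4 ^+ k.+1 / 'C(2 * k.+1, k.+1)%:R / (polya_len a k)%:R) @ \oo -->
    (Num.sqrt a)^-1.
  have sp : 0 < Num.sqrt (pi * a) by rewrite sqrtr_gt0 mulr_gt0// pi_gt0.
  have lV : (fun k => ((polya_len a k)%:R / rootn k)^-1) @ \oo --> (Num.sqrt (pi * a))^-1.
    by apply: cvgV; [rewrite gt_eqF|exact: cvg_polya_len].
  have := cvg_seqM (polya_const_cvg a0) lV.
  rewrite theta_constV// mulrAC divff ?gt_eqF// mul1r.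
  apply: cvg_trans; apply: near_eq_cvg; near=> k.
  by rewrite /= invf_div mulrA divfK// gt_eqF// rootn_gt0.
apply: (@cvg_unique _ _ _ _ _ _ W (cvg_trans _ (cvg_seqM lim1 V))) => //.
apply: near_eq_cvg; near=> k.
by rewrite /= (polya_identity _ (polya_len a k)./2).
Unshelve. all: by end_near. Qed.

End PoissonLineLimit.

(** * Positive definite forms and Schur complements *)

Section QuadraticForms.
Context {R : realType}.

Definition qform n (A : 'M[R]_n) (x : 'rV[R]_n) : R := (x *m A *m x^T) 0 0.
Definition mdot n (x y : 'rV[R]_n) : R := (x *m y^T) 0 0.

Definition sym_posdef n (A : 'M[R]_n) : Prop :=
  A^T = A /\ forall x, x != 0 -> 0 < qform A x.

Lemma mdotC n (x y : 'rV[R]_n) : mdot x y = mdot y x.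
Proof. by rewrite /mdot -[x *m y^T]trmxK mxE trmx_mul trmxK. Qed.

Lemma mdotDl n (x y z : 'rV[R]_n) : mdot (x + y) z = mdot x z + mdot y z.
Proof. by rewrite /mdot mulmxDl mxE. Qed.

Lemma mdotZl n (a : R) (x z : 'rV[R]_n) : mdot (a *: x) z = a * mdot x z.
Proof. by rewrite /mdot -scalemxAl mxE. Qed.

Lemma mdotDr n (x y z : 'rV[R]_n) : mdot x (y + z) = mdot x y + mdot x z.
Proof. by rewrite ![mdot x _]mdotC mdotDl. Qed.

Lemma mdotZr n (a : R) (x z : 'rV[R]_n) : mdot x (a *: z) = a * mdot x z.
Proof. by rewrite ![mdot x _]mdotC mdotZl. Qed.

Lemma mdotNr n (x z : 'rV[R]_n) : mdot x (- z) = - mdot x z.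
Proof. by rewrite -scaleN1r mdotZr mulN1r. Qed.

Lemma mdot_row n (x1 y1 : R) (x y : 'rV[R]_n) :
  mdot (row_mx x1%:M x : 'rV_(1 + n)) (row_mx y1%:M y) = x1 * y1 + mdot x y.
Proof.
rewrite /mdot tr_row_mx mul_row_col tr_scalar_mx -scalar_mxM mxE; congr (_ + _).
by rewrite mxE eqxx mulr1n.
Qed.

Lemma qformE n (A : 'M[R]_n) x : qform A x = mdot (x *m A) x. Proof. by []. Qed.

Section Schur.
Variables (n : nat) (a : R) (b : 'rV[R]_n) (D : 'M[R]_n).

(** What remains of the form after completing the square in the first coordinate; inductions on the
    dimension pass to it. *)
Definition schur : 'M[R]_n := D - a^-1 *: (b^T *m b).

Let A : 'M[R]_(1 + n) := block_mx a%:M b b^T D.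

Lemma qform_schur (x1 : R) (x : 'rV[R]_n) : a != 0 ->
  qform A (row_mx x1%:M x) = a * (x1 + mdot x b / a) ^+ 2 + qform schur x.
Proof.
move=> a0; rewrite qformE /A mul_row_block -scalar_mxM.
have -> : (x1 * a)%:M + x *m b^T = (x1 * a + mdot x b)%:M.
  by rewrite raddfD /= [x *m b^T]mx11_scalar.
rewrite mdot_row mdotDl mul_scalar_mx mdotZl [mdot b x]mdotC.
have -> : qform schur x = mdot (x *m D) x - a^-1 * mdot x b ^+ 2.
  rewrite qformE /schur mulmxBr -scalemxAr mulmxA mdotDl [X in _ + X]mdotC mdotNr mdotZr.
  congr (_ - _ * _); rewrite mdotC [x *m b^T]mx11_scalar mul_scalar_mx mdotZl.
  by rewrite [mdot b x]mdotC expr2.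
by field; exact: a0.
Qed.

Lemma det_schur : a != 0 -> \det A = a * \det schur.
Proof.
move=> a0; have -> : A = block_mx 1%:M 0 (a^-1 *: b^T) 1%:M *m block_mx a%:M b 0 schur.
  rewrite mulmx_block !mul1mx !mul0mx ?mulmx0 !addr0 /A; congr block_mx.
    by rewrite mul_mx_scalar scalerA divff ?scale1r.
  by rewrite /schur -scalemxAl addrC subrK.
by rewrite det_mulmx det_lblock !det1 !mul1r det_ublock det_scalar1.
Qed.

Lemma schur_posdef : sym_posdef A -> 0 < a /\ sym_posdef schur.
Proof.
case=> symA posA.
have a0 : 0 < a.
  have := posA (row_mx 1%:M 0); rewrite qformE /A mul_row_block !mul0mx !addr0 mul1mx mdot_row.
  rewrite mdotC /mdot mul0mx mxE addr0 mulr1; apply.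
  apply/eqP => /(congr1 lsubmx); rewrite row_mxKl => /matrixP/(_ 0 0).
  by rewrite !mxE eqxx => /eqP; rewrite oner_eq0.
split=> //; split.
  have : D^T = D by move: symA; rewrite /A tr_block_mx => /eq_block_mx[].
  by rewrite /schur linearB linearZ /= trmx_mul trmxK => ->.
move=> x x0; have := posA (row_mx (- (mdot x b / a))%:M x).
rewrite qform_schur ?gt_eqF// addNr expr0n mulr0 add0r; apply.
apply: contra x0 => /eqP /(congr1 rsubmx); rewrite row_mxKr => ->.
by rewrite linear0.
Qed.

End Schur.

Lemma block_split n (A : 'M[R]_(1 + n)) : A^T = A ->
  A = block_mx (A 0 0)%:M (ursubmx A) (ursubmx A)^T (drsubmx A).
Proof.
move=> symA; rewrite -[LHS]submxK; congr block_mx.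
  by rewrite [ulsubmx A]mx11_scalar !mxE; congr (A _ _)%:M; apply/val_inj.
by rewrite -[in LHS]symA trmx_ursub.
Qed.

Lemma posdef_det_gt0 n (A : 'M[R]_n) : sym_posdef A -> 0 < \det A.
Proof.
elim: n A => [|n IH] A pA; first by rewrite det_mx00.
move: A pA; rewrite -[n.+1]/(1 + n)%N => A pA.
have E := block_split pA.1.
have [a0 pS] : 0 < A 0 0 /\ sym_posdef (schur (A 0 0) (ursubmx A) (drsubmx A)).
  by apply: schur_posdef; rewrite -E.
by rewrite E det_schur ?gt_eqF// mulr_gt0// IH.
Qed.

Lemma posdef_unit n (A : 'M[R]_n) : sym_posdef A -> A \in unitmx.
Proof. by move=> /posdef_det_gt0 d0; rewrite unitmxE unitfE gt_eqF. Qed.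

Lemma qform_inv n (A : 'M[R]_n) x : A^T = A -> A \in unitmx ->
  qform (invmx A) (x *m A) = qform A x.
Proof.
by move=> sA uA; rewrite /qform -(mulmxA x) mulmxV// mulmx1 trmx_mul sA mulmxA.
Qed.

Lemma posdef_inv n (A : 'M[R]_n) : sym_posdef A -> sym_posdef (invmx A).
Proof.
move=> pA; have uA := posdef_unit pA; case: (pA) => sA posA; split.
  by rewrite trmx_inv sA.
move=> x x0; have -> : x = (x *m invmx A) *m A by rewrite mulmxKV.
rewrite qform_inv//; apply: posA; apply: contra x0 => /eqP e.
by rewrite -[x](mulmxKV uA) e mul0mx.
Qed.

(** The completion of squares dual to [qform_schur]: the shear now moves the remaining coordinates
    by a multiple of the first. It recombines the two Gaussians in the induction step of Poisson
    summation. *)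
Lemma qform_inv_schur n (A : 'M[R]_(1 + n)) (x1 : R) (x : 'rV[R]_n) :
  sym_posdef A ->
  let a := A 0 0 in let b := ursubmx A in
  qform (invmx A) (row_mx x1%:M x) =
  x1 ^+ 2 / a + qform (invmx (schur a b (drsubmx A))) (x - (x1 / a) *: b).
Proof.
move=> pA a b; have E := block_split pA.1; have uA := posdef_unit pA.
set S := schur a b (drsubmx A).
have [a0 pS] : 0 < a /\ sym_posdef S by apply: schur_posdef; rewrite -E.
have an : a != 0 by rewrite gt_eqF.
set y := row_mx x1%:M x *m invmx A.
have xE : row_mx x1%:M x = y *m A by rewrite mulmxKV.
pose y1 := lsubmx y 0 0; pose y' := rsubmx y.
have yE : y = row_mx y1%:M y' by rewrite -[LHS]hsubmxK [lsubmx y]mx11_scalar.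
rewrite xE qform_inv ?pA.1//.
move: xE; rewrite {1}yE {1}E mul_row_block => /eq_row_mx[x1E xE].
have x1E' : x1 = y1 * a + mdot y' b.
  by have := congr1 (fun m : 'M[R]_(1, 1) => m 0 0) x1E;
    rewrite -scalar_mxM /= [LHS]mxE eqxx mulr1n [RHS]mxE [X in _ = X + _]mxE eqxx mulr1n.
rewrite {1}yE E qform_schur// -/S -(@qform_inv _ S y') ?pS.1 ?posdef_unit//.
have -> : y1 + mdot y' b / a = x1 / a by rewrite x1E' mulrDl mulfK.
suff -> : x - (x1 / a) *: b = y' *m S by rewrite -/a; congr (_ + _); field.
rewrite xE mul_scalar_mx /S /schur mulmxBr -scalemxAr mulmxA [y' *m b^T]mx11_scalar.
rewrite mul_scalar_mx scalerA -/(mdot y' b) x1E' mulrDl mulfK// scalerDl.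
by rewrite addrAC opprD !addrA subrr add0r addrC [a^-1 * _]mulrC.
Qed.

End QuadraticForms.

(** * Poisson summation for positive definite forms *)

Section PoissonLattice.
Context {R : realType}.

Definition rint n (z : 'rV[int]_n) : 'rV[R]_n := map_mx intr z.

Definition row_cons n (x : 'rV[int]_n * int) : 'rV[int]_(1 + n) := row_mx x.2%:M x.1.

Lemma row_cons_bij n : bijective (@row_cons n).
Proof.
exists (fun z => (rsubmx z, lsubmx z 0 0)) => [[z m]|z]; rewrite /row_cons /=.
  by rewrite row_mxKr row_mxKl mxE eqxx mulr1n.
by rewrite -mx11_scalar hsubmxK.
Qed.

Lemma rint_row_cons n (z : 'rV[int]_n) m : rint (row_cons (z, m)) = row_mx m%:~R%:M (rint z).
Proof. by rewrite /rint /row_cons map_row_mx map_scalar_mx. Qed.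

(** The sum has period 1 in [c], so only shifts in [[0, 1)] matter. *)
Lemma gauss_uniform (b : R) : 0 < b -> exists2 K, 0 <= K &
  forall c, tsum (fun v : int => expR (- (b * (v%:~R + c) ^+ 2))) <= K.
Proof.
move=> b0; have e1 : expR (- b) < 1 :> R by rewrite expR_lt1 oppr_lt0.
have Sp := asummable_pow_absz (expR_ge0 (- b)) e1.
exists (tsum (fun v : int => expR (b * (1 + 1 / 4)) * expR (- b) ^+ absz v)).
  by apply: tsum_ge0 => v; rewrite mulr_ge0 ?exprn_ge0 ?expR_ge0.
move=> c; pose m := Num.floor c; pose f := c - m%:~R.
have /andP[f0 f1] := floor_itv c; rewrite rmorphD /= in f1.
have bm : bijective (fun v : int => v - m) by exists (fun v => v + m) => v; rewrite ?subrK ?addrK.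
rewrite -(tsum_bij _ bm); apply: le_tsum => [||v] /=.
- rewrite (_ : _ \o _ = (fun v : int => expR (- (b * (v%:~R + f) ^+ 2)))).
    exact: asummable_gauss.
  by apply/funext => v /=; rewrite rmorphB /= /f; congr (expR (- (b * (_ ^+ 2)))); ring.
- exact: asummableZ.
have -> : (v - m)%:~R + c = v%:~R + f by rewrite rmorphB /= /f; ring.
apply: gauss_le_pow => //; rewrite ler_norml /f /m; apply/andP; split; lra.
Qed.

Lemma asummable_qform n (A : 'M[R]_n) (u : 'rV[R]_n) : sym_posdef A ->
  asummable (fun z => expR (- (pi * qform A (rint z + u)))).
Proof.
elim: n A u => [|n IH] A u pA.
  apply: (proj1 (asummable1 (t := 0) _)) => z; rewrite (_ : z = 0) ?eqxx//.
  by apply/rowP => -[].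
move: A u pA; rewrite -[n.+1]/(1 + n)%N => A u pA.
have E := block_split pA.1.
set a := A 0 0 in E; set b := ursubmx A in E; set D := drsubmx A in E.
have [a0 pS] : 0 < a /\ sym_posdef (schur a b D) by apply: schur_posdef; rewrite -E.
have an : a != 0 by rewrite gt_eqF.
pose u1 := lsubmx (u : 'rV_(1 + n)) 0 0; pose u' := rsubmx (u : 'rV_(1 + n)).
have uE : u = row_mx u1%:M u' by rewrite -mx11_scalar hsubmxK.
apply: (asummable_bij (@row_cons_bij n)).
have pa : 0 < pi * a by rewrite mulr_gt0// pi_gt0.
have fE z m : expR (- (pi * qform A (rint (row_cons (z, m)) + u))) =
    expR (- (pi * qform (schur a b D) (rint z + u'))) *
    expR (- (pi * a * (m%:~R + (u1 + mdot (rint z + u') b / a)) ^+ 2)).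
  rewrite rint_row_cons {1}uE add_row_mx -raddfD /= E qform_schur//.
  by rewrite -expRD; congr expR; rewrite addrA; ring.
have [K K0 HK] := gauss_uniform pa.
apply: asummable_iter => [z|].
  under eq_fun do rewrite /comp fE.
  by apply: asummableZ; exact: asummable_gauss.
apply: asummable_le (asummableZr K (IH _ u' pS)) => z.
rewrite ger0_norm ?tsum_ge0//.
rewrite (eq_tsum (g := fun m : int => expR (- (pi * qform (schur a b D) (rint z + u'))) *
    expR (- (pi * a * (m%:~R + (u1 + mdot (rint z + u') b / a)) ^+ 2)))); last first.
  by move=> m; rewrite /comp fE ger0_norm ?mulr_ge0 ?expR_ge0.
rewrite tsumZ; last exact: asummable_gauss.
by rewrite ler_wpM2l ?expR_ge0.
Qed.

(** Induction on the dimension, with Poisson summation on the line in the first coordinate. The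
    shift [b . z / a] of that line sum becomes a phase linear in [z], which moves [xi] in the
    induction hypothesis. The constant phase [th] is present so that the inner sum, which carries
    the phase of the other coordinates, is of the same kind. *)
Theorem poisson_qform n (A : 'M[R]_n) (xi : 'rV[R]_n) (th : R) : sym_posdef A ->
  tsum (fun z => expR (- (pi * qform A (rint z))) * cos (2 * pi * (mdot (rint z) xi + th))) =
  (Num.sqrt (\det A))^-1 * cos (2 * pi * th) *
  tsum (fun z => expR (- (pi * qform (invmx A) (rint z + xi)))).
Proof.
elim: n A xi th => [|n IH] A xi th pA.
  have z0 (z : 'rV[int]_0) : z = 0 by apply/rowP => -[].
  have q0 (B : 'M[R]_0) x : qform B x = 0 by rewrite /qform thinmx0 mul0mx mxE.
  rewrite (tsum_seq (s := [:: 0]) _ _).2 ?big_seq1//; last by move=> z; rewrite (z0 z) mem_head.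
  rewrite [in RHS](tsum_seq (s := [:: 0]) _ _).2 ?big_seq1//; last by move=> z; rewrite (z0 z) mem_head.
  rewrite !q0 mulr0 oppr0 expR0 mulr1 mul1r det_mx00 sqrtr1 invr1 mul1r.
  by rewrite /mdot thinmx0 mul0mx mxE add0r.
move: A xi pA; rewrite -[n.+1]/(1 + n)%N => A xi pA.
have E := block_split pA.1.
set a := A 0 0 in E; set b := ursubmx A in E; set D := drsubmx A in E.
have [a0 pS] : 0 < a /\ sym_posdef (schur a b D) by apply: schur_posdef; rewrite -E.
set S := schur a b D in pS.
have an : a != 0 by rewrite gt_eqF.
pose x1 := lsubmx (xi : 'rV_(1 + n)) 0 0; pose x' := rsubmx (xi : 'rV_(1 + n)).
have xE : xi = row_mx x1%:M x' by rewrite -mx11_scalar hsubmxK.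
have pi0 := pi_gt0 R.
have pa : 0 < pi * a by rewrite mulr_gt0.
have pia : 0 < pi / a by rewrite divr_gt0.
have cb t : `|cos t| <= 1 :> R by rewrite ler_norml cos_geN1 cos_le1.
have S0 : asummable (fun z : 'rV[int]_n => expR (- (pi * qform S (rint z)))).
  by have := asummable_qform 0 pS; under eq_fun do rewrite addr0.
rewrite -(tsum_bij _ (row_cons_bij n)).
have fE z m : expR (- (pi * qform A (rint (row_cons (z, m))))) *
     cos (2 * pi * (mdot (rint (row_cons (z, m))) xi + th)) =
   expR (- (pi * qform S (rint z))) *
    (expR (- (pi * a * (m%:~R + mdot (rint z) b / a) ^+ 2)) *
     cos (2 * pi * (m%:~R * x1 + (mdot (rint z) x' + th)))).
  rewrite rint_row_cons {1}E qform_schur// xE mdot_row mulrA -expRD -addrA.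
  by congr (expR _ * _); ring.
have Sf : asummable ((fun z : 'rV[int]_(1 + n) => expR (- (pi * qform A (rint z))) *
     cos (2 * pi * (mdot (rint z) xi + th))) \o @row_cons n).
  apply: asummable_inj; first exact: bij_inj (row_cons_bij n).
  have := asummable_qform 0 pA; under eq_fun do rewrite addr0.
  by apply: asummable_le => z; rewrite normrM ger0_norm ?expR_ge0// ler_piMr ?expR_ge0.
have [_ _ ->] := tsum_iter Sf.
pose g (z : 'rV[int]_n) (m : int) := expR (- (pi * qform S (rint z))) *
   (expR (- (pi * (m%:~R + x1) ^+ 2 / a)) *
    cos (2 * pi * (mdot (rint z) (x' - ((m%:~R + x1) / a) *: b) + th))).
have lineE z : tsum (fun m => ((fun z => expR (- (pi * qform A (rint z))) *
     cos (2 * pi * (mdot (rint z) xi + th))) \o @row_cons n) (z, m)) =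
   (Num.sqrt a)^-1 * tsum (g z).
  rewrite (eq_tsum (fE z)) tsumZ; last first.
    apply: asummable_le (asummable_gauss (mdot (rint z) b / a) pa) => m.
    by rewrite normrM ger0_norm ?expR_ge0// ler_piMr ?expR_ge0.
  rewrite poisson_line// mulrCA -tsumZ; last first.
    apply: asummable_le (asummable_gauss x1 pia) => m.
    rewrite normrM ger0_norm ?expR_ge0//.
    by rewrite [pi * _ / a]mulrAC ler_piMr ?expR_ge0.
  congr (_ * _); apply: eq_tsum => m; rewrite /g; congr (_ * (_ * cos (_ * _))).
  rewrite mdotDr mdotNr mdotZr; ring.
have Sg : asummable (fun x => g x.1 x.2).
  have [Sm _] := tsum_mul S0 (asummable_gauss x1 pia).
  apply: asummable_le Sm => -[z m] /=.
  rewrite /g !normrM !(ger0_norm (expR_ge0 _)) ler_wpM2l ?expR_ge0//.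
  apply: le_trans (ler_wpM2l (expR_ge0 _) (cb _)) _.
  by rewrite mulr1 mulrAC.
rewrite (eq_tsum lineE) tsumZ; last by have [_ h _] := tsum_iter Sg; exact: h.
rewrite (tsum_exchange Sg).
have innerE m : tsum (fun z => g z m) =
    (Num.sqrt (\det S))^-1 * cos (2 * pi * th) *
    tsum (fun z : 'rV[int]_n => expR (- (pi * qform (invmx A) (rint (row_cons (z, m)) + xi)))).
  transitivity (expR (- (pi * (m%:~R + x1) ^+ 2 / a)) *
      tsum (fun z => expR (- (pi * qform S (rint z))) *
         cos (2 * pi * (mdot (rint z) (x' - ((m%:~R + x1) / a) *: b) + th)))).
    rewrite -tsumZ; first by apply: eq_tsum => z; rewrite /g mulrCA.
    by apply: asummable_le S0 => z; rewrite normrM ger0_norm ?expR_ge0// ler_piMr ?expR_ge0.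
  rewrite (IH S _ _ pS) mulrCA; congr (_ * _).
  rewrite -tsumZ; last exact: (asummable_qform _ (posdef_inv pS)).
  apply: eq_tsum => z; rewrite rint_row_cons [in RHS]xE add_row_mx -raddfD /=.
  by rewrite qform_inv_schur// -expRD -/a -/b -/D -/S; congr expR; rewrite addrA; ring.
rewrite (eq_tsum innerE).
have SM : asummable (fun x : 'rV[int]_n * int => expR (- (pi * qform (invmx A) (rint (row_cons x) + xi)))).
  apply: (asummable_inj (e := @row_cons n) (f := fun z => expR (- (pi * qform (invmx A) (rint z + xi))))).
    exact: bij_inj (row_cons_bij n).
  exact: (asummable_qform _ (posdef_inv pA)).
rewrite tsumZ; last by have [_ h _] := tsum_iter (asummable_swap SM); exact: h.
rewrite mulrA mulrA -invfM -sqrtrM ?ltW//; congr (_ * _ * _).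
  by rewrite E det_schur.
rewrite -[RHS](tsum_bij _ (row_cons_bij n)).
have [_ _ ->] := tsum_iter SM.
apply: esym; apply: (tsum_exchange (f := fun z m => expR (- (pi * qform (invmx A) (rint (row_cons (z, m)) + xi))))).
by move: SM; congr asummable; apply/funext => -[].
Qed.

End PoissonLattice.

(** * Theta series of unimodular lattices *)

Section GeneratingSeries.
Context {R : realType}.

Definition counting_series (T : choiceType) (N : T -> nat) : fps R :=
  Fps (fun m => tsum (fun t => (N t == m)%:R)).

Section Weight.
Variables (T : choiceType) (N : T -> nat).
Hypothesis SN : forall r : R, 0 <= r -> r < 1 -> asummable (fun t => r ^+ N t).

Let ind_summable m : asummable (fun t => (N t == m)%:R : R).
Proof.
have h0 : 0 <= 2^-1 :> R by rewrite invr_ge0 ler0n.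
have h1 : 2^-1 < 1 :> R by lra.
have [h _ _] := tsum_fiber N (SN h0 h1).
apply: asummable_le (asummableZ (2 ^+ m) (h m)) => t.
case: eqP => [->|_]; last by rewrite mulr0 normr0.
by rewrite normr1 -exprMn divff ?expr1n.
Qed.

Let SNx (x : R) : `|x| < 1 -> asummable (fun t => x ^+ N t).
Proof.
move=> x1; apply: asummable_le (SN (normr_ge0 x) x1) => t.
by rewrite normrX.
Qed.

Let fiberE (x : R) m :
  tsum (fun t => if N t == m then x ^+ N t else 0) = counting_series N m * x ^+ m.
Proof.
rewrite /= -tsumZr//; apply: eq_tsum => t.
by case: eqP => [->|_]; rewrite ?mul1r ?mul0r.
Qed.

Lemma conv_counting_series : conv (counting_series N).
Proof.
move=> r r0 r1; have [_ + _] := tsum_fiber N (SN r0 r1).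
by under eq_fun do rewrite fiberE.
Qed.

Lemma fev_counting_series (x : R) : `|x| < 1 ->
  fev (counting_series N) x = tsum (fun t => x ^+ N t).
Proof.
move=> x1; have [_ _ ->] := tsum_fiber N (SNx x1).
by rewrite /fev; apply: eq_tsum => m; rewrite fiberE.
Qed.

Lemma counting_series_ge0 m : 0 <= counting_series N m.
Proof. by apply: tsum_ge0 => t; rewrite ler0n. Qed.

Lemma counting_series_eq0 m : (forall t, N t != m) -> counting_series N m = 0.
Proof.
move=> H; rewrite /= -(@tsum0 R T); apply: eq_tsum => t.
by rewrite (negbTE (H t)).
Qed.

Lemma counting_series1 m t : (forall u, (N u == m) = (u == t)) ->
  counting_series N m = 1.
Proof.
move=> H; have [|_ /= ->] := @asummable1 R T t (fun t => (N t == m)%:R).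
  by move=> u ut; rewrite H (negbTE ut).
by rewrite H eqxx.
Qed.

(** A finite set that reaches the sum up to less than 1 contains every element of weight [m]. *)
Lemma counting_series_nat m : exists k : nat, counting_series N m = k%:R.
Proof.
pose c := counting_series N m.
have [s us sc] := tsum_approx (fun t => ler0n _ (N t == m)) (ind_summable m) (ltr01 : 0 < 1 :> R).
have le : \sum_(t <- s) (N t == m)%:R <= c.
  by apply: tsum_seq_le => // t; rewrite ler0n.
exists (count (fun t => N t == m) s).
have cE (s' : seq T) : \sum_(t <- s') (N t == m)%:R = (count (fun t => N t == m) s')%:R :> R.
  by elim: s' => [|t s' IH]; rewrite ?big_nil// big_cons IH /= natrD.
rewrite -cE; have [|_] := @tsum_seq R T s (fun t => (N t == m)%:R) us; last by [].
move=> t ts; case: eqP => // Nt; exfalso.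
have : \sum_(t <- t :: s) (N t == m)%:R <= c :> R.
  by apply: tsum_seq_le => [|u|] //=; rewrite ?ler0n ?ts.
have {}sc : c - \sum_(t <- s) (N t == m)%:R < 1 := sc.
by rewrite big_cons Nt eqxx => h; have {h} : 1 + \sum_(t <- s) (N t == m)%:R <= c := h; lra.
Qed.

End Weight.

(* c has weight n/2 for the theta group, and d, a series in q^(1/4), is its expansion at the other cusp. *)
Definition modular_pair (n : nat) (c d : fps R) : Prop :=
  [/\ conv c, conv d,
    forall y, 0 < y -> fev c (expR (- (pi * y))) =
      (Num.sqrt y)^-1 ^+ n * fev c (expR (- (pi / y))) &
    forall y, 0 < y -> fev c (- expR (- (pi * y))) =
      (Num.sqrt y)^-1 ^+ n * fev d (expR (- (pi / 4 / y)))].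

End GeneratingSeries.

(** * Gram matrices, theta series and shadows *)

Section UnimodularLattice.
Context {R : realType}.
Variable n : nat.

Definition gram_form (G : 'M[int]_n) (z : 'rV[int]_n) : int := (z *m G *m z^T) 0 0.

(** Modulo 2 the norm is additive, as its polar form is even, and [c^2 = c]; so the diagonal of the
    Gram matrix computes it. This is the existence of a characteristic vector. *)
Lemma gram_form_parity (G : 'M[int]_n) (z : 'rV[int]_n) : G^T = G ->
  (2 %| gram_form G z - \sum_j z 0 j * G j j)%Z.
Proof.
move=> sG; pose P (x : 'rV[int]_n) := (2 %| gram_form G x - \sum_j x 0 j * G j j)%Z.
have polar (x y : 'rV[int]_n) : gram_form G (x + y) =
    gram_form G x + gram_form G y + 2 * (x *m G *m y^T) 0 0.
  have sym : (y *m G *m x^T) 0 0 = (x *m G *m y^T) 0 0.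
    by rewrite -[y *m G *m x^T]trmxK mxE !trmx_mul trmxK sG mulmxA.
  rewrite /gram_form linearD /= !mulmxDl !mulmxDr !mxE.
  move: sym; rewrite !mxE => ->; ring.
rewrite -/(P z) [z]matrix_sum_delta big_ord1; elim/big_ind: _.
- rewrite /P /gram_form mul0mx mul0mx mxE big1 ?subr0// => j _.
  by rewrite mxE mul0r.
- move=> x y Px Py; rewrite /P polar.
  have -> : \sum_j (x + y) 0 j * G j j = \sum_j x 0 j * G j j + \sum_j y 0 j * G j j.
    by rewrite -big_split /=; apply: eq_bigr => j _; rewrite mxE mulrDl.
  have -> : gram_form G x + gram_form G y + 2 * (x *m G *m y^T) 0 0 -
      (\sum_j x 0 j * G j j + \sum_j y 0 j * G j j) =
    (gram_form G x - \sum_j x 0 j * G j j) + (gram_form G y - \sum_j y 0 j * G j j) +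
      2 * (x *m G *m y^T) 0 0 by ring.
  by rewrite rpredD ?dvdz_mulr// rpredD.
- move=> j _; rewrite /P (bigD1 j)//= big1 ?addr0; last first.
    by move=> k kj; rewrite !mxE (negbTE kj) andbF mulr0 mul0r.
  rewrite !mxE !eqxx mulr1.
  have -> : gram_form G (z 0 j *: delta_mx 0 j) = z 0 j ^+ 2 * G j j.
    rewrite /gram_form linearZ /= -!scalemxAl -scalemxAr scalerA mxE expr2; congr (_ * _).
    by rewrite -rowE trmx_delta -colE !mxE.
  have -> : z 0 j ^+ 2 * G j j - z 0 j * G j j = (z 0 j * (z 0 j - 1)) * G j j by ring.
  rewrite dvdz_mulr//; move: (z 0 j) => c.
  have [m [->|->]] : exists m : int, c = 2 * m \/ c = 2 * m + 1 by exists (divz c 2); lia.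
    by rewrite -mulrA dvdz_mulr.
  by rewrite addrK mulrC -mulrA dvdz_mulr.
Qed.

Variable L : set 'rV[R]_n.
Hypothesis uL : unimodular L.

Lemma dotp_mdot (x y : 'rV[R]_n) : dotp x y = mdot x y.
Proof. by rewrite /dotp /mdot mxE; apply: eq_bigr => i _; rewrite mxE. Qed.

(** The basis lies in the dual lattice, so its Gram matrix is integral. The dual basis lies in the
    lattice, and its coordinates form an integral inverse of that matrix. *)
Lemma unimodular_gram : exists (B : 'M[R]_n) (G H : 'M[int]_n),
  [/\ B \in unitmx, L = [set rint z *m B | z in [set: 'rV[int]_n]],
      map_mx intr G = B *m B^T, G^T = G & G *m H = 1%:M].
Proof.
have [[B uB LE] LD] := uL.
have Lin z : L (rint z *m B) by rewrite LE; exists z.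
have int_dot x y : L x -> L y -> dotp x y \is a Num.int.
  by move=> + Ly; rewrite LD => /(_ y Ly).
have rowB i : row i B = rint (delta_mx 0 i) *m B.
  by rewrite rowE /rint map_delta_mx.
have Gint i j : (B *m B^T) i j \is a Num.int.
  have -> : (B *m B^T) i j = dotp (row i B) (row j B).
    by rewrite /dotp mxE; apply: eq_bigr => k _; rewrite !mxE.
  by apply: int_dot; rewrite rowB.
pose G : 'M[int]_n := \matrix_(i, j) Num.floor ((B *m B^T) i j).
have GE : map_mx intr G = B *m B^T.
  by apply/matrixP => i j; rewrite 2![in LHS]mxE floorK.
have rowD i : L (row i (invmx B)^T).
  rewrite LD => l; rewrite LE => -[z _ <-].
  have -> : dotp (row i (invmx B)^T) (map_mx intr z *m B) = (z 0 i)%:~R.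
    rewrite dotp_mdot mdotC /mdot -mulmxA.
    have -> : B *m (row i (invmx B)^T)^T = delta_mx i 0.
      by rewrite tr_row trmxK colE mulmxA mulmxV// mul1mx.
    by rewrite -colE !mxE.
  by rewrite intr_int.
have /choice[h hE] : forall i, exists z : 'rV[int]_n, rint z *m B = row i (invmx B)^T.
  by move=> i; have := rowD i; rewrite LE => -[z _ zE]; exists z.
pose H : 'M[int]_n := \matrix_(i, j) h i 0 j.
have HE : map_mx intr H *m B = (invmx B)^T.
  apply/row_matrixP => i; rewrite row_mul -hE; congr (_ *m _).
  by apply/rowP => j; rewrite !mxE.
exists B, G, H; split => //.
- apply/matrixP => i j; rewrite !mxE; congr Num.floor; apply: eq_bigr => k _.
  by rewrite !mxE mulrC.
- have HE' : map_mx intr H = (invmx B)^T *m invmx B by rewrite -HE mulmxK.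
  have : map_mx intr (G *m H) = 1%:M :> 'M[R]_n.
    by rewrite map_mxM GE /= HE' mulmxA -(mulmxA B) -trmx_mul mulVmx// trmx1 mulmx1 mulmxV.
  move=> e; apply/matrixP => i j; apply: (@intr_inj R).
  by have /matrixP/(_ i j) := e; rewrite !mxE mulrz_nat.
Qed.

Lemma cos_pi_int (m : int) : cos (pi * m%:~R) = (-1) ^+ absz m :> R.
Proof.
have nat_case (k : nat) : cos (pi * k%:R) = (-1) ^+ k :> R.
  elim: k => [|k IH]; first by rewrite mulr0 cos0.
  by rewrite -natr1 mulrDr mulr1 cosDpi IH exprS mulN1r.
case: m => k; first exact: nat_case.
by rewrite NegzE abszN mulrNz mulrN cosN; apply: nat_case.
Qed.

Lemma signr_absz_congr (a b : int) : (2 %| a - b)%Z ->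
  (-1) ^+ absz a = (-1) ^+ absz b :> R.
Proof.
move=> ab; rewrite -[LHS]signr_odd -[RHS]signr_odd; congr (_ ^+ _).
by congr nat_of_bool; lia.
Qed.

Definition gram_weight (G : 'M[int]_n) (z : 'rV[int]_n) : nat := absz (gram_form G z).

(* The vector added to 2 z is characteristic, so this is 4 times the norm of a vector of the shadow. *)
Definition shadow_weight (G H : 'M[int]_n) (z : 'rV[int]_n) : nat :=
  absz (gram_form G (2 *: z + (\row_j G j j) *m H)).

Section Basis.
Variables (B : 'M[R]_n) (G H : 'M[int]_n).
Hypotheses (uB : B \in unitmx) (LE : L = [set rint z *m B | z in [set: 'rV[int]_n]]).
Hypotheses (GE : map_mx intr G = B *m B^T) (sG : G^T = G) (GH : G *m H = 1%:M).

Local Notation GR := (B *m B^T).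

Lemma qform_gramE z : qform GR (rint z) = (gram_form G z)%:~R.
Proof.
by rewrite /qform  -GE /rint matrix.map_trmx -!map_mxM mxE.
Qed.

Lemma sqnorm_gramE z : sqnorm (rint z *m B) = (gram_form G z)%:~R.
Proof. by rewrite -qform_gramE /sqnorm dotp_mdot /mdot /qform trmx_mul !mulmxA. Qed.

Lemma gram_posdef : sym_posdef GR.
Proof.
split=> [|x x0]; first by rewrite  trmx_mul trmxK.
have -> : qform GR x = \sum_i (x *m B) 0 i ^+ 2.
  have -> : qform GR x = (x *m B *m (x *m B)^T) 0 0 by rewrite /qform trmx_mul !mulmxA.
  rewrite mxE; apply: eq_bigr => i _.
  by rewrite [X in _ * X]mxE -expr2.
have [i xi] : exists i, (x *m B) 0 i != 0.
  apply/existsP; apply: contraNT x0 => /existsPn h; apply/eqP.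
  rewrite -[x](mulmxK uB) (_ : x *m B = 0) ?mul0mx//.
  by apply/rowP => i; rewrite (eqP (negbNE (h i))) mxE.
rewrite (bigD1 i)//= ltr_pwDl ?sumr_ge0// => [|j _]; last by rewrite sqr_ge0.
by rewrite lt_def sqr_ge0 sqrf_eq0 xi.
Qed.

Lemma gram_form_ge0 z : 0 <= gram_form G z.
Proof.
rewrite -(@ler_int R) -qform_gramE; have [->|z0] := eqVneq (rint z) (0 : 'rV[R]_n).
  by rewrite /qform !mul0mx mxE.
exact/ltW/(gram_posdef.2 _ z0).
Qed.

Lemma gram_form_eq0 z : gram_form G z = 0 -> z = 0.
Proof.
move=> e; apply/rowP => i; rewrite mxE; apply: (@intr_inj R).
have [z0|z0] := eqVneq (rint z) (0 : 'rV[R]_n); last first.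
  by have := gram_posdef.2 _ z0; rewrite qform_gramE e ltxx.
by have /rowP/(_ i) := z0; rewrite !mxE.
Qed.

Lemma det_gram : \det GR = 1.
Proof.
have d : \det G * \det H = 1 by rewrite -det_mulmx GH det1.
have dE : \det GR = (\det G)%:~R by rewrite  -GE det_map_mx.
have := posdef_det_gt0 gram_posdef; rewrite dE ltr0z => d0.
suff -> : \det G = 1 by [].
have : absz (\det G) == 1%N by rewrite -dvdz1; apply/dvdzP; exists (\det H); rewrite mulrC.
lia.
Qed.

Local Notation N := (gram_weight G).
Local Notation g := (\row_j G j j : 'rV[int]_n).
Local Notation u := (g *m H).
Local Notation NS := (shadow_weight G H).

Let N_E z : (N z)%:R = qform GR (rint z).
Proof. by rewrite qform_gramE -[gram_form G z]gez0_abs ?gram_form_ge0. Qed.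

Let NS_E z : (NS z)%:R = 4 * qform GR (rint z + 2^-1 *: rint u).
Proof.
have -> : rint z + 2^-1 *: rint u = 2^-1 *: rint (2 *: z + u) :> 'rV[R]_n.
  by apply/rowP => i; rewrite !mxE intrD intrM mulrDr mulKf.
rewrite /qform -!scalemxAl linearZ /= -scalemxAr scalerA [in RHS]mxE.
rewrite -[(rint _ *m GR *m _) 0 0]/(qform _ _) qform_gramE mulrA.
rewrite (_ : 4 * (2^-1 * 2^-1) = 1 :> R) ?mul1r; last by field.
by rewrite -[gram_form G _ in RHS]gez0_abs ?gram_form_ge0.
Qed.

Lemma scale_posdef (A : 'M[R]_n) (y : R) : 0 < y -> sym_posdef A -> sym_posdef (y *: A).
Proof.
move=> y0 [sA pA]; split; first by rewrite linearZ /= sA.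
by move=> x x0; rewrite /qform -scalemxAr -scalemxAl mxE mulr_gt0// pA.
Qed.

Lemma qformZ (A : 'M[R]_n) (y : R) x : qform (y *: A) x = y * qform A x.
Proof. by rewrite /qform -scalemxAr -scalemxAl mxE. Qed.

Lemma powR_base (r : R) : 0 <= r -> r < 1 -> exists2 y, 0 < y & r <= expR (- (pi * y)).
Proof.
move=> r0 r1; have s0 : 0 < (r + 1) / 2 by lra.
have s1 : (r + 1) / 2 < 1 by lra.
exists (- ln ((r + 1) / 2) / pi).
  by rewrite divr_gt0 ?pi_gt0// oppr_gt0 ln_lt0// s0.
rewrite mulrCA divff ?gt_eqF ?pi_gt0// mulr1 opprK lnK; last by rewrite posrE.
lra.
Qed.

Lemma asummable_weight (M : 'rV[int]_n -> nat) (a : R) (w : 'rV[R]_n) : 0 < a ->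
  (forall z, (M z)%:R = a * qform GR (rint z + w)) ->
  forall r : R, 0 <= r -> r < 1 -> asummable (fun z => r ^+ M z).
Proof.
move=> a0 ME r r0 r1; have [y y0 ry] := powR_base r0 r1.
apply: asummable_le (asummable_qform w (scale_posdef (mulr_gt0 y0 a0) gram_posdef)) => z.
rewrite normrX (ger0_norm r0) qformZ -mulrA -ME mulrA.
rewrite (_ : - (pi * y * (M z)%:R) = (M z)%:R * - (pi * y)); last by rewrite mulrN mulrC.
by rewrite expRM_natl lerXn2r// nnegrE// expR_ge0.
Qed.

Let SN : forall r : R, 0 <= r -> r < 1 -> asummable (fun z => r ^+ N z).
Proof.
apply: (@asummable_weight N 1 0) => // z.
by rewrite N_E mul1r addr0.
Qed.

Lemma asummable_shadow : forall r : R, 0 <= r -> r < 1 -> asummable (fun z => r ^+ NS z).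
Proof.
by apply: (@asummable_weight NS 4 (2^-1 *: rint u)) => //; exact: NS_E.
Qed.

Let HG : H *m G = 1%:M. Proof. exact: mulmx1C. Qed.

Let mulG_bij : bijective (fun z : 'rV[int]_n => z *m G).
Proof.
exists (fun z => z *m H) => z; first by rewrite -mulmxA GH mulmx1.
by rewrite -mulmxA HG mulmx1.
Qed.

Let expR_weight (y : R) (k : nat) : expR (- (pi * y)) ^+ k = expR (- (pi * (y * k%:R))).
Proof. by rewrite -expRM_natl mulrN mulrA [_%:R * _]mulrC. Qed.

(** Poisson summation for [y] times the Gram matrix. Since that matrix is invertible over the
    integers, the substitution of [z *m G] turns the dual form back into the original one. *)
Lemma poisson_gram (y : R) (xi : 'rV[R]_n) : 0 < y ->
  tsum (fun z => expR (- (pi * y)) ^+ N z * cos (2 * pi * mdot (rint z) xi)) =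
  (Num.sqrt y)^-1 ^+ n *
  tsum (fun z => expR (- (pi * (y^-1 * qform GR (rint z + xi *m invmx GR))))).
Proof.
move=> y0; have pA := scale_posdef y0 gram_posdef.
have uG := posdef_unit gram_posdef.
have := poisson_qform xi 0 pA.
rewrite (mulr0 (2 * pi)) cos0 mulr1 detZ det_gram mulr1.
have -> : Num.sqrt (y ^+ n) = Num.sqrt y ^+ n 
    by elim: n => [|k IH]; rewrite ?expr0 ?sqrtr1// !exprS sqrtrM ?IH// ltW.
rewrite -exprVn => E; transitivity (tsum (fun z => expR (- (pi * qform (y *: GR) (rint z))) *
    cos (2 * pi * (mdot (rint z) xi + 0)))).
  apply: eq_tsum => z; rewrite addr0 expR_weight qformZ N_E //.
rewrite E; congr (_ * _).
rewrite -(tsum_bij _ mulG_bij); apply: eq_tsum => z; congr (expR (- (pi * _))).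
have -> : rint (z *m G) + xi = (rint z + xi *m invmx GR) *m GR :> 'rV[R]_n.
  by rewrite mulmxDl mulmxKV// /rint map_mxM GE.
have -> : invmx (y *: GR) = y^-1 *: invmx GR by rewrite invmxZ//; exact: posdef_unit pA.
by rewrite qformZ qform_inv//; exact: gram_posdef.1.
Qed.

(** The first identity takes [xi = 0]. For the second, the sign of [(-q)^(N z)] is [cos (pi g . z)]
    by parity, with [g] the diagonal of the Gram matrix. Hence [xi = g / 2], which becomes the shift
    [u / 2] by half a characteristic vector. *)
Lemma gram_modular_pair : modular_pair (R := R) n (counting_series N) (counting_series NS).
Proof.
have q1 y : 0 < y -> `|expR (- (pi * y))| < 1 :> R.
  by move=> y0; rewrite (ger0_norm (expR_ge0 _)) expR_lt1 oppr_lt0 mulr_gt0// pi_gt0.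
split; [exact: conv_counting_series | exact: (conv_counting_series asummable_shadow) | |].
- move=> y y0; have iy0 : 0 < y^-1 by rewrite invr_gt0.
  rewrite (fev_counting_series SN (q1 _ y0)) (fev_counting_series SN (q1 _ iy0)).
  have := poisson_gram 0 y0; rewrite mul0mx => E.
  transitivity (tsum (fun z => expR (- (pi * y)) ^+ N z * cos (2 * pi * mdot (rint z) 0))).
    by apply: eq_tsum => z; rewrite /mdot trmx0 mulmx0 mxE mulr0 cos0 mulr1.
  rewrite E; congr (_ * _); apply: eq_tsum => z.
  by rewrite expR_weight addr0 N_E.
- move=> y y0; have y40 : 0 < (4 * y)^-1 by rewrite invr_gt0 mulr_gt0.
  rewrite (_ : pi / 4 / y = pi * (4 * y)^-1); last by rewrite invfM mulrA.
  have nq1 : `|- expR (- (pi * y))| < 1 :> R by rewrite normrN q1.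
  rewrite (fev_counting_series SN nq1) (fev_counting_series asummable_shadow (q1 _ y40)).
  have := poisson_gram (2^-1 *: rint g) y0 => E.
  transitivity (tsum (fun z => expR (- (pi * y)) ^+ N z *
      cos (2 * pi * mdot (rint z) (2^-1 *: rint g)))).
    apply: eq_tsum => z; rewrite exprNn mulrC; congr (_ * _).
    have -> : 2 * pi * mdot (rint z) (2^-1 *: rint g) =
        pi * (\sum_j z 0 j * G j j)%:~R :> R.
      rewrite mdotZr [2 * pi]mulrC -mulrA (mulVKf (_ : 2 != 0)) ?pnatr_eq0//; congr (_ * _).
      rewrite /mdot mxE rmorph_sum /=; apply: eq_bigr => j _.
      by rewrite !mxE intrM.
    by rewrite cos_pi_int; apply: signr_absz_congr; exact: gram_form_parity.
  rewrite E; congr (_ * _); apply: eq_tsum => z; rewrite expR_weight; congr (expR (- (pi * _))).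
  rewrite NS_E invfM [4^-1 * _]mulrC -mulrA mulKf ?pnatr_eq0//; congr (_ * _); congr (qform _ (_ + _)).
  rewrite -scalemxAl; congr (_ *: _).
  have -> : rint g = rint u *m GR :> 'rV[R]_n by rewrite  -GE /rint -map_mxM /= -mulmxA HG mulmx1.
  by rewrite mulmxK// posdef_unit//; exact: gram_posdef.
Qed.

Lemma theta_gramE y : 0 < y -> theta L y = fev (counting_series N) (nome y).
Proof.
move=> y0; have q0 : 0 <= nome y :> R := expR_ge0 _.
have q1 : `|nome y| < 1 :> R.
  by rewrite (ger0_norm q0) expR_lt1 oppr_lt0 mulr_gt0// pi_gt0.
rewrite (fev_counting_series SN q1) tsum_nneg; last by move=> z; rewrite exprn_ge0.
rewrite /theta /nnsum LE; congr fine.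
rewrite (@reindex_esum _ _ _ [set: 'rV[int]_n] _ (fun z => rint z *m B)).
- apply: eq_esum => z _; rewrite sqnorm_gramE -[gram_form G z]gez0_abs ?gram_form_ge0//.
  by rewrite -powR_mulrn.
- split.
  + by move=> z _; exists z.
  + move=> z w _ _ /(congr1 (mulmx^~ (invmx B))) /=; rewrite !mulmxK// => /rowP e.
    by apply/rowP => i; apply: (@intr_inj R); have := e i; rewrite !mxE.
  + by move=> x [z _ <-]; exists z.
Qed.

(** A zero vector in the shadow means that the characteristic vector is twice a lattice vector. The
    diagonal of the Gram matrix is then even, and so are all norms. *)
Lemma gram_all_norms_even : counting_series NS 0%N != 0 :> R -> all_norms_even L.
Proof.
move=> S0; have [t Nt] : exists t, NS t = 0%N.
  apply: contrapT => H0; move: S0; rewrite counting_series_eq0 ?eqxx// => t.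
  by apply/eqP => e; apply: H0; exists t.
have ut : u = - (2 *: t).
  by apply/eqP; rewrite -addr_eq0 addrC; apply/eqP/gram_form_eq0/eqP; rewrite -absz_eq0 -/(NS t) Nt.
have gE : g = 2 *: (- t *m G).
  by rewrite -[g]mulmx1 -HG mulmxA ut -scalerN scalemxAl.
move=> x; rewrite LE => -[z _ <-]; rewrite sqnorm_gramE.
have : (2 %| gram_form G z)%Z.
  have -> : gram_form G z = (gram_form G z - \sum_j z 0 j * G j j) + \sum_j z 0 j * G j j by ring.
  rewrite rpredD ?gram_form_parity//; apply: rpred_sum => j _.
  have -> : G j j = g 0 j by rewrite mxE.
  by rewrite gE mxE mulrCA dvdz_mulr.
by move=> /dvdzP[k ->]; exists k; rewrite intrM mulrC.
Qed.

End Basis.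

Theorem unimodular_theta : exists c d : fps R,
  [/\ modular_pair n c d, forall y, 0 < y -> theta L y = fev c (nome y),
      c 0%N = 1,
      forall m, (0 < m)%N -> no_vector_of_norm L m%:R -> c m = 0 &
      (forall m, exists k : nat, d m = k%:R) /\ (d 0%N != 0 -> all_norms_even L)].
Proof.
have [B [G [H [uB LE GE sG GH]]]] := unimodular_gram.
exists (counting_series (gram_weight G)), (counting_series (shadow_weight G H)).
split; first by apply: (@gram_modular_pair B G H).
- by move=> y y0; apply: (theta_gramE (B := B)).
- apply: (@counting_series1 _ _ _ 0%N 0) => z.
  apply/idP/eqP => [|->]; last by rewrite /gram_weight /gram_form !mul0mx mxE.
  by rewrite absz_eq0 => /eqP/(gram_form_eq0 uB GE).
- move=> m m0 nm; apply: counting_series_eq0 => z; apply/eqP => e.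
  have Lz : L (rint z *m B) by rewrite LE; exists z.
  have := nm _ Lz; rewrite (sqnorm_gramE GE) -e /gram_weight.
  by rewrite -[gram_form G z in X in X != _]gez0_abs ?(gram_form_ge0 uB GE)// eqxx.
- split; last exact: (gram_all_norms_even uB LE GE sG GH).
  by move=> m; apply: counting_series_nat => r r0 r1; apply: (@asummable_shadow B).
Qed.

End UnimodularLattice.

(** * Jacobi's theta series *)

Section Splitting.
Context {R : realType}.

Lemma tsum_bool (f : bool -> R) : tsum f = f false + f true.
Proof.
have [//|[]//|_ ->] := @tsum_seq R bool [:: false; true] f.
by rewrite big_cons big_seq1.
Qed.

Lemma tsum_split (T U : choiceType) (e : bool * T -> U) (f : U -> R) :
  bijective e -> asummable f ->
  tsum f = tsum (fun t => f (e (false, t))) + tsum (fun t => f (e (true, t))).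
Proof.
move=> be Sf; rewrite -(tsum_bij f be).
have Sfe : asummable (f \o e) := asummable_inj (bij_inj be) Sf.
by have [_ _ ->] := tsum_iter Sfe; rewrite tsum_bool.
Qed.

End Splitting.

Section ThetaSeries.
Context {R : realType}.

Definition sqz (z : int) : nat := (absz z ^ 2)%N.
Definition tri (z : int) : nat := absz (z * (z + 1) %/ 2)%Z.

Lemma sqzE z : (sqz z)%:Z = z ^+ 2.
Proof. by rewrite /sqz -abszX gez0_abs// sqr_ge0. Qed.

Lemma triE z : 2 * (tri z)%:Z = z * (z + 1).
Proof.
have [m [mE|mE]] : exists m : int, z = 2 * m \/ z = 2 * m + 1 by exists (divz z 2); lia.
  have e : z * (z + 1) = m * (2 * m + 1) * 2 by rewrite mE; ring.
  rewrite /tri e mulzK// gez0_abs; last by nia.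
  by rewrite mulrC.
have e : z * (z + 1) = (2 * m + 1) * (m + 1) * 2 by rewrite mE; ring.
rewrite /tri e mulzK// gez0_abs; last by nia.
by rewrite mulrC.
Qed.

(** The successor accommodates triangular numbers, as [tri (-1) = 0]. It costs a factor [s^-1], and
    the base [s > r] is positive even when [r = 0]. *)
Lemma asummable_int_weight (N : int -> nat) : (forall z, absz z <= (N z).+1)%N ->
  forall r : R, 0 <= r -> r < 1 -> asummable (fun z => r ^+ N z).
Proof.
move=> le_N r r0 r1; pose s := (r + 1) / 2.
have s0 : 0 < s by rewrite /s; lra.
have s1 : s < 1 by rewrite /s; lra.
have rs : r <= s by rewrite /s; lra.
apply: asummable_le (asummableZ s^-1 (asummable_pow_absz (ltW s0) s1)) => z.
rewrite normrX (ger0_norm r0) (@le_trans _ _ (s ^+ N z))//.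
  by rewrite lerXn2r// nnegrE// ltW.
rewrite ler_pdivlMl// -exprS ler_wiXn2l//; exact: ltW.
Qed.

Lemma asummable_sqz (r : R) : 0 <= r -> r < 1 -> asummable (fun z => r ^+ sqz z).
Proof.
apply: asummable_int_weight => z; rewrite /sqz; case: (absz z) => // k.
by rewrite ltnW// ltnS expnS expn1 leq_pmulr.
Qed.

Lemma asummable_tri (r : R) : 0 <= r -> r < 1 -> asummable (fun z => r ^+ tri z).
Proof. by apply: asummable_int_weight => z; have := triE z; nia. Qed.

Definition phi : fps R := counting_series sqz.
Definition psi2 : fps R := counting_series tri.
(* Every triangular number is tri z for exactly two integers z. *)
Definition psi : fps R := fC 2^-1 * psi2.

Lemma conv_phi : conv phi. Proof. exact: conv_counting_series asummable_sqz. Qed.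
Lemma conv_psi2 : conv psi2. Proof. exact: conv_counting_series asummable_tri. Qed.
Lemma conv_psi : conv psi.
Proof. by apply: convM; [exact: conv_fC|exact: conv_psi2]. Qed.

Lemma fev_phi (x : R) : `|x| < 1 -> fev phi x = tsum (fun z => x ^+ sqz z).
Proof. exact: (fev_counting_series asummable_sqz). Qed.

Lemma fev_psi2 (x : R) : `|x| < 1 -> fev psi2 x = tsum (fun z => x ^+ tri z).
Proof. exact: (fev_counting_series asummable_tri). Qed.

Lemma fC_nat k : fC (k%:R) = k%:R :> fps R.
Proof. exact: (rmorph_nat (fC (F := R))). Qed.

Lemma conv_nat k : conv (k%:R : fps R).
Proof. by rewrite -fC_nat; exact: conv_fC. Qed.

Lemma psi2E : psi2 = 2 * psi.
Proof. by rewrite /psi -fC_nat mulrA -rmorphM divff ?pnatr_eq0// rmorph1 mul1r. Qed.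

Lemma phi_coef0 : phi 0%N = 1.
Proof. by apply: (@counting_series1 _ _ _ 0%N 0) => z; rewrite /sqz -absz_eq0; case: absz. Qed.

Lemma psi_coef0 : psi 0%N = 1.
Proof.
rewrite /psi fcoefCM; have [//|z|_] := @tsum_seq R int [:: 0; -1] (fun z => (tri z == 0%N)%:R).
  rewrite !inE => nz; have := triE z; case: (tri z) => // e; exfalso; nia.
rewrite /psi2 /= => ->; rewrite big_cons big_seq1 /tri /=; lra.
Qed.

Lemma phi_ge0 m : 0 <= phi m. Proof. exact: counting_series_ge0. Qed.
Lemma psi_ge0 m : 0 <= psi m.
Proof. by rewrite /psi fcoefCM mulr_ge0 ?invr_ge0// counting_series_ge0. Qed.

Lemma phi_coef_square k : (0 < k)%N -> phi (k ^ 2)%N = 2.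
Proof.
move=> k0; have [|z|_ /= ->] := @tsum_seq R int [:: k%:Z; - k%:Z] (fun z => (sqz z == (k ^ 2)%N)%:R).
- by rewrite /= inE andbT; lia.
- rewrite !inE negb_or => /andP[/eqP h1 /eqP h2].
  by rewrite /sqz eqn_exp2r//; case: eqP => // e; exfalso; lia.
- by rewrite big_cons big_seq1 /sqz abszN /= eqxx -natrD.
Qed.

Lemma phi_coef_nsquare m : (forall k : nat, k ^ 2 != m)%N -> phi m = 0.
Proof. by move=> nm; apply: counting_series_eq0 => z; exact: nm. Qed.

Lemma odd_sqz z : odd (sqz z) = odd (absz z). Proof. by rewrite /sqz oddX. Qed.

#[local] Opaque sqz tri.

Let sqz_rotate (m n : int) : (sqz (m + n) + sqz (m - n) = 2 * sqz m + 2 * sqz n)%N.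
Proof.
have := sqzE (m + n); have := sqzE (m - n); have := sqzE m; have := sqzE n.
rewrite !expr2; lia.
Qed.

Let sqz_rotate1 (m n : int) :
  (sqz (m + n + 1) + sqz (m - n) = (4 * tri m + 4 * tri n).+1)%N.
Proof.
have := sqzE (m + n + 1); have := sqzE (m - n); have := triE m; have := triE n.
rewrite !expr2; lia.
Qed.

Let tri_rotate (m n : int) : (tri (m + n) + tri (m - n - 1) = sqz m + 2 * tri n)%N.
Proof.
have := triE (m + n); have := triE (m - n - 1); have := sqzE m; have := triE n.
rewrite !expr2; lia.
Qed.

Let tri_rotate1 (m n : int) : (tri (m + n) + tri (n - m) = sqz m + 2 * tri n)%N.
Proof.
have := triE (m + n); have := triE (n - m); have := sqzE m; have := triE n.
rewrite !expr2; lia.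
Qed.

(** Pairs of equal parity are the points [(m + n, m - n)], the others the points
    [(m + n + 1, m - n)]. *)
Let rotate_bij : bijective (fun t : bool * (int * int) =>
  if t.1 then (t.2.1 + t.2.2 + 1, t.2.1 - t.2.2) else (t.2.1 + t.2.2, t.2.1 - t.2.2)).
Proof.
exists (fun x : int * int => if (2 %| x.1 - x.2)%Z
    then (false, (((x.1 + x.2) %/ 2)%Z, ((x.1 - x.2) %/ 2)%Z))
    else (true, (((x.1 + x.2 - 1) %/ 2)%Z, ((x.1 - x.2 - 1) %/ 2)%Z))).
- case=> -[] [m n] /=.
    have -> : (2 %| m + n + 1 - (m - n))%Z = false by lia.
    by congr (_, (_, _)); lia.
  have -> : (2 %| m + n - (m - n))%Z = true by lia.
  by congr (_, (_, _)); lia.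
- case=> a b /=; case: (boolP (2 %| a - b)%Z) => h /=; congr (_, _); lia.
Qed.

(** Here the signs are arranged so that both parity classes contribute the same series, which
    produces the factor 2 in [psi2_sqr]. *)
Let rotate_tri_bij : bijective (fun t : bool * (int * int) =>
  if t.1 then (t.2.1 + t.2.2, t.2.2 - t.2.1) else (t.2.1 + t.2.2, t.2.1 - t.2.2 - 1)).
Proof.
exists (fun x : int * int => if (2 %| x.1 - x.2)%Z
    then (true, (((x.1 - x.2) %/ 2)%Z, ((x.1 + x.2) %/ 2)%Z))
    else (false, (((x.1 + x.2 + 1) %/ 2)%Z, ((x.1 - x.2 - 1) %/ 2)%Z))).
- case=> -[] [m n] /=.
    have -> : (2 %| m + n - (n - m))%Z = true by lia.
    by congr (_, (_, _)); lia.
  have -> : (2 %| m + n - (m - n - 1))%Z = false by lia.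
  by congr (_, (_, _)); lia.
- case=> a b /=; case: (boolP (2 %| a - b)%Z) => h /=; congr (_, _); lia.
Qed.

(** Both sides count points of the square lattice by norm; the right-hand side splits them by the
    parity of the coordinate sum and rotates by 45 degrees. *)
Lemma phi_sqr_psi2 : phi ^+ 2 = fdil 2 phi ^+ 2 + fX * fdil 4 psi2 ^+ 2.
Proof.
have cp := conv_phi; have cs := conv_psi2.
have cd2 : conv (fdil 2 phi) by exact: conv_fdil.
have cd4 : conv (fdil 4 psi2) by exact: conv_fdil.
apply: (@fev_inj R _ _ 1) => //; first exact: convX.
  by apply: convD; [exact: convX|apply: convM; [exact: conv_fX|exact: convX]].
move=> x x0 x1; have nx : `|x| < 1 by rewrite (gtr0_norm x0).
have xk k : (0 < k)%N -> 0 <= x ^+ k /\ x ^+ k < 1.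
  by move=> k0; rewrite exprn_ge0 ?(ltW x0)// exprn_ilt1 ?(ltW x0)// -lt0n.
have nxk k : (0 < k)%N -> `|x ^+ k| < 1.
  by move=> /xk[h0 h1]; rewrite (ger0_norm h0).
rewrite fevD//; [|exact: convX|by apply: convM; [exact: conv_fX|exact: convX]].
rewrite fevM//; [|exact: conv_fX|exact: convX].
rewrite !fevX// fev_fX !fev_fdil// !fev_phi ?nxk// fev_psi2 ?nxk//.
have S1 := asummable_sqz (ltW x0) x1.
have [x20 x21] := xk 2%N isT; have [x40 x41] := xk 4%N isT.
have S2 := asummable_sqz x20 x21; have S4 := asummable_tri x40 x41.
rewrite !expr2; have [S11 <-] := tsum_mul S1 S1.
have [_ <-] := tsum_mul S2 S2; have [S44 <-] := tsum_mul S4 S4.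
rewrite (tsum_split rotate_bij S11) -(tsumZ _ S44); congr (_ + _).
  apply: eq_tsum => -[m n] /=; rewrite -!exprM -!exprD; congr (_ ^+ _).
  exact: sqz_rotate.
apply: eq_tsum => -[m n] /=; rewrite -!exprM -!exprD -exprS; congr (_ ^+ _).
exact: sqz_rotate1.
Qed.

Lemma psi2_sqr : psi2 ^+ 2 = 2 * phi * fdil 2 psi2.
Proof.
have cp := conv_phi; have cs := conv_psi2.
have cd2 : conv (fdil 2 psi2) by exact: conv_fdil.
have c2p : conv (2 * phi) by apply: convM => //; exact: conv_nat.
apply: (@fev_inj R _ _ 1) => //; first exact: convX.
  exact: convM.
move=> x x0 x1; have nx : `|x| < 1 by rewrite (gtr0_norm x0).
have x20 : 0 <= x ^+ 2 by exact: sqr_ge0.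
have x21 : x ^+ 2 < 1 by rewrite exprn_ilt1// ltW.
have nx2 : `|x ^+ 2| < 1 by rewrite (ger0_norm x20).
rewrite fevM// fevM//; last exact: conv_nat.
rewrite fevX// fev_fdil// fev_phi// !fev_psi2// -(fC_nat 2) fev_fC.
have S1 := asummable_sqz (ltW x0) x1.
have T1 := asummable_tri (ltW x0) x1; have T2 := asummable_tri x20 x21.
rewrite !expr2; have [T11 <-] := tsum_mul T1 T1; rewrite -expr2 -mulrA.
have [_ <-] := tsum_mul S1 T2.
rewrite (tsum_split rotate_tri_bij T11) mulrDl !mul1r.
congr (_ + _); apply: eq_tsum => -[m n] /=; rewrite -!exprM -!exprD; congr (_ ^+ _).
  exact: tri_rotate.
exact: tri_rotate1.
Qed.

Lemma phi_sqr : phi ^+ 2 = fdil 2 phi ^+ 2 + 4 * fX * fdil 4 psi ^+ 2.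
Proof. by rewrite phi_sqr_psi2 psi2E rmorphM rmorph_nat; ring. Qed.

Lemma psi_sqr : psi ^+ 2 = phi * fdil 2 psi.
Proof.
have e : fdil 2 psi = fC 2^-1 * fdil 2 psi2 by rewrite /psi rmorphM /= fdil_C.
rewrite e /psi exprMn psi2_sqr -fC_nat -rmorphXn.
rewrite (_ : fC (2^-1 ^+ 2) * _ = fC (2^-1 ^+ 2 * 2) * phi * fdil 2 psi2); last first.
  by rewrite [fC (_ ^+ 2 * 2)]rmorphM /= !mulrA.
rewrite (_ : 2^-1 ^+ 2 * 2 = 2^-1 :> R); last by field.
by ring.
Qed.

Lemma fneg_fdil4 (c : fps R) : fneg (fdil 4 c) = fdil 4 c.
Proof. by rewrite -(@fdil_comp _ 2 2)// fneg_dil2. Qed.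

Lemma fneg0 (c : fps R) : fneg c 0%N = c 0%N.
Proof. by rewrite /= expr0 mul1r. Qed.

Lemma fneg_phi_sqr : fneg phi ^+ 2 = fdil 2 phi ^+ 2 - 4 * fX * fdil 4 psi ^+ 2.
Proof.
rewrite -rmorphXn phi_sqr rmorphD rmorphXn /= fneg_dil2; congr (_ + _).
rewrite rmorphM /= [fneg (4 * fX)]rmorphM /= rmorph_nat fneg_X [fneg (_ ^+ 2)]rmorphXn /= fneg_fdil4.
ring.
Qed.

(** Jacobi's identity between the fourth powers of the theta constants: the difference of the
    squares of [phi_sqr] and [fneg_phi_sqr], with [psi_sqr] at [q^2]. *)
Lemma phi_quartic : phi ^+ 4 = fneg phi ^+ 4 + 16 * fX * fdil 2 psi ^+ 4.
Proof.
have := congr1 (fdil 2) psi_sqr; rewrite rmorphXn [fdil 2 (phi * _)]rmorphM /= fdil_comp// => e3.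
by rewrite !(exprM _ 2 2) phi_sqr fneg_phi_sqr e3; ring.
Qed.

(** The squares of both sides agree by [phi_quartic] at [q^2], and a series with constant term 1 is
    determined by its square. *)
Lemma phi_mul_fneg : phi * fneg phi = fdil 2 (fneg phi) ^+ 2.
Proof.
have c0 : fneg phi 0%N = 1 by rewrite fneg0 phi_coef0.
have d0 : fdil 2 (fneg phi) 0%N = 1 by rewrite fcoef_dil dvdn0 div0n.
apply: fsqr_inj; first by rewrite fcoefM0 phi_coef0 c0 mulr1.
- by rewrite fcoefX0 d0 expr1n.
- by rewrite pnatr_eq0.
have e4 : fdil 2 phi ^+ 4 = fdil 2 (fneg phi) ^+ 4 + 16 * fX ^+ 2 * fdil 4 psi ^+ 4.
  rewrite -rmorphXn phi_quartic rmorphD; congr (_ + _); first exact: rmorphXn.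
  rewrite rmorphM /= [fdil 2 (16 * fX)]rmorphM /= rmorph_nat fdil_X// [fdil 2 (_ ^+ 4)]rmorphXn /=.
  by rewrite fdil_comp.
rewrite exprMn phi_sqr fneg_phi_sqr -exprM.
have -> : fdil 2 (fneg phi) ^+ (2 * 2) = fdil 2 phi ^+ 4 - 16 * fX ^+ 2 * fdil 4 psi ^+ 4.
  by rewrite e4 addrK.
ring.
Qed.

(** The second member is theta_2: alternating signs shift the dual sum by 1/2, and with
    [p = exp (- pi / (4 y))] the exponents are the odd squares [(2 v + 1)^2 = 8 tri v + 1]. *)
Lemma modular_pair_phi : modular_pair 1 phi (fX * fdil 8 psi2).
Proof.
have cd8 : conv (fdil 8 psi2) by apply: conv_fdil => //; exact: conv_psi2.
have q1 y : 0 < y -> `|expR (- (pi * y))| < 1 :> R.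
  by move=> y0; rewrite (ger0_norm (expR_ge0 _)) expR_lt1 oppr_lt0 mulr_gt0// pi_gt0.
have qE (y : R) k : expR (- (pi * y)) ^+ k = expR (- (pi * (y * k%:R))).
  by rewrite -expRM_natl mulrN mulrA [_%:R * _]mulrC.
have sqR z : (sqz z)%:R = z%:~R ^+ 2 :> R by rewrite -rmorphXn /= -sqzE.
split; [exact: conv_phi | by apply: convM => //; exact: conv_fX | |].
- move=> y y0; have iy0 : 0 < y^-1 by rewrite invr_gt0.
  rewrite (fev_phi (q1 _ y0)) (fev_phi (q1 _ iy0)) expr1.
  have := @poisson_line R y 0 0 0 y0 => E.
  transitivity (tsum (fun v : int => expR (- (pi * y * (v%:~R + 0) ^+ 2)) *
      cos (2 * pi * (v%:~R * 0 + 0)))).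
    apply: eq_tsum => v; rewrite mulr0 !addr0 (mulr0 (2 * pi)) cos0 mulr1 qE sqR.
    by rewrite mulrA.
  rewrite E; congr (_ * _); apply: eq_tsum => v.
  rewrite mulr0 subr0 (mulr0 (2 * pi)) cos0 mulr1 addr0 qE sqR.
  by congr (expR (- _)); rewrite -mulrA; congr (_ * _); exact: mulrC.
- move=> y y0; have y40 : 0 < (4 * y)^-1 by rewrite invr_gt0 mulr_gt0.
  rewrite (_ : pi / 4 / y = pi * (4 * y)^-1); last by rewrite invfM mulrA.
  have nq1 : `|- expR (- (pi * y))| < 1 :> R by rewrite normrN q1.
  have p1 := q1 _ y40.
  rewrite (fev_phi nq1) expr1 fevM//; last exact: conv_fX.
  rewrite fev_fX fev_fdil//; last exact: conv_psi2.
  have p80 := exprn_ge0 8 (expR_ge0 (- (pi * (4 * y)^-1))).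
  have p81 : expR (- (pi * (4 * y)^-1)) ^+ 8 < 1 :> R.
    by rewrite exprn_ilt1// ?expR_ge0//; move: p1; rewrite (ger0_norm (expR_ge0 _)).
  rewrite fev_psi2; last by rewrite (ger0_norm p80).
  have := @poisson_line R y 0 2^-1 0 y0 => E.
  transitivity (tsum (fun v : int => expR (- (pi * y * (v%:~R + 0) ^+ 2)) *
      cos (2 * pi * (v%:~R * 2^-1 + 0)))).
    apply: eq_tsum => v; rewrite !addr0 exprNn qE sqR mulrA [RHS]mulrC; congr (_ * _).
    have -> : 2 * pi * (v%:~R * 2^-1) = pi * v%:~R :> R by field.
    rewrite cos_pi_int -signr_odd -[RHS]signr_odd; congr (_ ^+ nat_of_bool _).
    by rewrite odd_sqz.
  rewrite E; congr (_ * _); rewrite -(tsumZ _ (asummable_tri p80 p81)); apply: eq_tsum => v.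
  rewrite mulr0 subr0 (mulr0 (2 * pi)) cos0 mulr1 -exprM -exprS qE.
  congr (expR (- _)); rewrite -mulrA; congr (_ * _).
  have -> : ((8 * tri v).+1)%:R = (2 * v%:~R + 1) ^+ 2 :> R.
    rewrite -natr1 natrM (_ : (tri v)%:R = (tri v)%:Z%:~R)//.
    have /(congr1 (fun z : int => z%:~R : R)) := triE v.
    by rewrite !intrM intrD /= => e; lra.
  by field; rewrite gt_eqF.
Qed.

Lemma theta3_phiE y : 0 < y -> theta3 y = fev phi (nome y).
Proof.
move=> y0; have q0 : 0 <= nome y :> R := expR_ge0 _.
have q1 : nome y < 1 :> R by rewrite expR_lt1 oppr_lt0 mulr_gt0// pi_gt0.
rewrite fev_phi ?(ger0_norm q0)// tsum_nneg; last by move=> z; rewrite exprn_ge0.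
rewrite /theta3 /nnsum; congr fine; apply: eq_esum => z _.
by rewrite -rmorphXn /= -sqzE -powR_mulrn.
Qed.

End ThetaSeries.

(** * Doubling equations: convergence and positivity *)

Section Doubling.
Context {R : realType}.
Implicit Types f c : fps R.

Definition psum (N : nat) c (r : R) : R := \sum_(i < N) `|c i| * r ^+ i.

Lemma psum_ge0 N c r : 0 <= r -> 0 <= psum N c r.
Proof. by move=> r0; apply: sumr_ge0 => i _; rewrite mulr_ge0 ?exprn_ge0. Qed.

Lemma psumS N c r : psum N.+1 c r = psum N c r + `|c N| * r ^+ N.
Proof. by rewrite /psum big_ord_recr. Qed.

Lemma le_psum N M c r : 0 <= r -> (N <= M)%N -> psum N c r <= psum M c r.
Proof.
move=> r0 /subnK<-; elim: (M - N)%N => [|k IH]; first by rewrite add0n.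
by rewrite addSn psumS ler_wpDr// mulr_ge0// exprn_ge0.
Qed.

Lemma sum_iota N (F : nat -> R) : \sum_(i <- iota 0 N) F i = \sum_(i < N) F i.
Proof. by rewrite -(big_mkord xpredT) /index_iota subn0. Qed.

Lemma psum_fev N c r :
  let d := Fps (fun i => if (i < N)%N then `|c i| else 0) in
  conv d /\ fev d r = psum N c r.
Proof.
set d := Fps _ => /=.
have H s : asummable (fun i => d i * s ^+ i) /\ fev d s = psum N c s.
  have [|i|S E] := @tsum_seq R nat (iota 0 N) (fun i => d i * s ^+ i); first exact: iota_uniq.
    by rewrite mem_iota add0n /= => /negbTE->; rewrite mul0r.
  split=> //; rewrite /fev E sum_iota /psum.
  by apply: eq_bigr => i _ /=; rewrite ltn_ord.
by split; [move=> s _ _; exact: (H s).1|exact: (H r).2].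
Qed.

Lemma psumM N f c r : 0 <= r -> r < 1 -> psum N (f * c) r <= psum N f r * psum N c r.
Proof.
move=> r0 r1; have nr : `|r| < 1 by rewrite (ger0_norm r0).
have [cf <-] := psum_fev N f r; have [cc <-] := psum_fev N c r.
set F := Fps _ in cf *; set C := Fps _ in cc *.
rewrite -(fevM nr cf cc).
have cFC := convM cf cc.
have FC0 i : 0 <= (F * C) i.
  rewrite fcoefM; apply: sumr_ge0 => j _; rewrite mulr_ge0//=; case: ifP => //.
have Fr0 i : 0 <= (F * C) i * r ^+ i by rewrite mulr_ge0// exprn_ge0.
apply: le_trans (tsum_seq_le (cFC r r0 r1) Fr0 (iota_uniq 0 N)).
rewrite sum_iota; apply: ler_sum => i _.
rewrite ler_wpM2r ?exprn_ge0// !fcoefM; apply: le_trans (ler_norm_sum _ _ _) _.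
apply: ler_sum => j _ /=; rewrite normrM (leq_ltn_trans (leq_subr _ _) (ltn_ord i)).
by rewrite (leq_ltn_trans (_ : j <= i)%N (ltn_ord i))// -ltnS.
Qed.

Lemma psum_dil2 M c r : psum (2 * M) (fdil 2 c) r = psum M c (r ^+ 2).
Proof.
elim: M => [|M IH]; first by rewrite /psum !big_ord0.
rewrite mulnS add2n !psumS IH /= dvdn_mulr// mulKn// exprM.
have -> : (2 %| (2 * M).+1)%N = false by rewrite dvdn2 /= oddM.
by rewrite normr0 mul0r addr0.
Qed.

Lemma psum_ge1 N f r r0 : (0 < N)%N -> 0 <= r -> r <= r0 -> 0 < r0 -> `|f 0%N| <= 1 ->
  psum N f r <= 1 + r * (psum N f r0 / r0).
Proof.
case: N => // N _ rr0 ler r00 f0; rewrite /psum !big_ord_recl /= !expr0 !mulr1.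
apply: lerD => //; rewrite mulrDl mulrDr.
apply: ler_wpDl; first by rewrite mulr_ge0 // divr_ge0 // ltW.
rewrite mulr_suml mulr_sumr; apply: ler_sum => i _; rewrite /bump /= add1n.
have -> : r * (`|f i.+1| * r0 ^+ i.+1 / r0) = `|f i.+1| * (r * r0 ^+ i).
  by rewrite exprS; field; rewrite gt_eqF.
rewrite exprS ler_wpM2l// ler_wpM2l// lerXn2r// nnegrE//; exact: ltW.
Qed.

(** A partial absolute sum of [c] at [r] with [2^(k+1)] terms is bounded through one at [r^2] with
    [2^k] terms. Hence a function [B] with [exp (K r) * B (r^2)^2 <= B r] bounds all of them by
    induction on [k]. *)
Lemma conv_doubling f c j : (j <= 2)%N -> conv f -> f 0%N = 1 -> c 0%N = 1 ->
  c = f * fdil 2 c ^+ j -> conv c.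
Proof.
move=> j2 cf f0 c0 cE; apply: convI => r0 r00 r01.
pose K := tsum (fun i => `|f i| * r0 ^+ i) / r0.
have K0 : 0 <= K.
  apply: divr_ge0; last exact: ltW.
  by apply: tsum_ge0 => i; rewrite mulr_ge0// exprn_ge0// ltW.
(* The exponent is chosen because [r^2 / (1 - r^2)] is half of [r / (1 - r) - r / (1 + r)]: squaring
   [B (r^2)] leaves the gain [2 K r / (1 + r)], which covers [K r] as [r < 1]. *)
pose B r := expR (2 * K * (r / (1 - r))).
have B1 r : 0 <= r -> r <= r0 -> 1 <= B r.
  move=> rp rr; rewrite -expR0 ler_expR; apply: mulr_ge0; first exact: mulr_ge0.
  by apply: divr_ge0 => //; lra.
have fr N r : (0 < N)%N -> 0 <= r -> r <= r0 -> psum N f r <= expR (K * r).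
  move=> N0 rp rr; apply: le_trans (psum_ge1 N0 rp rr r00 _) _; first by rewrite f0 normr1.
  apply: le_trans (expR_ge1Dx _); rewrite lerD2l [K * r]mulrC ler_wpM2l//.
  rewrite ler_pM2r ?invr_gt0// /psum.
  have := tsum_seq_le (conv_norm cf (ltW r00) r01) _ (iota_uniq 0 N).
  rewrite sum_iota; apply => i.
  by rewrite mulr_ge0// exprn_ge0// ltW.
have main k r : 0 <= r -> r <= r0 -> psum (2 ^ k) c r <= B r.
  elim: k r => [|k IH] r rp rr.
    by rewrite /psum big_ord1 c0 normr1 expr0 mulr1 B1.
  have r1 : r < 1 by lra.
  have r2p : 0 <= r ^+ 2 by rewrite exprn_ge0.
  have r2r : r ^+ 2 <= r by rewrite expr2 ler_piMl// ltW.
  have r2 : r ^+ 2 <= r0 by lra.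
  have Sj : psum (2 ^ k.+1) (fdil 2 c ^+ j) r <= B (r ^+ 2) ^+ 2.
    have S1 : psum (2 ^ k.+1) (fdil 2 c) r <= B (r ^+ 2).
      by rewrite expnS psum_dil2 IH.
    have Sp i : psum (2 ^ k.+1) (fdil 2 c ^+ i) r <= B (r ^+ 2) ^+ i.
      elim: i => [|i IHi].
        rewrite !expr0 /psum -(prednK (expn_gt0 2 k.+1)) big_ord_recl big1 ?addr0.
          by rewrite /= normr1 mulr1.
        by move=> l _; rewrite /= normr0 mul0r.
      rewrite [fdil 2 c ^+ i.+1]exprS [B _ ^+ i.+1]exprS.
      apply: le_trans (psumM _ _ _ rp r1) _.
      by apply: ler_pM => //; exact: psum_ge0.
    by apply: le_trans (Sp j) _; rewrite ler_weXn2l// B1.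
  rewrite cE; apply: le_trans (psumM _ _ _ rp r1) _.
  apply: (@le_trans _ _ (expR (K * r) * B (r ^+ 2) ^+ 2)).
    by apply: ler_pM => //; [exact: psum_ge0|exact: psum_ge0|apply: fr; rewrite ?expn_gt0].
  rewrite /B -expRM_natl -expRD ler_expR.
  have d1 : 0 < 1 - r by lra.
  have d2 : 0 < 1 + r by lra.
  have -> : r ^+ 2 / (1 - r ^+ 2) = (r / (1 - r) - r / (1 + r)) / 2.
    have -> : 1 - r ^+ 2 = (1 - r) * (1 + r) by ring.
    by field; rewrite !gt_eqF.
  have Y : r / 2 <= r / (1 + r) by rewrite ler_wpM2l// lef_pV2 ?posrE//; lra.
  have := ler_wpM2l K0 Y; move: (r / (1 - r)) (r / (1 + r)) => a b; lra.
have Sn i : 0 <= `|c i * r0 ^+ i| by exact: normr_ge0.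
apply: asummable_normP; apply: (tsum_nat_le (M := B r0) Sn _).1 => N.
apply: le_trans (main N r0 (ltW r00) (lexx _)).
apply: le_trans (le_psum c (ltW r00) (ltnW (ltn_expl N (ltnSn 1)))).
by apply: ler_sum => i _; rewrite normrM (ger0_norm (exprn_ge0 _ (ltW r00))).
Qed.

Definition nonneg_upto (n : nat) c := forall i, (i <= n)%N -> 0 <= c i.

Lemma nonneg_uptoM n c f : nonneg_upto n c -> nonneg_upto n f -> nonneg_upto n (c * f).
Proof.
move=> c0 f0 i ni; rewrite fcoefM; apply: sumr_ge0 => j _; rewrite mulr_ge0//.
  by apply: c0; apply: leq_trans ni; rewrite -ltnS.
by apply: f0; apply: leq_trans ni; exact: leq_subr.
Qed.

Lemma nonneg_uptoX n c k : nonneg_upto n c -> nonneg_upto n (c ^+ k).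
Proof.
move=> c0; elim: k => [|k IH]; last by rewrite exprS; exact: nonneg_uptoM.
by move=> i _; rewrite expr0 fcoef1 ler0n.
Qed.

(** Coefficients of [c(q^2)] up to [n] involve only those of [c] up to [n / 2], so strong induction
    applies. *)
Lemma nonneg_doubling f c j : (forall i, 0 <= f i) -> 0 <= c 0%N ->
  c = f * fdil 2 c ^+ j -> forall i, 0 <= c i.
Proof.
move=> f0 c0 cE; elim/ltn_ind => -[//|n] IH; rewrite cE.
apply: (@nonneg_uptoM n.+1) => //; apply: nonneg_uptoX => i ni.
rewrite fcoef_dil; case: ifP => // _; case: i ni => [|i] ni; first by rewrite div0n.
by apply: IH; apply: leq_trans ni; rewrite ltn_Pdiv.
Qed.

Definition nonneg c := forall i, 0 <= c i.

Lemma nonnegM c f : nonneg c -> nonneg f -> nonneg (c * f).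
Proof. by move=> c0 f0 i; apply: (@nonneg_uptoM i). Qed.

Lemma nonnegX c k : nonneg c -> nonneg (c ^+ k).
Proof. by move=> c0 i; apply: (@nonneg_uptoX i). Qed.

Lemma nonneg_dil k c : nonneg c -> nonneg (fdil k c).
Proof. by move=> c0 i; rewrite fcoef_dil; case: ifP. Qed.

End Doubling.

(** * The Hauptmodul and its inverse series *)

Section Hauptmodul.
Context {R : realType}.

Definition phi_inv : fps R := finv phi.
Definition psi_inv : fps R := finv psi.

Lemma phi_invK : phi * phi_inv = 1. Proof. exact/finvr/phi_coef0. Qed.
Lemma psi_invK : psi * psi_inv = 1. Proof. exact/finvr/psi_coef0. Qed.

Lemma inv_coef0 (c d : fps R) : c 0%N = 1 -> c * d = 1 -> d 0%N = 1.
Proof. by move=> c0 /(congr1 (fun e : fps R => e 0%N)); rewrite fcoefM0 c0 mul1r. Qed.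

Lemma phi_inv_coef0 : phi_inv 0%N = 1. Proof. exact: inv_coef0 phi_coef0 phi_invK. Qed.
Lemma psi_inv_coef0 : psi_inv 0%N = 1. Proof. exact: inv_coef0 psi_coef0 psi_invK. Qed.

Lemma fneg_phi_invK : fneg phi * fneg phi_inv = 1 :> fps R.
Proof. by rewrite -rmorphM phi_invK rmorph1. Qed.

#[local] Opaque phi psi phi_inv psi_inv.

(* phi(q) phi(-q) = phi(-q^2)^2 makes 1 / phi(-q) a solution of the doubling equation u(q) = phi(q) u(q^2)^2. *)
Lemma fneg_phi_inv_doubling :
  fneg phi_inv = phi * fdil 2 (fneg phi_inv) ^+ 2 :> fps R.
Proof.
have e := phi_mul_fneg (R := R).
have k : fdil 2 (fneg phi) * fdil 2 (fneg phi_inv) = 1 :> fps R.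
  by rewrite -rmorphM /= fneg_phi_invK rmorph1.
rewrite -[LHS]mulr1 -(expr1n _ 2) -k exprMn -e.
transitivity (fneg phi * fneg phi_inv * (phi * fdil 2 (fneg phi_inv) ^+ 2) : fps R); first by ring.
by rewrite fneg_phi_invK mul1r.
Qed.

Lemma fneg_phi_inv_ge0 : nonneg (fneg phi_inv : fps R).
Proof.
apply: nonneg_doubling fneg_phi_inv_doubling; first exact: phi_ge0.
by rewrite fneg0 phi_inv_coef0.
Qed.

Lemma conv_fneg_phi_inv : conv (fneg phi_inv : fps R).
Proof.
apply: conv_doubling fneg_phi_inv_doubling => //; first exact: conv_phi.
  exact: phi_coef0.
by rewrite fneg0 phi_inv_coef0.
Qed.

Lemma conv_phi_inv : conv (phi_inv : fps R).
Proof. by rewrite -[phi_inv]fnegK; apply: conv_fneg; exact: conv_fneg_phi_inv. Qed.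

Lemma psi_inv_doubling : psi_inv = psi * phi_inv * fdil 2 psi_inv ^+ 1 :> fps R.
Proof.
have e := psi_sqr (R := R).
have k : fdil 2 psi * fdil 2 psi_inv = 1 :> fps R by rewrite -rmorphM /= psi_invK rmorph1.
transitivity (phi * phi_inv * (fdil 2 psi * fdil 2 psi_inv) * psi_inv : fps R).
  by rewrite phi_invK k !mul1r.
transitivity (psi ^+ 2 * phi_inv * fdil 2 psi_inv * psi_inv : fps R).
  by rewrite e; ring.
transitivity (psi * psi_inv * (psi * phi_inv * fdil 2 psi_inv) : fps R); first by ring.
by rewrite psi_invK mul1r expr1.
Qed.

Lemma conv_psi_inv : conv (psi_inv : fps R).
Proof.
apply: conv_doubling psi_inv_doubling => //.
  by apply: convM; [exact: conv_psi|exact: conv_phi_inv].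
by rewrite fcoefM0 psi_coef0 phi_inv_coef0 mulr1.
Qed.

(** The inverse of psi has coefficients of both signs. In this product the factor [phi_inv] of its
    doubling equation cancels, and what remains is a doubling equation with nonnegative
    multiplier. *)
Let E : fps R := psi_inv * fneg phi_inv.

Let E_ge0 : nonneg E.
Proof.
apply: (@nonneg_doubling R (psi * fdil 2 (fneg phi_inv)) E 1).
- by apply: nonnegM; [exact: psi_ge0|apply: nonneg_dil; exact: fneg_phi_inv_ge0].
- by rewrite fcoefM0 fneg0 psi_inv_coef0 phi_inv_coef0 mulr1.
rewrite expr1 /E [in RHS]rmorphM /= {1}psi_inv_doubling expr1 {1}fneg_phi_inv_doubling.
transitivity (phi * phi_inv * (psi * fdil 2 psi_inv * fdil 2 (fneg phi_inv) ^+ 2) : fps R); first by ring.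
by rewrite phi_invK; ring.
Qed.

(* W is phi^-4 h, where h = 1 / (psi(q^2) phi(-q))^4. *)
Definition hauptW : fps R := fdil 2 ((psi_inv * fneg phi_inv ^+ 2) ^+ 4).
Definition hauptz : fps R := fX * fdil 2 psi ^+ 4 * fneg phi ^+ 4 * phi_inv ^+ 8.

Lemma hauptW_ge0 : nonneg hauptW.
Proof.
apply: nonneg_dil; apply: nonnegX; rewrite expr2 mulrA; apply: nonnegM; first exact: E_ge0.
exact: fneg_phi_inv_ge0.
Qed.

Lemma conv_hauptW : conv hauptW.
Proof.
apply: conv_fdil => //; apply: convX; apply: convM; first exact: conv_psi_inv.
by apply: convX; exact: conv_fneg_phi_inv.
Qed.

Lemma conv_hauptz : conv hauptz.
Proof.
have cp : conv (phi : fps R) := conv_phi.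
apply: convM; last by apply: convX; exact: conv_phi_inv.
apply: convM; last by apply: convX; apply: conv_fneg.
by apply: convM; [exact: conv_fX|apply: convX; apply: conv_fdil => //; exact: conv_psi].
Qed.

Lemma hauptWE : phi ^+ 4 * hauptW * (fdil 2 psi ^+ 4 * fneg phi ^+ 4) = 1.
Proof.
rewrite /hauptW rmorphXn rmorphM /= [fdil 2 (_ ^+ 2)]rmorphXn /=.
have k : fdil 2 psi * fdil 2 psi_inv = 1 :> fps R by rewrite -rmorphM /= psi_invK rmorph1.
transitivity ((fdil 2 psi * fdil 2 psi_inv) ^+ 4 *
   ((phi * fdil 2 (fneg phi_inv) ^+ 2) * fneg phi) ^+ 4 : fps R); first by ring.
by rewrite k -fneg_phi_inv_doubling [fneg phi_inv * _]mulrC fneg_phi_invK !expr1n mulr1.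
Qed.

Lemma hauptzW : hauptz * (hauptW * phi ^+ 12) = fX.
Proof.
transitivity (fX * (phi * phi_inv) ^+ 8 *
    (phi ^+ 4 * hauptW * (fdil 2 psi ^+ 4 * fneg phi ^+ 4)) : fps R); first by rewrite /hauptz; ring.
by rewrite hauptWE phi_invK expr1n !mulr1.
Qed.

(** With [x = (phi(-q) / phi(q))^4] this reads [16 z = x (1 - x)]. Inversion exchanges [x] and
    [1 - x], whence the invariance of z; the maximum [1/4] at [x = 1/2] gives the bound [1/64]. *)
Lemma hauptz_phi : 16 * hauptz * phi ^+ 8 = (phi ^+ 4 - fneg phi ^+ 4) * fneg phi ^+ 4.
Proof.
transitivity ((phi * phi_inv) ^+ 8 * (16 * fX * fdil 2 psi ^+ 4 * fneg phi ^+ 4) : fps R).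
  by rewrite /hauptz; ring.
by rewrite phi_invK expr1n {1}phi_quartic; ring.
Qed.

End Hauptmodul.

Ltac convs := repeat match goal with
  | H : conv ?c |- conv ?c => exact: H
  | |- conv phi => exact: conv_phi
  | |- conv psi2 => exact: conv_psi2
  | |- conv psi => exact: conv_psi
  | |- conv phi_inv => exact: conv_phi_inv
  | |- conv psi_inv => exact: conv_psi_inv
  | |- conv hauptz => exact: conv_hauptz
  | |- conv hauptW => exact: conv_hauptW
  | |- conv fX => exact: conv_fX
  | |- conv (fC _) => exact: conv_fC
  | |- conv 1 => exact: conv1
  | |- conv (_%:R) => exact: conv_nat
  | |- conv (fneg _) => apply: conv_fneg
  | |- conv (fdil _ _) => apply: conv_fdil; [by []|]
  | |- conv (_ ^+ _) => apply: convX
  | |- conv (_ * _) => apply: convM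
  | |- conv (_ - _) => apply: convB
  | |- conv (_ + _) => apply: convD
  | |- conv (- _) => apply: convN
  end.

(** * Polynomials in the Hauptmodul *)

Section HeckeStep.
Context {R : realType}.

Definition theta2 : fps R := fX * fdil 8 psi2.
(** The product theta_3 theta_4 in the variable [p] of the other cusp, whose fourth power is the
    inverted nome. *)
Definition phi_pm : fps R := fdil 4 (phi * fneg phi).

Lemma conv_theta2 : conv theta2. Proof. rewrite /theta2; convs. Qed.
Lemma conv_phi_pm : conv phi_pm. Proof. rewrite /phi_pm; convs. Qed.

Lemma theta2E : theta2 = fX * fdil 8 psi2. Proof. by []. Qed.
Lemma phi_pmE : phi_pm = fdil 4 (phi * fneg phi). Proof. by []. Qed.
Lemma hauptzE : hauptz = fX * (fdil 2 psi ^+ 4 * fneg phi ^+ 4 * phi_inv ^+ 8) :> fps R.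
Proof. by rewrite /hauptz !mulrA. Qed.

#[local] Opaque fev cev phi psi psi2 phi_inv psi_inv hauptz hauptW theta2 phi_pm.

(** As z starts with [q], subtracting the right multiple of [z^r] removes the coefficient of [q^r]
    and disturbs only higher ones. *)
Lemma haupt_expansion (f : fps R) (k : nat) : conv f ->
  exists (a : nat -> R) (K : fps R), conv K /\
    f = \sum_(r < k.+1) fC (a r) * hauptz ^+ r + fX ^+ k.+1 * K.
Proof.
move=> cf; pose zeta : fps R := fdil 2 psi ^+ 4 * fneg phi ^+ 4 * phi_inv ^+ 8.
have zE : hauptz = fX * zeta := hauptzE.
have z0 : zeta 0%N = 1.
  have oneM (g h : fps R) : g 0%N = 1 -> h 0%N = 1 -> (g * h) 0%N = 1.
    by move=> g0 h0; rewrite fcoefM0 g0 h0 mulr1.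
  have oneX (g : fps R) j : g 0%N = 1 -> (g ^+ j) 0%N = 1.
    by move=> g0; rewrite fcoefX0 g0 expr1n.
  refine (oneM _ _ _ _); last exact/oneX/phi_inv_coef0.
  refine (oneM _ _ _ _); refine (oneX _ _ _); first by rewrite fcoef_dil dvdn0 div0n psi_coef0.
  by rewrite fneg0 phi_coef0.
have cz : conv zeta by rewrite /zeta; convs.
elim: k => [|k [a [K [cK fE]]]].
  exists (fun=> f 0%N), (fshift 1 f); split; first exact: conv_fshift.
  by rewrite big_ord1 expr0 mulr1 expr1 -fcoef_shift1.
pose b r := if (r <= k)%N then a r else K 0%N.
pose K' := K - fC (K 0%N) * zeta ^+ k.+1.
have cK' : conv K' by rewrite /K'; convs.
have K'0 : K' 0%N = 0 by rewrite /K' fcoefB fcoefM0 fcoefX0 z0 expr1n mulr1 /= subrr.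
exists b, (fshift 1 K'); split; first exact: conv_fshift.
have K'E : K' = fX * fshift 1 K' by rewrite {1}(fcoef_shift1 K') K'0 rmorph0 add0r.
rewrite big_ord_recr /=.
have -> : fX ^+ k.+2 * fshift 1 K' = fX ^+ k.+1 * K'.
  by rewrite {2}K'E [fX ^+ k.+2]exprSr mulrA.
rewrite {2}/b ltnn /K'.
have -> : \sum_(i < k.+1) fC (b i) * hauptz ^+ i = \sum_(i < k.+1) fC (a i) * hauptz ^+ i :> fps R.
  by apply: eq_bigr => i _; rewrite /b -ltnS ltn_ord.
have zk : hauptz ^+ k.+1 = fX ^+ k.+1 * zeta ^+ k.+1 by rewrite zE exprMn.
by rewrite {1}fE zk; ring.
Qed.

Section AtPoint.
Variable y : R.
Hypothesis y0 : 0 < y.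
Let s : R := (Num.sqrt y)^-1.
Let q : R := expR (- (pi * y)).
Let q' : R := expR (- (pi / y)).
Let p : R := expR (- (pi / 4 / y)).

Let s0 : s != 0. Proof. by rewrite invr_eq0 gt_eqF ?sqrtr_gt0. Qed.
Let exp1 (x : R) : 0 < x -> `|expR (- x)| < 1 :> R.
Proof. by move=> x0; rewrite (ger0_norm (expR_ge0 _)) expR_lt1 oppr_lt0. Qed.
Let nq : `|q| < 1. Proof. by apply: exp1; rewrite mulr_gt0// pi_gt0. Qed.
Let nq' : `|q'| < 1. Proof. by apply: exp1; rewrite divr_gt0// pi_gt0. Qed.
Let np : `|p| < 1. Proof. by apply: exp1; rewrite !divr_gt0// pi_gt0. Qed.
Let nmq : `|- q| < 1. Proof. by rewrite normrN. Qed.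
Let p4 : p ^+ 4 = q'.
Proof. by rewrite /p /q' -expRM_natl; congr expR; field; rewrite gt_eqF. Qed.

Lemma fev_phi_neq0 (x : R) : `|x| < 1 -> fev phi x != 0.
Proof.
move=> nx; have := congr1 (fev^~ x) (phi_invK (R := R)).
rewrite /= (fevM nx conv_phi conv_phi_inv) fev1 => e.
by apply/eqP => h; move/eqP: e; rewrite h mul0r eq_sym oner_eq0.
Qed.

Let phi_q : fev phi q = s * fev phi q'.
Proof. by have [_ _ H _] := modular_pair_phi (R := R); rewrite /q H// expr1. Qed.

Let phi_mq : fev phi (- q) = s * fev theta2 p.
Proof. by have [_ _ _ H] := modular_pair_phi (R := R); rewrite /q H// expr1. Qed.

Lemma theta2_quartic : fev theta2 p ^+ 4 = fev phi q' ^+ 4 - fev phi (- q') ^+ 4.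
Proof.
have := congr1 (fev^~ q') (phi_quartic (R := R)); rewrite /=.
rewrite (fevX _ nq' conv_phi) (fevD nq'); [|convs|convs].
rewrite (fevX _ nq'); last convs.
rewrite fev_fneg (fevM nq'); [|convs|convs].
rewrite (fevM nq'); [|convs|convs].
rewrite -fC_nat fev_fC fev_fX (fevX _ nq'); last convs.
rewrite fev_fdil//; last convs.
move=> ->; rewrite [_ + _ * _]addrC addrK.
rewrite theta2E (fevM np); [|convs|convs].
rewrite fev_fX fev_fdil//; last convs.
rewrite psi2E (fevM _ _ (conv_psi (R := R))); [|by rewrite normrX exprn_ilt1|convs].
rewrite -fC_nat fev_fC -p4 -exprM.
by rewrite !exprMn -natrX; ring.
Qed.

Lemma fev_hauptz_phi (x : R) : `|x| < 1 ->
  16 * fev hauptz x * fev phi x ^+ 8 = (fev phi x ^+ 4 - fev phi (- x) ^+ 4) * fev phi (- x) ^+ 4.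
Proof.
move=> nx; have := congr1 (fev^~ x) (hauptz_phi (R := R)); rewrite /=.
rewrite (fevM nx); [|convs|convs].
rewrite (fevM nx); [|convs|convs].
rewrite -fC_nat fev_fC (fevX _ nx); last convs.
move=> ->; rewrite (fevM nx); [|convs|convs].
rewrite (fevB nx); [|convs|convs].
rewrite !(fevX _ nx); try convs.
by rewrite fev_fneg.
Qed.

Lemma hauptz_inv : fev hauptz q = fev hauptz q' :> R.
Proof.
have := fev_hauptz_phi nq; have := fev_hauptz_phi nq'.
have : fev phi q' != 0 := fev_phi_neq0 nq'.
have := theta2_quartic; rewrite phi_q phi_mq.
move: (fev hauptz q) (fev hauptz q') (fev phi q') (fev phi (- q')) (fev theta2 p) => z z' A B T TE A0 e1 e2.
have : 16 * z * (s * A) ^+ 8 = 16 * z' * (s * A) ^+ 8.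
  rewrite e2 !exprMn -mulrBr TE.
  transitivity (s ^+ 8 * (16 * z' * A ^+ 8)); last by ring.
  by rewrite e1; ring.
have sA : 16 * (s * A) ^+ 8 != 0 by rewrite mulf_neq0 ?pnatr_eq0// expf_neq0// mulf_neq0.
by rewrite !(mulrAC 16 _ (_ ^+ 8)) => /(mulfI sA).
Qed.

(** At the other cusp z has a pole, of order 8 in [p]. The constant [- 1/16] of the later formulas
    originates here. *)
Lemma hauptz_neg : 16 * fev hauptz (- q) * fev theta2 p ^+ 8 = - fev phi_pm p ^+ 4.
Proof.
have := fev_hauptz_phi nmq; rewrite opprK.
have -> : fev phi_pm p = fev phi q' * fev phi (- q').
  rewrite phi_pmE fev_fdil//; last convs.
  by rewrite p4 (fevM nq'); [rewrite fev_fneg|convs|convs].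
have := theta2_quartic; rewrite phi_q phi_mq.
move: (fev hauptz (- q)) (fev phi q') (fev phi (- q')) (fev theta2 p) => z A B T TE e.
have s8 : s ^+ 8 != 0 by rewrite expf_neq0.
apply: (mulfI s8); transitivity (16 * z * (s * T) ^+ 8); first by ring.
by rewrite e !exprMn -mulrBr TE; ring.
Qed.

Variables (n : nat) (c d : fps R).
Hypothesis cd : modular_pair n c d.

Lemma weight0_inv : fev (c * phi_inv ^+ n) q = fev (c * phi_inv ^+ n) q'.
Proof.
have [cc cd' H _] := cd.
have E x : `|x| < 1 -> fev (c * phi_inv ^+ n) x = fev c x / fev phi x ^+ n.
  move=> nx; rewrite (fevM nx) ?(fevX _ nx); try convs.
  have := congr1 (fev^~ x) (phi_invK (R := R)).
  rewrite /= (fevM nx conv_phi conv_phi_inv) fev1 => e.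
  have {e} -> : fev phi_inv x = (fev phi x)^-1.
    by apply: (mulfI (fev_phi_neq0 nx)); rewrite e divff// fev_phi_neq0.
  by rewrite exprVn.
have Hq : fev c q = s ^+ n * fev c q' := H y y0.
have sn : s ^+ n != 0 by exact: expf_neq0.
by rewrite (E q nq) (E q' nq') Hq phi_q exprMn invfM mulrACA (divff sn) mul1r.
Qed.

Lemma weight0_neg : fev (c * phi_inv ^+ n) (- q) * fev theta2 p ^+ n = fev d p.
Proof.
have [cc cd' _ H] := cd.
rewrite (fevM nmq) ?(fevX _ nmq); try convs.
have := congr1 (fev^~ (- q)) (phi_invK (R := R)).
rewrite /= (fevM nmq conv_phi conv_phi_inv) fev1 phi_mq => e.
rewrite {1}/q H// -/s -/p -mulrA -exprMn mulrC mulrA -mulrA.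
transitivity (fev d p * (s * fev theta2 p * fev phi_inv (- q)) ^+ n); first by rewrite !exprMn; ring.
by rewrite e expr1n mulr1.
Qed.

End AtPoint.

Lemma phi_pm_inv (x : R) : `|x| < 1 ->
  fev phi_pm x * fev (fdil 4 (phi_inv * fneg phi_inv)) x = 1.
Proof.
move=> nx; rewrite phi_pmE -(fevM nx); [|convs|convs].
rewrite -rmorphM mulrACA phi_invK fneg_phi_invK mulr1 rmorph1; exact: fev1.
Qed.

Section Hecke.
Variables (n : nat) (c d : fps R).
Hypothesis cd : modular_pair n c d.
Let k := (n %/ 8)%N.

Lemma fev_hauptz_neq0 (x : R) : x != 0 -> `|x| < 1 -> fev hauptz x != 0.
Proof.
move=> x0 nx; have := congr1 (fev^~ x) (hauptzW (R := R)); rewrite /=.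
rewrite (fevM nx) ?fev_fX; [|convs|convs].
by move=> e; apply: contra x0 => /eqP h; rewrite -e h mul0r.
Qed.

Lemma fev_theta2_neq0 (x : R) : x != 0 -> `|x| < 1 -> fev theta2 x != 0.
Proof.
move=> x0 nx; have k1 : fdil 8 psi2 * (fC 2^-1 * fdil 8 psi_inv) = 1 :> fps R.
  rewrite psi2E rmorphM /= rmorph_nat mulrACA -fC_nat -rmorphM divff ?pnatr_eq0// rmorph1 mul1r.
  by rewrite -rmorphM /= psi_invK rmorph1.
have := congr1 (fev^~ x) k1; rewrite /= fev1.
have c1 : conv (fC 2^-1 * fdil 8 psi_inv : fps R).
  by apply: convM; [exact: conv_fC|apply: conv_fdil => //; exact: conv_psi_inv].
rewrite (fevM nx _ c1); last convs.
move=> e; rewrite theta2E (fevM nx); [|convs|convs].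
rewrite fev_fX mulf_neq0//; apply/eqP => h.
by move/eqP: e; rewrite h mul0r eq_sym oner_eq0.
Qed.

Theorem hecke : exists a : nat -> R,
  c * phi_inv ^+ n = \sum_(r < k.+1) fC (a r) * hauptz ^+ r /\
  d = \sum_(r < k.+1) fC (a r * (- 16^-1) ^+ r) * theta2 ^+ (n - 8 * r) * phi_pm ^+ (4 * r).
Proof.
have [cc cd' _ _] := cd.
have cF : conv (c * phi_inv ^+ n) by convs.
have [a [K [cK FE]]] := haupt_expansion k cF.
exists a; set F := c * phi_inv ^+ n in cF FE *.
set P := \sum_(r < k.+1) fC (a r) * hauptz ^+ r in FE *.
set S := \sum_(r < k.+1) _.
have ct := conv_theta2; have cg := conv_phi_pm.
have cP : conv P by apply: conv_sum => i _; convs.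
have cS : conv S by apply: conv_sum => i _; convs.
(* For a 16th power the exponent of z must lie strictly between [2 * n] and [16 * k.+1]: below the
   upper end the quotient vanishes at [q = 0], above the lower end it vanishes at the other cusp. As
   [8 * k.+1 > n], the upper end is at least [2 * n + 2], which leaves room for [2 * n + 1]. *)
pose m := (2 * n).+1.
have km : (m < 16 * k.+1)%N by rewrite /m /k; lia.
have [C [C00 cC CE]] : exists C : fps R,
    [/\ C 0%N = 0, conv C & C * hauptz ^+ m = (F - P) ^+ 16].
  (* The quotient is formed with [q / z = hauptW * phi ^+ 12], so it is visibly a convergent power
     series. *)
  exists (fX ^+ (16 * k.+1 - m) * K ^+ 16 * (hauptW * phi ^+ 12) ^+ m); split.
  - rewrite -mulrA fcoefM0 fcoefX0 expr0n.
    have -> : (16 * k.+1 - m == 0)%N = false by lia.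
    exact: mul0r.
  - by convs.
  - have zz : (hauptW * phi ^+ 12) ^+ m * hauptz ^+ m = fX ^+ m :> fps R.
      by rewrite -(exprMn m) [X in X ^+ m]mulrC hauptzW.
    have FP : F - P = fX ^+ k.+1 * K by rewrite FE addrAC subrr add0r.
    rewrite -mulrA zz FP exprMn -exprM.
    transitivity (fX ^+ (16 * k.+1 - m + m) * K ^+ 16); first by rewrite exprD; ring.
    by rewrite (subnK (ltnW km)) mulnC.
pose Gi : fps R := fdil 4 (phi_inv * fneg phi_inv).
have cGi : conv Gi by rewrite /Gi; convs.
(* The same quotient at the other cusp: [F - P] is [(d - S) / theta2 ^+ n] there, and [1 / z] brings
   [theta2 ^+ 8]. Of the exponent [8 * m = 16 * n + 8] exactly 8 is left, and this makes the series
   vanish at the cusp. *)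
have [D [D00 cD DE]] : exists D : fps R, [/\ D 0%N = 0, conv D &
    forall x, `|x| < 1 -> fev D x = (-16) ^+ m * (fev d x - fev S x) ^+ 16 *
      fev theta2 x ^+ 8 * fev Gi x ^+ (4 * m)].
  have c1 : conv (fC ((- 16) ^+ m) : fps R) := conv_fC _.
  have c2 : conv ((d - S) ^+ 16) := convX 16 (convB cd' cS).
  have c3 : conv (theta2 ^+ 8 : fps R) := convX 8 ct.
  have c4 : conv (Gi ^+ (4 * m)) := convX _ cGi.
  have c12 := convM c1 c2; have c123 := convM c12 c3.
  exists (fC ((- 16) ^+ m) * (d - S) ^+ 16 * theta2 ^+ 8 * Gi ^+ (4 * m)); split.
  - rewrite fcoefM0 (fcoefM0 _ (theta2 ^+ 8)) (fcoefX0 theta2) theta2E (fcoefM0 fX).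
    by rewrite mul0r expr0n mulr0 mul0r.
  - exact: convM c123 c4.
  - move=> x nx; rewrite (fevM nx c123 c4) (fevM nx c12 c3) (fevM nx c1 c2) fev_fC.
    by rewrite (fevX 16 nx (convB cd' cS)) (fevX 8 nx ct) (fevX _ nx cGi) (fevB nx cd' cS).
have CEev x : `|x| < 1 -> fev C x * fev hauptz x ^+ m = (fev F x - fev P x) ^+ 16.
  move=> nx; have := congr1 (fev^~ x) CE; rewrite /=.
  have cz := conv_hauptz (R := R).
  rewrite (fevM nx cC (convX m cz)) (fevX m nx cz) (fevX 16 nx (convB cF cP)).
  by rewrite (fevB nx cF cP).
have PE x : `|x| < 1 -> fev P x = \sum_(r < k.+1) a r * fev hauptz x ^+ r.
  move=> nx; rewrite /P (fev_sum _ nx) => [|i]; last convs.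
  apply: eq_bigr => i _; have cz := conv_hauptz (R := R).
  by rewrite (fevM nx (conv_fC _) (convX i cz)) fev_fC (fevX i nx cz).
have e1 (x : R) : 0 < x -> `|expR (- x)| < 1 :> R.
  by move=> x0; rewrite (ger0_norm (expR_ge0 _)) expR_lt1 oppr_lt0.
have expN0 (x : R) : expR x != 0 by rewrite gt_eqF// expR_gt0.
have [||y y0|y y0|C0 D0] := @modular_liouville R C D cC cD.
- exact: C00.
- exact: D00.
- have n1 := e1 _ (mulr_gt0 (pi_gt0 R) y0); have n2 := e1 _ (divr_gt0 (pi_gt0 R) y0).
  have := CEev _ n1; rewrite (PE _ n1) (weight0_inv y0 cd) (hauptz_inv y0) -(PE _ n2) -(CEev _ n2).
  by move/mulIf; apply; rewrite expf_neq0// fev_hauptz_neq0.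
- have n1 := e1 _ (mulr_gt0 (pi_gt0 R) y0).
  have nm1 : `|- expR (- (pi * y))| < 1 :> R by rewrite normrN.
  have np : `|expR (- (pi / 4 / y))| < 1 :> R.
    by apply: e1; rewrite divr_gt0// divr_gt0// pi_gt0.
  have := CEev _ nm1; rewrite (PE _ nm1) fev_fneg.
  have := weight0_neg y0 cd; have := hauptz_neg y0; have := phi_pm_inv np.
  have T0 := fev_theta2_neq0 (expN0 _) np.
  rewrite (DE _ np).
  have -> : fev S (expR (- (pi / 4 / y))) = \sum_(r < k.+1) a r * (- 16^-1) ^+ r *
      fev theta2 (expR (- (pi / 4 / y))) ^+ (n - 8 * r) *
      fev phi_pm (expR (- (pi / 4 / y))) ^+ (4 * r).
    rewrite /S (fev_sum _ np) => [|i]; last convs.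
    apply: eq_bigr => i _; set x := expR _ in np *.
    have c1 : conv (fC (a i * (- 16^-1) ^+ i) : fps R) := conv_fC _.
    have c2 := convX (n - 8 * i) ct; have c3 := convX (4 * i) cg.
    by rewrite (fevM np (convM c1 c2) c3) (fevM np c1 c2) fev_fC (fevX _ np ct) (fevX _ np cg).
  rewrite -/F -/Gi.
  move: (fev F _) (fev hauptz _) (fev theta2 _) (fev phi_pm _) (fev Gi _) (fev d _) (fev C _) T0.
  move=> f z T G gi dp Cv T0 Gg zE fE CvE.
  have G0 : G != 0 by apply/eqP => h; move/eqP: Gg; rewrite h mul0r eq_sym oner_eq0.
  have giE : gi = G^-1 by apply: (mulfI G0); rewrite Gg divff.
  have {zE}zE : z = - 16^-1 * G ^+ 4 / T ^+ 8.
    have T80 : T ^+ 8 != 0 by rewrite expf_neq0.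
    apply: (mulIf T80); rewrite divfK//.
    have -> : z * T ^+ 8 = 16^-1 * (16 * z * T ^+ 8) by field.
    by rewrite zE; ring.
  have zr r : z ^+ r = (- 16^-1) ^+ r * G ^+ (4 * r) / T ^+ (8 * r).
    by rewrite zE [LHS](exprMn r) [X in X * _](exprMn r) exprVn -!exprM.
  have SE : \sum_(r < k.+1) a r * (- 16^-1) ^+ r * T ^+ (n - 8 * r) * G ^+ (4 * r) =
      T ^+ n * \sum_(r < k.+1) a r * z ^+ r.
    rewrite mulr_sumr; apply: eq_bigr => r _.
    have rn : (8 * r <= n)%N by have := ltn_ord r; rewrite /k; lia.
    have TnE : T ^+ n = T ^+ (n - 8 * r) * T ^+ (8 * r) by rewrite -exprD (subnK rn).
    have T8 : T ^+ (8 * r) != 0 by rewrite expf_neq0.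
    rewrite TnE zr; move: T8; move: (T ^+ (8 * r)) (T ^+ (n - 8 * r)) (G ^+ (4 * r)) => u v w u0.
    by field.
  rewrite SE -fE; move: CvE {SE}; move: (\sum_(r < k.+1) _) => P0 CvE.
  have -> : f * T ^+ n - T ^+ n * P0 = T ^+ n * (f - P0) by ring.
  rewrite (exprMn 16) -CvE zr giE exprVn -(exprM T).
  have T8m : T ^+ (8 * m) = T ^+ (n * 16) * T ^+ 8.
    by rewrite -exprD; congr (_ ^+ _); rewrite /m; lia.
  have s16 : (-16) ^+ m * (- 16^-1) ^+ m = 1 :> R.
    by rewrite -(exprMn m) mulrNN divff ?expr1n// pnatr_eq0.
  have T1 : T ^+ (n * 16) != 0 by rewrite expf_neq0.
  have T2 : T ^+ 8 != 0 by rewrite expf_neq0.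
  have G1 : G ^+ (4 * m) != 0 by rewrite expf_neq0.
  rewrite T8m; move: T1 T2 G1 s16.
  move: (T ^+ (n * 16)) (T ^+ 8) (G ^+ (4 * m)) ((-16) ^+ m) ((- 16^-1) ^+ m) => t1 t2 g1 w1 w2 t10 t20 g10 w12.
  by rewrite -[LHS]mul1r -w12; field; rewrite t10 t20 g10.
have nx1 (x : R) : 0 < x -> x < 1 -> `|x| < 1 by move=> x0 x1; rewrite (gtr0_norm x0).
split.
- apply: (@fev_inj R _ _ 1) => // x x0 x1; have nx := nx1 x x0 x1.
  have := CEev x nx; rewrite C0 fev0 mul0r => /esym/eqP; rewrite expf_eq0 /= subr_eq0.
  by move/eqP.
(* All cofactors of [(d - S)^16] in [D] are nonzero at positive points, so [D = 0] forces
   [d = S]. *)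
- apply: (@fev_inj R _ _ 2^-1) => //; rewrite ?invr_gt0 ?invf_le1 ?ler1n// => x x0 x2.
  have x1 : x < 1 by lra.
  have nx := nx1 x x0 x1.
  have := DE x nx; rewrite D0 fev0 => /esym E.
  apply/eqP; rewrite -subr_eq0; apply/negPn/negP => nz.
  have G0 : fev Gi x != 0.
    apply/eqP => h; have := phi_pm_inv nx; rewrite -/Gi h mulr0 => /eqP.
    by rewrite eq_sym oner_eq0.
  have T0 : fev theta2 x != 0 by apply: fev_theta2_neq0 => //; rewrite gt_eqF.
  have w0 : (-16) ^+ m != 0 :> R by rewrite expf_neq0// oppr_eq0 pnatr_eq0.
  have := mulf_neq0 (mulf_neq0 (mulf_neq0 w0 (expf_neq0 16 nz)) (expf_neq0 8 T0))
    (expf_neq0 (4 * m) G0).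
  by rewrite E eqxx.
Qed.

End Hecke.

End HeckeStep.

(** * Lagrange inversion *)

Section Derivation.
Context {R : realType}.
Implicit Types c d : fps R.

(** The derivation [q d/dq]. Residues of differentials become coefficients, and that a derivative
    has no residue becomes the vanishing of the factor [i] at [i = 0]. *)
Definition fder c := Fps (fun i => i%:R * c i).

Lemma fcoef_der c i : fder c i = i%:R * c i. Proof. by []. Qed.

Lemma fcoef_nat k c i : (k%:R * c) i = k%:R * c i.
Proof. by rewrite -fC_nat fcoefCM. Qed.

Lemma fderD c d : fder (c + d) = fder c + fder d.
Proof. by apply: fpsP => i; rewrite fcoefD /= mulrDr. Qed.

Lemma fderM c d : fder (c * d) = fder c * d + c * fder d.
Proof.
apply: fpsP => m; rewrite fcoefD !fcoefM /= mulr_sumr -big_split /=.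
apply: eq_bigr => i _; have -> : m%:R = i%:R + (m - i)%:R :> R.
  by rewrite -natrD subnKC// -ltnS.
ring.
Qed.

Lemma fder1 : fder 1 = 0.
Proof. by apply: fpsP => -[|i]; rewrite /= ?mul0r ?mulr0. Qed.

Lemma fderX c m : fder (c ^+ m) = m%:R * c ^+ m.-1 * fder c.
Proof.
elim: m => [|m IH]; first by rewrite expr0 fder1 !mul0r.
rewrite exprS fderM IH /=; case: m {IH} => [|m]; first by rewrite expr0; ring.
by rewrite /= -[m.+2%:R]natr1 exprS; ring.
Qed.

Lemma fderC a c : fder (fC a * c) = fC a * fder c.
Proof. by apply: fpsP => i; rewrite fcoef_der !fcoefCM fcoef_der mulrCA. Qed.

Lemma fder_fXn s : fder (fX ^+ s) = s%:R * fX ^+ s.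
Proof.
rewrite fderX; have -> : fder fX = fX by apply: fpsP => -[|[|i]]; rewrite /= ?mul0r ?mulr0 ?mul1r.
case: s => [|s]; first by rewrite !mul0r.
by rewrite /= exprSr mulrA.
Qed.

Lemma fder_sum (I : Type) (s : seq I) (f : I -> fps R) :
  fder (\sum_(i <- s) f i) = \sum_(i <- s) fder (f i).
Proof.
elim: s => [|i s IH]; last by rewrite !big_cons fderD IH.
by rewrite !big_nil; apply: fpsP => i; rewrite fcoef_der !fcoef0 mulr0.
Qed.

Lemma fcoefM_low k c d : (forall i, (i <= k)%N -> c i = 0) ->
  forall i, (i <= k)%N -> (c * d) i = 0.
Proof.
move=> c0 i ik; rewrite fcoefM big1// => j _; rewrite c0 ?mul0r//.
by rewrite (leq_trans _ ik)// -ltnS.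
Qed.

(* Since z^-r is q^-r eta^r, the coefficient on the left is the residue at 0 of z^-r d(z^s). *)
Lemma lagrange (z eta zeta : fps R) (s r : nat) : z = fX * zeta -> zeta 0%N = 1 ->
  zeta * eta = 1 -> (0 < r)%N ->
  (fder (z ^+ s) * eta ^+ r) r = if s == r then r%:R else 0.
Proof.
move=> zE zeta0 ze r0; have eta0 : eta 0%N = 1 by exact: inv_coef0 zeta0 ze.
have Dz t : fder (z ^+ t) = fX ^+ t * (t%:R * zeta ^+ t + fder (zeta ^+ t)).
  by rewrite zE (exprMn t) fderM fder_fXn; ring.
have z_eta t : z ^+ t * eta ^+ t = fX ^+ t.
  by rewrite zE -(exprMn t) -mulrA ze mulr1.
case: (ltngtP s r) => [sr|rs|->]; last first.
- rewrite Dz -mulrA fcoefXnM ltnn subnn fcoefM0 fcoefD fcoef_nat !fcoefX0 zeta0 eta0 /=.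
  by rewrite mul0r !expr1n addr0 !mulr1.
- by rewrite Dz -mulrA fcoefXnM rs.
case: s sr => [|s] sr; first by rewrite expr0 fder1 mul0r fcoef0.
(* Up to the factor [m] the series equals [s + 1] times [q^(s+1) (m eta^m - D(eta^m))], with [D] the
   derivation; coefficient [m] of the bracket is zero because [D] multiplies it by [m]. *)
pose m := (r - s.+1)%N; have m0 : (0 < m)%N by rewrite subn_gt0.
have rE : r = (s.+1 + m)%N by rewrite subnKC// ltnW.
have key : m%:R * (fder (z ^+ s.+1) * eta ^+ r) =
    s.+1%:R * (fX ^+ s.+1 * (m%:R * eta ^+ m - fder (eta ^+ m))).
  have E : fder (z ^+ s.+1) * eta ^+ s.+1 = s.+1%:R * fX ^+ s.+1 - z ^+ s.+1 * fder (eta ^+ s.+1).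
    by rewrite -(fder_fXn s.+1) -(z_eta s.+1) fderM addrK.
  have em : eta ^+ m = eta ^+ m.-1 * eta by rewrite -exprSr prednK.
  transitivity (m%:R * ((fder (z ^+ s.+1) * eta ^+ s.+1) * eta ^+ m)).
    by rewrite rE exprD; congr (_ * _); exact: mulrA.
  rewrite E !(fderX eta) -(z_eta s.+1) em [eta ^+ s.+1]exprSr /=.
  move: (z ^+ s.+1) (eta ^+ s) (eta ^+ m.-1) (fder eta) (m%:R : fps R) (s.+1%:R : fps R) => *; ring.
have := congr1 (fun c : fps R => c r) key; cbv beta.
rewrite fcoef_nat (fcoef_nat s.+1).
rewrite fcoefXnM ltnNge (ltnW sr) [~~ true]/= -/m fcoefB fcoef_nat fcoef_der subrr mulr0 => /eqP.
by rewrite mulf_eq0 pnatr_eq0 -leqn0 leqNgt m0 /= => /eqP.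
Qed.

End Derivation.

(** * The coefficients of the polynomial as residues *)

Section Residues.
Context {R : realType}.

Lemma hauptz_lagrange (s r : nat) : (0 < r)%N ->
  (fder (hauptz ^+ s) * (hauptW * phi ^+ 12) ^+ r) r = if s == r then r%:R else 0 :> R.
Proof.
move=> r0; pose zeta : fps R := fdil 2 psi ^+ 4 * fneg phi ^+ 4 * phi_inv ^+ 8.
have zE : hauptz = fX * zeta := hauptzE.
have oneM (g h : fps R) : g 0%N = 1 -> h 0%N = 1 -> (g * h) 0%N = 1.
  by move=> g0 h0; rewrite fcoefM0 g0 h0 mulr1.
have oneX (g : fps R) j : g 0%N = 1 -> (g ^+ j) 0%N = 1.
  by move=> g0; rewrite fcoefX0 g0 expr1n.
apply: (lagrange (zeta := zeta)) => //.
  refine (oneM _ _ _ _); last exact/oneX/phi_inv_coef0.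
  refine (oneM _ _ _ _); refine (oneX _ _ _); first by rewrite fcoef_dil dvdn0 div0n psi_coef0.
  by rewrite fneg0 phi_coef0.
apply: (@fX_lreg R _ _ 1); rewrite expr1 mulr1 mulrA -zE; exact: hauptzW.
Qed.

Variables (n k : nat) (c : fps R) (a : nat -> R).
Hypothesis c0 : c 0%N = 1.
Hypothesis c_low : forall i, (0 < i)%N -> (i <= k)%N -> c i = 0.
Hypothesis cE : c * phi_inv ^+ n = \sum_(r < k.+1) fC (a r) * hauptz ^+ r.

Lemma hecke_coef0 : a 0%N = 1.
Proof.
have := congr1 (fun d : fps R => d 0%N) cE.
rewrite fcoefM0 fcoefX0 c0 phi_inv_coef0 expr1n mulr1 fcoef_sum => ->.
rewrite big_ord_recl fcoefCM expr0 fcoef1 mulr1 big1 ?addr0// => i _.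
rewrite fcoefCM fcoefX0 hauptzE fcoefM0 mul0r expr0n /= mulr0 //.
Qed.

Lemma fder_phi_inv : fder (phi_inv ^+ n) = - (n%:R * phi_inv ^+ n.+1 * fder phi) :> fps R.
Proof.
have := congr1 fder (phi_invK (R := R)); rewrite fderM fder1 => /eqP.
rewrite addr_eq0 => /eqP e.
have D1 : fder phi_inv = - (phi_inv ^+ 2 * fder phi) :> fps R.
  transitivity (phi * phi_inv * fder phi_inv : fps R); first by rewrite phi_invK mul1r.
  transitivity (- (phi_inv * - (phi * fder phi_inv)) : fps R); first by ring.
  by rewrite -e; ring.
rewrite fderX D1; case: n => [|m]; first by rewrite !mul0r oppr0.
by rewrite /= !exprS; ring.
Qed.

(** Lagrange's formula extracts [a r] from the derivative of [c phi^-n]. As [c - 1] vanishes up to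
    degree [k], [c] may be replaced by 1 there, which leaves a quantity depending on [n] and [r]
    only. *)
Theorem residue r : (0 < r)%N -> (r <= k)%N ->
  r%:R * a r = - (n%:R * (phi_inv ^+ n.+1 * fder phi * (hauptW * phi ^+ 12) ^+ r) r).
Proof.
move=> r0 rk; set eta := hauptW * phi ^+ 12.
have L : (fder (c * phi_inv ^+ n) * eta ^+ r) r = r%:R * a r.
  have -> : fder (c * phi_inv ^+ n) * eta ^+ r =
      \sum_(i < k.+1) fC (a i) * (fder (hauptz ^+ i) * eta ^+ r).
    by rewrite cE fder_sum mulr_suml; apply: eq_bigr => i _; rewrite fderC mulrA.
  rewrite fcoef_sum; transitivity (\sum_(i < k.+1) a i * (if (i : nat) == r then r%:R else 0)).
    by apply: eq_bigr => i _; rewrite fcoefCM hauptz_lagrange.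
  rewrite (bigD1 (Ordinal (rk : r < k.+1)%N)) //= eqxx big1 ?addr0; first exact: mulrC.
  move=> i /eqP ir; case: eqP => [e|_]; last by rewrite mulr0.
  by exfalso; apply: ir; apply: val_inj.
rewrite -L; have -> : c * phi_inv ^+ n = phi_inv ^+ n + (c - 1) * phi_inv ^+ n by ring.
have low i : (i <= k)%N -> ((c - 1) * phi_inv ^+ n) i = 0.
  apply: fcoefM_low => j jk; rewrite fcoefB fcoef1.
  by case: j jk => [|j] jk; rewrite ?c0 ?c_low// subrr.
rewrite fderD fder_phi_inv mulrDl fcoefD [X in _ + X](fcoefM_low (k := k))//; last first.
  by move=> i ik; rewrite fcoef_der low// mulr0.
rewrite addr0; transitivity ((- n%:R * (phi_inv ^+ n.+1 * fder phi * eta ^+ r)) r).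
  by congr (fcoef _ _); ring.
by rewrite mulNr fcoefN fcoef_nat.
Qed.

(** For [n < 12 r] the negative power of phi is absorbed by [phi ^+ (12 * r)]. All remaining factors
    have nonnegative coefficients, so the sign of [a r] can be read off. *)
Lemma residue_phi r : (0 < r)%N -> (r <= k)%N -> (n < 12 * r)%N ->
  r%:R * a r = - (n%:R * (fder phi * (phi ^+ (12 * r - n.+1) * hauptW ^+ r)) r).
Proof.
move=> r0 rk nr; rewrite residue//; congr (- (_ * fcoef _ _)).
rewrite (exprMn r) -(exprM phi) -[X in phi ^+ X](subnK nr) exprD.
transitivity (fder phi * (phi ^+ (12 * r - n.+1) * hauptW ^+ r) * (phi * phi_inv) ^+ n.+1 : fps R).
  by rewrite (exprMn n.+1); ring.
by rewrite phi_invK expr1n mulr1.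
Qed.

End Residues.

Section LowCoefficients.
Context {R : realType}.
Implicit Types f g : fps R.

Lemma fneg1 f : fneg f 1%N = - f 1%N.
Proof. by rewrite /= expr1 mulN1r. Qed.

Lemma fcoefM1 f g : (f * g) 1%N = f 0%N * g 1%N + f 1%N * g 0%N.
Proof. by rewrite fcoefM big_ord_recl big_ord1. Qed.

Lemma fcoefM2 f g : (f * g) 2%N = f 0%N * g 2%N + f 1%N * g 1%N + f 2%N * g 0%N.
Proof. by rewrite fcoefM !big_ord_recl big_ord0 addr0 addrA. Qed.

Lemma fcoefX1 f m : f 0%N = 1 -> (f ^+ m) 1%N = m%:R * f 1%N.
Proof.
move=> f0; elim: m => [|m IH]; first by rewrite expr0 mul0r.
by rewrite exprS fcoefM1 fcoefX0 f0 IH expr1n -natr1; ring.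
Qed.

Lemma fcoefX2 f m : f 0%N = 1 ->
  (f ^+ m) 2%N = m%:R * f 2%N + m%:R * (m%:R - 1) / 2 * f 1%N ^+ 2.
Proof.
move=> f0; elim: m => [|m IH]; first by rewrite expr0 !mul0r addr0.
by rewrite exprS fcoefM2 fcoefX0 fcoefX1// f0 IH expr1n -natr1; field.
Qed.

Lemma phi_coef1 : phi 1%N = 2 :> R. Proof. exact: (@phi_coef_square R 1). Qed.
Lemma phi_coef4 : phi 4%N = 2 :> R. Proof. exact: (@phi_coef_square R 2). Qed.
Lemma phi_coef2 : phi 2%N = 0 :> R.
Proof. by apply: phi_coef_nsquare => -[|[|k]]//; rewrite expnS expn1; nia. Qed.

Lemma psi_coef1 : psi 1%N = 1 :> R.
Proof.
rewrite /psi fcoefCM; have [//|z|_] := @tsum_seq R int [:: 1; -2] (fun z => (tri z == 1%N)%:R).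
  rewrite !inE negb_or => /andP[/eqP h1 /eqP h2].
  by case: eqP => // e; exfalso; have := triE z; rewrite e; nia.
by rewrite /psi2 /= => ->; rewrite big_cons big_seq1 /tri /= -natrD mulVf// pnatr_eq0.
Qed.

Lemma phi_inv_coef1 : phi_inv 1%N = -2 :> R.
Proof.
have := congr1 (fun d : fps R => d 1%N) (phi_invK (R := R)).
by rewrite fcoefM1 phi_coef0 phi_inv_coef0 phi_coef1 fcoef1 /=; lra.
Qed.

Lemma psi_inv_coef1 : psi_inv 1%N = -1 :> R.
Proof.
have := congr1 (fun d : fps R => d 1%N) (psi_invK (R := R)).
by rewrite fcoefM1 psi_coef0 psi_inv_coef0 psi_coef1 fcoef1 /=; lra.
Qed.

Lemma hauptW_coefs : [/\ hauptW 0%N = 1 :> R, hauptW 1%N = 0 :> R & hauptW 2%N = 12 :> R].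
Proof.
have u0 : fneg phi_inv 0%N = 1 :> R by rewrite fneg0 phi_inv_coef0.
have u1 : fneg phi_inv 1%N = 2 :> R by rewrite fneg1 phi_inv_coef1 opprK.
have v0 : (psi_inv * fneg phi_inv ^+ 2) 0%N = 1 :> R.
  by rewrite fcoefM0 fcoefX0 u0 psi_inv_coef0 expr1n mulr1.
rewrite /hauptW; split.
- by rewrite fcoef_dil dvdn0 div0n fcoefX0 v0 expr1n.
- by rewrite fcoef_dil.
rewrite fcoef_dil dvdnn (_ : (2 %/ 2 = 1)%N)// (fcoefX1 4 v0) fcoefM1 (fcoefX1 2 u0) fcoefX0.
rewrite u0 u1 psi_inv_coef0 psi_inv_coef1; lra.
Qed.

End LowCoefficients.

(** * Coefficients of theta series and shadows *)

Section Signs.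
Context {R : realType}.
Implicit Types f g : fps R.

Lemma fcoefM_ge f g i j : nonneg f -> nonneg g -> f i * g j <= (f * g) (i + j)%N.
Proof.
move=> f0 g0; have lt : (i < (i + j).+1)%N by rewrite ltnS leq_addr.
rewrite fcoefM (bigD1 (Ordinal lt)) //= addKn lerDl.
by apply: sumr_ge0 => l _; rewrite mulr_ge0.
Qed.

Lemma fcoefX_gt0 g m i : nonneg g -> g 0%N = 1 -> 0 < g 2%N -> (i <= m)%N ->
  0 < (g ^+ m) (2 * i)%N.
Proof.
move=> gp g0 g2; elim: m i => [|m IH] [|i]//; rewrite ?muln0 ?fcoefX0 ?g0 ?expr1n ?ltr01//.
rewrite ltnS => /IH h; rewrite mulnS exprS.
by apply: lt_le_trans (fcoefM_ge _ _ gp (nonnegX m gp)); rewrite mulr_gt0.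
Qed.

Lemma nonneg_phi : nonneg (phi : fps R). Proof. exact: phi_ge0. Qed.

Lemma nonneg_fder_phi : nonneg (fder phi : fps R).
Proof. by move=> i; rewrite fcoef_der mulr_ge0// phi_ge0. Qed.

Variables (n k : nat) (c : fps R) (a : nat -> R).
Hypothesis c0 : c 0%N = 1.
Hypothesis c_low : forall i, (0 < i)%N -> (i <= k)%N -> c i = 0.
Hypothesis cE : c * phi_inv ^+ n = \sum_(r < k.+1) fC (a r) * hauptz ^+ r.

Let nonneg_tail m r : nonneg (phi ^+ m * hauptW ^+ r : fps R).
Proof. by apply: nonnegM; apply: nonnegX; [exact: nonneg_phi|exact: hauptW_ge0]. Qed.

Lemma hecke_coef_le0 r : (0 < r)%N -> (r <= k)%N -> (n < 12 * r)%N -> a r <= 0.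
Proof.
move=> r0 rk nr; have := residue_phi c0 c_low cE r0 rk nr => e.
rewrite -(pmulr_rle0 (x := r%:R)) ?ltr0n// e oppr_le0 mulr_ge0//.
by apply: nonnegM; [exact: nonneg_fder_phi|exact: nonneg_tail].
Qed.

(** One strictly positive contribution suffices. [hauptW] has a positive coefficient at [q^2], which
    reaches every even degree up to [2 r]; the derivative of phi supplies degree 1 when [r] is odd
    and degree 4 when [r] is even. *)
Lemma hecke_coef_lt0 r : (0 < n)%N -> (2 < r)%N -> (r <= k)%N -> (n < 12 * r)%N -> a r < 0.
Proof.
move=> n0 r2 rk nr; have r0 : (0 < r)%N by apply: leq_trans r2.
have := residue_phi c0 c_low cE r0 rk nr => e.
rewrite -(pmulr_rlt0 (x := r%:R)) ?ltr0n// e oppr_lt0 mulr_gt0 ?ltr0n//.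
set m := (12 * r - n.+1)%N.
have [W0 W1 W2] := hauptW_coefs (R := R).
have tail i : (i <= r)%N -> 0 < (phi ^+ m * hauptW ^+ r : fps R) (2 * i)%N.
  move=> ir; apply: lt_le_trans (fcoefM_ge 0 _ (nonnegX m nonneg_phi) (nonnegX r hauptW_ge0)).
  by rewrite fcoefX0 phi_coef0 expr1n mul1r fcoefX_gt0// ?W2//; exact: hauptW_ge0.
have split_r s i : r = (s + 2 * i)%N -> (i <= r)%N -> 0 < (fder phi : fps R) s ->
    0 < (fder phi * (phi ^+ m * hauptW ^+ r) : fps R) r.
  move=> rE ir ds; rewrite {2}rE.
  apply: lt_le_trans (fcoefM_ge _ _ nonneg_fder_phi (nonneg_tail m r)).
  by rewrite mulr_gt0// tail.
have [od|ev] := boolP (odd r).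
  apply: (split_r 1%N (r./2)); [lia|lia|].
  by rewrite fcoef_der phi_coef1 mul1r.
apply: (split_r 4%N (r - 4)./2); [lia|lia|].
by rewrite fcoef_der phi_coef4 mulr_gt0.
Qed.

Lemma hecke_coef1 : (0 < k)%N -> a 1%N = - (2 * n%:R).
Proof.
move=> k0; have := residue c0 c_low cE (ltn0Sn 0) k0; rewrite mul1r => ->.
have [W0 W1 W2] := hauptW_coefs (R := R).
have u0 : (phi_inv ^+ n.+1 : fps R) 0%N = 1 by rewrite fcoefX0 phi_inv_coef0 expr1n.
have e0 : ((hauptW * phi ^+ 12) ^+ 1 : fps R) 0%N = 1.
  by rewrite fcoefX0 fcoefM0 (fcoefX0 phi) W0 phi_coef0 !expr1n mulr1.
have p0 : (fder phi : fps R) 0%N = 0 by rewrite fcoef_der mul0r.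
have p1 : (fder phi : fps R) 1%N = 2 by rewrite fcoef_der mul1r phi_coef1.
rewrite fcoefM1 (fcoefM0 (phi_inv ^+ n.+1)) (fcoefM1 (phi_inv ^+ n.+1)) p0 p1 u0 e0; ring.
Qed.

Lemma hecke_coef2 : (1 < k)%N -> (n < 24)%N -> a 2%N = - (2 * n%:R * (23 - n)%N%:R).
Proof.
move=> k1 n24; have := residue_phi c0 c_low cE (ltn0Sn 1) k1 n24.
have [W0 W1 W2] := hauptW_coefs (R := R).
rewrite fcoefM2 fcoefM1 (fcoefX1 _ (phi_coef0 (R := R))) (fcoefX1 _ W0) !fcoefX0 phi_coef0 W0 W1.
rewrite fcoefM0 !fcoefX0 phi_coef0 W0.
rewrite !fcoef_der phi_coef1 phi_coef2 !expr1n (_ : (12 * 2 - n.+1 = 23 - n)%N); last by lia.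
move: (n%:R) ((23 - n)%N%:R) => x y e; lra.
Qed.

Lemma phi_coef3 : phi 3%N = 0 :> R.
Proof. by apply: phi_coef_nsquare => -[|[|j]]//; rewrite expnS expn1; nia. Qed.

Lemma fcoefM3 f g :
  (f * g) 3%N = f 0%N * g 3%N + f 1%N * g 2%N + f 2%N * g 1%N + f 3%N * g 0%N.
Proof. by rewrite fcoefM !big_ord_recl big_ord0 addr0 !addrA. Qed.

(** The number [e] is the exponent [36 - (n + 1)] of phi left in the residue. *)
Lemma hecke_coef3 e : (2 < k)%N -> (n + e = 35)%N ->
  a 3%N = - (2 * n%:R * (2 * e%:R * (e%:R - 1) + 36) / 3).
Proof.
move=> k2 ne; have n36 : (n < 12 * 3)%N by lia.
have := residue_phi c0 c_low cE (ltn0Sn 2) k2 n36.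
have [W0 W1 W2] := hauptW_coefs (R := R).
have p0 : (fder phi : fps R) 0%N = 0 by rewrite fcoef_der mul0r.
have p1 : (fder phi : fps R) 1%N = 2 by rewrite fcoef_der mul1r phi_coef1.
have p2 : (fder phi : fps R) 2%N = 0 by rewrite fcoef_der phi_coef2 mulr0.
have p3 : (fder phi : fps R) 3%N = 0 by rewrite fcoef_der phi_coef3 mulr0.
rewrite fcoefM3 p0 p1 p2 p3 (_ : (12 * 3 - n.+1 = e)%N); last by lia.
rewrite !mul0r !addr0 add0r fcoefM2 (fcoefX2 _ (phi_coef0 (R := R))) (fcoefX2 _ W0).
rewrite (fcoefX1 _ (phi_coef0 (R := R))) (fcoefX1 _ W0) !fcoefX0 phi_coef0 phi_coef1 phi_coef2.
rewrite W0 W1 W2 !expr1n; move: (n%:R) (e%:R) => x y E.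
by apply: (mulfI (_ : 3%:R != 0 :> R)); rewrite ?pnatr_eq0// E; field.
Qed.

End Signs.

(** * The shadow from dimension 24 on *)

Section Shadow.
Context {R : realType}.
Variables (n : nat) (c d : fps R).
Hypothesis cd : modular_pair n c d.
Hypothesis c0 : c 0%N = 1.
Hypothesis c_low : forall i, (0 < i)%N -> (i <= n %/ 8)%N -> c i = 0.
Hypothesis d_nat : forall m, exists N : nat, d m = N%:R.

Let k := (n %/ 8)%N.
Let j := (n %% 8)%N.

Lemma fdil_term (e u v l : nat) (x : R) (f g : fps R) :
  fdil l.+1 (fX ^+ e * (fC x * (f ^+ u * g ^+ v))) =
  fX ^+ (l.+1 * e) * (fC x * (fdil l.+1 f ^+ u * fdil l.+1 g ^+ v)).
Proof. by rewrite !rmorphM /= fdil_C// !rmorphXn /= fdil_X// exprM. Qed.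

(* 24 + i is the dimension; the right-hand side would be the number of vectors of minimal norm of the shadow. *)
Lemma shadow_count_not_nat (N i : nat) : (0 < i)%N -> (i < 8)%N ->
  N%:R = 2 * (24 + i)%:R * (2 * (11 - i)%N%:R * ((11 - i)%N%:R - 1) + 36) / (3 * 4096) * 2 ^+ i :> R ->
  False.
Proof.
move=> i0 i8; have -> : (11 - i)%N%:R - 1 = (10 - i)%N%:R :> R.
  rewrite (_ : (11 - i = (10 - i).+1)%N); last by lia.
  by rewrite -[(10 - i).+1%:R]natr1 addrK.
move=> e; have : (3 * 4096 * N)%:R = (2 * (24 + i) * (2 * (11 - i) * (10 - i) + 36) * 2 ^ i)%:R :> R.
  rewrite !(natrM, natrD, natrX) e natrD.
  move: ((11 - i)%N%:R : R) ((10 - i)%N%:R : R) (i%:R : R) (2 ^+ i : R) => *; by field.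
move/eqP; rewrite eqr_nat => /eqP.
by case: i i0 i8 {e} => [|[|[|[|[|[|[|[|]]]]]]]]// _ _; rewrite ?expnS expn0; lia.
Qed.

(** By [phi_mul_fneg] everything apart from powers of [q] is a series in [q^8], so the shadow
    weights are congruent to [n] modulo 8. Term [r] starts at index [k - r], so the lowest
    coefficients involve only the last values of [a]. *)
Lemma shadow_expansion (a : nat -> R) :
  d = \sum_(r < k.+1) fC (a r * (- 16^-1) ^+ r) * theta2 ^+ (n - 8 * r) * phi_pm ^+ (4 * r) ->
  let X := \sum_(r < k.+1) fX ^+ (k - r) *
    (fC (a r * (- 16^-1) ^+ r * 2 ^+ (n - 8 * r)) * (psi ^+ (n - 8 * r) * fneg phi ^+ (8 * r))) in
  forall i, d (j + 8 * i)%N = X i.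
Proof.
move=> dE X i; have -> : d = fX ^+ j * fdil 8 X.
  rewrite dE rmorph_sum mulr_sumr; apply: eq_bigr => r _.
  have rk : (r <= k)%N by rewrite -ltnS.
  have nE : (n - 8 * r = j + 8 * (k - r))%N.
    by have := divn_eq n 8; rewrite -/k -/j; lia.
  have G : phi_pm ^+ (4 * r) = fdil 8 (fneg phi) ^+ (8 * r) :> fps R.
    rewrite phi_pmE phi_mul_fneg rmorphXn /= fdil_comp// -exprM; congr (_ ^+ _); lia.
  have T : theta2 ^+ (n - 8 * r) = fX ^+ (n - 8 * r) * (fC (2 ^+ (n - 8 * r)) * fdil 8 psi ^+ (n - 8 * r)) :> fps R.
    rewrite theta2E (exprMn (n - 8 * r)) psi2E [fdil 8 (2 * psi)]rmorphM /= rmorph_nat.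
    by rewrite (exprMn (n - 8 * r) 2) [fC (2 ^+ _)]rmorphXn /= fC_nat.
  rewrite /= G T fdil_term [fC (_ * 2 ^+ _)]rmorphM /= nE exprD.
  move: (fX ^+ _) (fX ^+ _) (fC _) (fC _) (fdil 8 psi ^+ _) (fdil 8 (fneg phi) ^+ _) => *; ring.
have lt : (j + 8 * i < j)%N = false by rewrite ltnNge leq_addr.
by rewrite fcoefXnM lt addKn fcoef_dil dvdn_mulr// mulKn.
Qed.

(** The lowest shadow coefficient is [a k * (- 1/16)^k * 2^j] with [a k < 0]. For even [k] it is
    negative, for odd [k >= 5] the next one is negative, and for [k = 3] it is an explicit number,
    integral only when [n = 24]. The first two cases contradict that the coefficients are counts. *)
Lemma shadow_coef0_neq0 : (24 <= n)%N -> d 0%N != 0.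
Proof.
move=> n24; have [a [cE dE]] := hecke cd.
have X := shadow_expansion dE; cbv zeta in X.
have k3 : (3 <= k)%N by rewrite /k leq_divRL.
have nkj : n = (8 * k + j)%N by rewrite [LHS](divn_eq n 8) mulnC.
have j8 : (j < 8)%N by rewrite ltn_mod.
have n0 : (0 < n)%N by apply: leq_trans n24.
pose T r : fps R := fX ^+ (k - r) *
    (fC (a r * (- 16^-1) ^+ r * 2 ^+ (n - 8 * r)) * (psi ^+ (n - 8 * r) * fneg phi ^+ (8 * r))).
have one u v : (psi ^+ u * fneg phi ^+ v : fps R) 0%N = 1.
  by rewrite fcoefM0 !fcoefX0 psi_coef0 fneg0 phi_coef0 !expr1n mulr1.
have {}X i : d (j + 8 * i)%N = \sum_(r < k.+1) T r i by rewrite X fcoef_sum.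
have Tlow r i : (r + i < k)%N -> T r i = 0.
  by move=> h; rewrite /T fcoefXnM (_ : (i < k - r)%N)//; lia.
have Tk i : T k i = (fC (a k * (- 16^-1) ^+ k * 2 ^+ j) * (psi ^+ j * fneg phi ^+ (8 * k))) i.
  by rewrite /T subnn expr0 mul1r (_ : (n - 8 * k = j)%N)//; lia.
have Tk1 : T k.-1 1%N = a k.-1 * (- 16^-1) ^+ k.-1 * 2 ^+ (j + 8).
  rewrite /T (_ : (k - k.-1 = 1)%N); last by lia.
  by rewrite expr1 fcoefXM fcoefCM one mulr1 (_ : (n - 8 * k.-1 = j + 8)%N)//; lia.
have {Tk}[Tk0 Tkk] : T k 0%N = a k * (- 16^-1) ^+ k * 2 ^+ j /\
    T k 1%N = a k * (- 16^-1) ^+ k * 2 ^+ j * (j%:R - 16 * k%:R).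
  rewrite !Tk !fcoefCM one mulr1; split=> //; congr (_ * _).
  rewrite fcoefM1 !fcoefX0 (fcoefX1 _ (psi_coef0 (R := R))) psi_coef0 psi_coef1.
  by rewrite fcoefX1 ?fneg0 ?phi_coef0// fneg1 phi_coef1 !expr1n natrM; ring.
clearbody T.
have d0 : d j = a k * (- 16^-1) ^+ k * 2 ^+ j.
  have := X 0%N; rewrite muln0 addn0 => ->; rewrite big_ord_recr /= Tk0 big1 ?add0r// => i _.
  by apply: Tlow; rewrite addn0 /=.
have d1 : d (j + 8)%N = a k * (- 16^-1) ^+ k * 2 ^+ j * (j%:R - 16 * k%:R) +
    a k.-1 * (- 16^-1) ^+ k.-1 * 2 ^+ (j + 8).
  have := X 1%N; rewrite muln1 => ->; rewrite big_ord_recr /= Tkk addrC -Tk1; congr (_ + _).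
  have kS : k = k.-1.+1 by lia.
  transitivity (\sum_(i < k.-1.+1) T i 1%N); first by rewrite -kS.
  rewrite big_ord_recr /= big1 ?add0r// => i _.
  by apply: Tlow; have := ltn_ord i; rewrite /=; lia.
have ak : a k < 0 by apply: (hecke_coef_lt0 c0 c_low cE) => //; lia.
have [N0 dN0] := d_nat j; have [N1 dN1] := d_nat (j + 8)%N.
have pj : 0 < 2 ^+ j :> R by rewrite exprn_gt0.
have [ev|od] := boolP (~~ odd k).
  exfalso; have s0 : 0 < (- 16^-1) ^+ k :> R.
    by rewrite exprn_even_gt0// oppr_eq0 invr_eq0 pnatr_eq0 orbT.
  have : d j < 0 by rewrite d0 pmulr_llt0// pmulr_llt0.
  by rewrite dN0 ltrn0.
have {}od : odd k by rewrite negbK in od.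
(* From [k >= 5] on, [n < 12 * (k - 1)], hence [a (k - 1) <= 0]. In the coefficient at [j + 8] the
   summand with [j - 16 k] is then negative and the other one at most 0. *)
have [k5|k5] := leqP 5 k.
  exfalso; have sk1 : 0 < (- 16^-1) ^+ k.-1 :> R.
    rewrite exprn_even_gt0// ?oppr_eq0 ?invr_eq0 ?pnatr_eq0 ?orbT//.
    by move: od; rewrite -{1}(prednK (ltnW (ltnW k3))).
  have sk : (- 16^-1) ^+ k < 0 :> R.
    rewrite -(prednK (ltnW (ltnW k3))) exprS mulNr oppr_lt0 mulr_gt0// invr_gt0 ltr0n //.
  have ak1 : a k.-1 <= 0 by apply: (hecke_coef_le0 c0 c_low cE); lia.
  have jk : j%:R - 16 * k%:R < 0 :> R.
    by rewrite subr_lt0 -natrM ltr_nat; lia.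
  have : d (j + 8)%N < 0.
    rewrite d1 -[ltRHS]addr0; apply: ltr_leD.
      by rewrite pmulr_rlt0// mulr_gt0// nmulr_rgt0.
    by rewrite pmulr_lle0 ?exprn_gt0// mulr_le0_ge0// ltW.
  by rewrite dN1 ltrn0.
have kE : k = 3%N by have : k <> 4%N by [move=> e; rewrite e in od]; lia.
have nE : n = (24 + j)%N by rewrite nkj kE.
have ne : (n + (11 - j) = 35)%N by rewrite nE; lia.
have a3 := hecke_coef3 c0 c_low cE k3 ne.
have key : N0%:R = 2 * (24 + j)%:R * (2 * (11 - j)%N%:R * ((11 - j)%N%:R - 1) + 36) / (3 * 4096) * 2 ^+ j :> R.
  rewrite -dN0 d0 kE a3 {1}nE.
  move: ((24 + j)%:R : R) ((11 - j)%N%:R : R) (2 ^+ j : R) => *; by field.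
(* For [n = 24] the formula gives [48 * 256 / 12288 = 1]: the shadow contains the zero vector, as
   for an even lattice. *)
have [j0|j0] := posnP j; last by case: (shadow_count_not_nat j0 j8 key).
rewrite -{1}j0 dN0 key j0 (_ : _ * _ = 1 :> R) ?oner_eq0// subn0 addn0 expr0; lra.
Qed.

End Shadow.

(** * The lattice D12+ *)

Section DPlus.
Context {R : realType}.

Lemma D_plusP n (x : 'rV[R]_n) : D_plus R n x <->
  exists (w : 'rV[int]_n) (e : bool),
    x = rint w + const_mx (e%:R / 2) /\ (2 %| \sum_j w 0 j)%Z.
Proof.
have DP (y : 'rV[R]_n) : D_lattice R n y <->
    exists2 w : 'rV[int]_n, y = rint w & (2 %| \sum_j w 0 j)%Z.
  split=> [[yi [k yk]]|[w -> /dvdzP[k wk]]].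
    pose w : 'rV[int]_n := \row_j Num.floor (y 0 j).
    have yE : y = rint w by apply/rowP => j; rewrite !mxE floorK.
    exists w => //; apply/dvdzP; exists k; apply: (@intr_inj R).
    rewrite rmorph_sum /= intrM mulrC -yk yE; apply: eq_bigr => j _; by rewrite [RHS]mxE.
  split=> [j|]; first by rewrite mxE intr_int.
  exists k; transitivity ((\sum_j w 0 j)%:~R : R).
    by rewrite rmorph_sum; apply: eq_bigr => j _; rewrite mxE.
  by rewrite wk intrM mulrz_nat mulrC.
split.
  case=> [/DP[w -> we]|[y /DP[w -> we] <-]].
    by exists w, false; split=> //; apply/rowP => j; rewrite !mxE mul0r addr0.
  by exists w, true; split=> //; apply/rowP => j; rewrite !mxE mul1r.
case=> w [[] [-> we]]; [right|left].
  exists (rint w); first by apply/DP; exists w.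
  by apply/rowP => j; rewrite !mxE mul1r.
by apply/DP; exists w => //; apply/rowP => j; rewrite !mxE mul0r addr0.
Qed.

(** The rows are the vector with all entries [1/2], the vectors [e_i + e_11] for [i] from 1 to 10,
    and [2 e_11], coordinates being numbered from 0. *)
Definition D12_basis : 'M[R]_12 := \matrix_(i, j)
  if i == 0 then 2^-1 else (i == j)%:R + (j == ord_max)%:R.

Lemma mul_D12_basis (x : 'rV[R]_12) j :
  (x *m D12_basis) 0 j = x 0 0 / 2 + (j != 0)%:R * x 0 j +
    (j == ord_max)%:R * (\sum_i x 0 i - x 0 0).
Proof.
rewrite mxE (bigD1 0)//= [in RHS](bigD1 0)//= [x 0 0 + _]addrC addrK mxE eqxx.
rewrite (eq_bigr (fun i => (i == j)%:R * x 0 i + (j == ord_max)%:R * x 0 i)); last first.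
  by move=> i i0; rewrite mxE (negbTE i0) mulrC mulrDl.
rewrite big_split /= -mulr_sumr addrA; congr (_ + _ + _).
have [->|j0] := eqVneq j 0.
  by rewrite mul0r big1// => i i0; rewrite (negbTE i0) mul0r.
rewrite (bigD1 j)//= eqxx big1 ?addr0// => i /andP[_ ij].
by rewrite (negbTE ij) mul0r.
Qed.

Lemma D12_basis_unit : D12_basis \in unitmx.
Proof.
rewrite -row_free_unit -kermx_eq0; apply/eqP/row_matrixP => i; rewrite row0.
set v := row i _; have vB : v *m D12_basis = 0 by rewrite -row_mul mulmx_ker row0.
have E j := etrans (esym (mul_D12_basis v j)) (congr1 (fun u : 'rV[R]_12 => u 0 j) vB).
have v0 : v 0 0 = 0 by have := E 0; rewrite !mxE eqxx /= mul0r mul0r !addr0; lra.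
have vj j : j != 0 -> j != ord_max -> v 0 j = 0.
  move=> j0 jm; have := E j; rewrite j0 (negbTE jm) v0 [RHS]mxE !mul0r mul1r; lra.
have vm : v 0 ord_max = 0.
  have nz : (ord_max : 'I_12) != 0 by [].
  have := E ord_max; rewrite v0 nz eqxx (bigD1 ord_max)//= big1.
    by rewrite [RHS]mxE !mul1r; lra.
  by move=> j jm; have [->//|j0] := eqVneq j 0; rewrite vj.
apply/rowP => j; rewrite [RHS]mxE.
by have [->//|j0] := eqVneq j 0; have [->//|jm] := eqVneq j ord_max; rewrite vj.
Qed.

Lemma D12_lattice : is_lattice (D_plus R 12).
Proof.
exists D12_basis; first exact: D12_basis_unit.
apply/seteqP; split=> x.
- move=> /D_plusP[w [e [xE /dvdzP[s ws]]]].
  (* Solving for the coordinates gives [2 x_0] first and the differences [x_j - x_0] in the middle;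
     the last one is integral because the sum of [w] is [2 s]. *)
  pose zm : int := w 0 ord_max + 5 * w 0 0 - s.
  pose z : 'rV[int]_12 := \row_j (w 0 j - w 0 0 + (j == 0)%:R * (2 * w 0 0 + e%:R) +
    (j == ord_max)%:R * (zm - (w 0 ord_max - w 0 0))).
  exists z => //; apply/rowP => j; rewrite (mul_D12_basis (rint z)).
  have sz : \sum_i z 0 i = s * 2 - 12 * w 0 0 + (2 * w 0 0 + e%:R) + (zm - (w 0 ord_max - w 0 0)).
    under eq_bigr do rewrite mxE.
    rewrite !big_split /= ws; congr (_ + _ + _ + _).
    + by rewrite sumrN sumr_const card_ord -[w 0 0 *+ 12]mulr_natl.
    + by rewrite (bigD1 0)//= mul1r big1 ?addr0// => i i0; rewrite (negbTE i0) mul0r.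
    + by rewrite (bigD1 ord_max)//= mul1r big1 ?addr0// => i i0; rewrite (negbTE i0) mul0r.
  have rz i : (rint z : 'rV[R]_12) 0 i = (z 0 i)%:~R by rewrite mxE.
  have -> : \sum_i (rint z : 'rV[R]_12) 0 i = (\sum_i z 0 i)%:~R.
    by rewrite rmorph_sum /=; apply: eq_bigr => i _; rewrite rz.
  rewrite sz !rz xE !mxE /zm.
  have [->|j0] := eqVneq j 0.
    rewrite /= !mul1r !mul0r !addr0 subrr add0r !(intrD, intrM, intrN) mulrz_nat; by field.
  have [->|jm] := eqVneq j ord_max.
    rewrite /= !mul1r !mul0r !addr0 !(intrD, intrM, intrN) !mulrz_nat; by field.
  rewrite /= !mul1r !mul0r !addr0 !(intrD, intrM, intrN) mulrz_nat; by field.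
- case=> z _ <-; apply/D_plusP.
  have [t [e tE]] : exists t (e : bool), z 0 0 = 2 * t + e%:R.
    exists (divz (z 0 0) 2); have := divz_eq (z 0 0) 2.
    have [/eqP r|r] := boolP (modz (z 0 0) 2 == 0); [exists false|exists true]; lia.
  pose S := \sum_i z 0 i - z 0 0.
  exists (\row_j (t + (j != 0)%:R * z 0 j + (j == ord_max)%:R * S)), e; split.
    apply/rowP => j; rewrite mul_D12_basis !mxE.
    have -> : \sum_i (map_mx intr z : 'rV[R]_12) 0 i = (\sum_i z 0 i)%:~R.
      by rewrite rmorph_sum /=; apply: eq_bigr => i _; rewrite mxE.
    rewrite !(intrD, intrM, intrN) !mulrz_nat {1}tE !(intrD, intrM) mulrz_nat; by field.
  under eq_bigr do rewrite mxE.
  rewrite !big_split /= sumr_const card_ord.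
  have -> : \sum_(i < 12) (i != 0)%:R * z 0 i = S.
    rewrite /S [in RHS](bigD1 0)//= [z 0 0 + _]addrC addrK (bigD1 0)//= mul0r add0r.
    by apply: eq_bigr => i i0; rewrite i0 mul1r.
  have -> : \sum_(i < 12) (i == ord_max)%:R * S = S.
    by rewrite (bigD1 ord_max)//= mul1r big1 ?addr0// => i i0; rewrite (negbTE i0) mul0r.
  by apply/dvdzP; exists (6 * t + S); rewrite -[t *+ 12]mulr_natl; ring.
Qed.

Lemma dotp_shifted (w w' : 'rV[int]_12) (a b : R) :
  dotp (rint w + const_mx a) (rint w' + const_mx b) =
  (\sum_j w 0 j * w' 0 j)%:~R + b * (\sum_j w 0 j)%:~R + a * (\sum_j w' 0 j)%:~R + 12 * (a * b).
Proof.
rewrite /dotp !rmorph_sum /= !mulr_sumr.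
rewrite (eq_bigr (fun j => (w 0 j * w' 0 j)%:~R + b * (w 0 j)%:~R + a * (w' 0 j)%:~R + a * b)).
  by rewrite !big_split /= sumr_const card_ord -[a * b *+ 12]mulr_natl.
by move=> j _; rewrite !mxE intrM; ring.
Qed.

(** Products are integral because the half vector has norm 3. Conversely, testing against [2 e_0],
    the differences [e_j - e_0] and the half vector determines the coset of a dual vector and the
    parity of its coordinate sum. *)
Lemma D12_self_dual : D_plus R 12 = dual_lattice (D_plus R 12).
Proof.
apply/seteqP; split=> x.
- move=> /D_plusP[w [e [-> /dvdzP[s ws]]]] l /D_plusP[w' [e' [-> /dvdzP[s' ws']]]].
  rewrite dotp_shifted ws ws'.
  have -> : (\sum_j w 0 j * w' 0 j)%:~R + e'%:R / 2 * (s * 2)%:~R + e%:R / 2 * (s' * 2)%:~R +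
      12 * (e%:R / 2 * (e'%:R / 2)) =
      (\sum_j w 0 j * w' 0 j + e'%:R * s + e%:R * s' + 3 * (e%:R * e'%:R))%:~R :> R.
    by rewrite !(intrD, intrM) !mulrz_nat; field.
  exact: intr_int.
- move=> xd.
  have xint (w : 'rV[int]_12) : (2 %| \sum_j w 0 j)%Z -> dotp x (rint w) \is a Num.int.
    move=> we; apply: xd; apply/D_plusP; exists w, false; split=> //.
    by apply/rowP => j; rewrite !mxE mul0r addr0.
  have sd i : \sum_j (delta_mx 0 i : 'rV[int]_12) 0 j = 1.
    by rewrite (bigD1 i)//= mxE !eqxx big1 ?addr0// => j ji; rewrite mxE (negbTE ji) andbF.
  have dd i : dotp x (rint (delta_mx 0 i)) = x 0 i.
    rewrite /dotp (bigD1 i)//= !mxE !eqxx mulr1 big1 ?addr0// => j ji.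
    by rewrite !mxE (negbTE ji) andbF mulr0.
  have dD u v : dotp x (u + v) = dotp x u + dotp x v by rewrite !dotp_mdot mdotDr.
  have dN u : dotp x (- u) = - dotp x u by rewrite !dotp_mdot mdotNr.
  have rD (u v : 'rV[int]_12) : rint (u + v) = rint u + rint v :> 'rV[R]_12 by exact: map_mxD.
  have rN (u : 'rV[int]_12) : rint (- u) = - rint u :> 'rV[R]_12 by exact: map_mxN.
  have x0 : x 0 0 + x 0 0 \is a Num.int.
    rewrite -(dd 0) -dD -rD; apply: xint.
    by under eq_bigr do rewrite mxE; rewrite big_split /= sd.
  have xj j : x 0 j - x 0 0 \is a Num.int.
    rewrite -(dd 0) -(dd j) -dN -rN -dD -rD; apply: xint.
    under eq_bigr do rewrite mxE; rewrite big_split /= sd.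
    under eq_bigr do rewrite mxE; by rewrite sumrN sd.
  have xs : (\sum_j x 0 j) / 2 \is a Num.int.
    have := xd (const_mx (true%:R / 2)); rewrite /dotp.
    under eq_bigr do rewrite mxE mul1r; rewrite -mulr_suml; apply; apply/D_plusP.
    exists 0, true; split; first by apply/rowP => j; rewrite !mxE add0r.
    by rewrite big1// => j _; rewrite mxE.
  have [t [e tE]] : exists (t : int) (e : bool), Num.floor (x 0 0 + x 0 0) = 2 * t + e%:R.
    set m := Num.floor _; exists (m %/ 2)%Z; have := divz_eq m 2.
    by have [/eqP r|r] := boolP ((m %% 2)%Z == 0); [exists false|exists true]; lia.
  have x0E : x 0 0 = t%:~R + e%:R / 2.
    have := floorK x0; rewrite tE intrD intrM mulrz_nat => h; lra.
  apply/D_plusP; exists (\row_j (Num.floor (x 0 j - x 0 0) + t)), e.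
  have wE j : (Num.floor (x 0 j - x 0 0) + t)%:~R = x 0 j - e%:R / 2 :> R.
    by rewrite intrD (floorK (xj j)) x0E; ring.
  split; first by apply/rowP => j; rewrite !mxE wE subrK.
  apply/dvdzP; exists (Num.floor ((\sum_j x 0 j) / 2) - 3 * e%:R); apply: (@intr_inj R).
  rewrite rmorph_sum /= intrM intrD intrN (floorK xs) intrM mulrz_nat.
  under eq_bigr do rewrite mxE wE.
  by rewrite big_split /= sumrN sumr_const card_ord -[(e%:R / 2) *+ 12]mulr_natl; field.
Qed.

Lemma D12_plus_unimodular : unimodular (D_plus R 12).
Proof. by split; [exact: D12_lattice|exact: D12_self_dual]. Qed.

(** A vector with half-integral entries has norm at least [12 / 4]; an integral one has the parity
    of its coordinate sum, which is even. *)
Lemma D12_plus_no_norm1 : no_vector_of_norm (D_plus R 12) 1.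
Proof.
move=> x /D_plusP[w [[] [-> we]]]; apply/eqP; rewrite /sqnorm.
  rewrite /dotp => e; have : 3 <= 1 :> R.
    rewrite -[leRHS]e (_ : 3 = \sum_(i < 12) 4^-1 :> R); last first.
      by rewrite sumr_const card_ord -[4^-1 *+ 12]mulr_natl; field.
    apply: ler_sum => i _; rewrite !mxE mul1r.
    have -> : ((w 0 i)%:~R + 2^-1) * ((w 0 i)%:~R + 2^-1) = (w 0 i * (w 0 i + 1))%:~R + 4^-1 :> R.
      by rewrite intrM intrD; field.
    by rewrite lerDr ler0z; nia.
  by move=> h; lra.
rewrite dotp_shifted mul0r !mul0r mulr0 !addr0 => h.
have e : \sum_j w 0 j * w 0 j = 1 by apply: (@intr_inj R).
have : (2 %| \sum_j w 0 j * w 0 j)%Z.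
  have -> : \sum_j w 0 j * w 0 j = \sum_j w 0 j * (w 0 j - 1) + \sum_j w 0 j.
    rewrite -big_split /=; apply: eq_bigr => j _; ring.
  rewrite rpredD//; apply: rpred_sum => j _; move: (w 0 j) => v.
  have [m [->|->]] : exists m : int, v = 2 * m \/ v = 2 * m + 1 by exists (divz v 2); lia.
    by rewrite -mulrA dvdz_mulr.
  by rewrite addrK mulrC -mulrA dvdz_mulr.
by rewrite e.
Qed.

End DPlus.

(** * The secrecy function in terms of the Hauptmodul *)

Section SecrecyGain.
Context {R : realType}.

#[local] Opaque fev phi psi phi_inv psi_inv hauptz hauptW theta2 phi_pm.

Lemma nome_lt1 (y : R) : 0 < y -> `|nome y| < 1.
Proof.
move=> y0; rewrite (ger0_norm (expR_ge0 _)) expR_lt1 oppr_lt0.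
exact: mulr_gt0 (pi_gt0 R) y0.
Qed.

(** Its product with the value of [hauptW * phi ^+ 12], a series with nonnegative coefficients, is
    the positive number [q]. *)
Lemma hauptz_ge0 (y : R) : 0 < y -> 0 <= fev hauptz (nome y).
Proof.
move=> y0; have n1 := nome_lt1 y0; have q0 : 0 < nome y := expR_gt0 _.
have cW : conv (hauptW * phi ^+ 12 : fps R) by convs.
have := congr1 (fev^~ (nome y)) (hauptzW (R := R)); cbv beta.
rewrite (fevM n1 (conv_hauptz (R := R)) cW) fev_fX => e.
have W0 : 0 <= fev (hauptW * phi ^+ 12) (nome y).
  apply: tsum_ge0 => i; apply: mulr_ge0; last by apply: exprn_ge0; exact: ltW.
  by apply: nonnegM; [exact: hauptW_ge0|apply: nonnegX; exact: nonneg_phi].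
move: W0 e; move: (fev hauptz _) (fev (_ * _) _) => z w w0 e.
by rewrite leNgt; apply/negP => z0; move: q0; rewrite -e ltNge mulr_le0_ge0// ltW.
Qed.

Lemma hauptz_le (y : R) : 0 < y -> fev hauptz (nome y) <= 64^-1.
Proof.
move=> y0; have n1 := nome_lt1 y0.
have := fev_hauptz_phi n1; have := fev_phi_neq0 n1.
move: (fev hauptz _) (fev phi (nome y)) (fev phi (- nome y)) => z A B A0 e.
have A8 : 0 < A ^+ 8 by rewrite exprn_even_gt0// A0.
rewrite -(ler_pM2r A8) -(ler_pM2l (ltr0n R 16 : _ = true)) mulrA e.
have := sqr_ge0 (A ^+ 4 - 2 * B ^+ 4).
have -> : A ^+ 8 = A ^+ 4 * A ^+ 4 by rewrite -exprD.
by move: (A ^+ 4) (B ^+ 4) => a b; lra.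
Qed.

(** At the fixed point [y = 1] of the inversion the value of phi at [-q] is theta_2, so Jacobi's
    quartic identity becomes [phi(q)^4 = 2 phi(-q)^4], the case of equality in [hauptz_le]. *)
Lemma hauptz_1 : fev hauptz (nome 1) = 64^-1 :> R.
Proof.
have n1 := nome_lt1 (ltr01 : 0 < 1 :> R).
have := fev_hauptz_phi n1; have := fev_phi_neq0 n1.
have := theta2_quartic (ltr01 : 0 < 1 :> R).
have [_ _ _ /(_ 1 ltr01)] := modular_pair_phi (R := R).
rewrite sqrtr1 invr1 expr1n mul1r !mulr1 /nome !mulr1 -theta2E => <-.
move: (fev hauptz _) (fev phi (expR _)) (fev phi (- expR _)) => z A B e A0 h.
have A8 : 16 * A ^+ 8 != 0 by rewrite mulf_neq0 ?pnatr_eq0// expf_neq0.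
apply: (mulIf A8); rewrite mulrCA mulrA h.
have -> : A ^+ 8 = A ^+ 4 * A ^+ 4 by rewrite -exprD.
move: (A ^+ 4) (B ^+ 4) e => a b e; have -> : a = 2 * b by lra.
by field.
Qed.

(* The expansion of theta_L / theta_3^n in powers of the Hauptmodul z. *)
Definition gain_poly (n : nat) (z : R) : R :=
  1 - 2 * n%:R * z - (if (n < 16)%N then 0 else 2 * n%:R * (23 - n)%N%:R) * z ^+ 2.

(** Positivity at the minimum [z = 1/64] is what allows the monotonicity of the polynomial to pass
    to its inverse. In the quadratic case [n <= 23] and [23 - n <= 7] are enough. *)
Lemma gain_poly_gt0 n : (n < 24)%N -> 0 < gain_poly n 64^-1.
Proof.
move=> n24; rewrite /gain_poly; have x0 : 0 <= n%:R :> R by [].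
have x23 : n%:R <= 23 :> R by rewrite ler_nat.
case: ltnP => n16; first by lra.
have u0 : 0 <= (23 - n)%N%:R :> R by [].
have u7 : (23 - n)%N%:R <= 7 :> R by rewrite ler_nat; lia.
have := ler_pM x0 u0 x23 u7; move: (n%:R : R) ((23 - n)%N%:R : R) x23 => x u x23 h; lra.
Qed.

Lemma gain_poly_le n (z w : R) : 0 <= z -> z <= w -> gain_poly n w <= gain_poly n z.
Proof.
move=> z0 zw; rewrite /gain_poly; apply: lerB.
  by rewrite lerB// ler_wpM2l// mulr_ge0.
apply: ler_wpM2l; first by case: ifP => // _; rewrite !mulr_ge0.
by rewrite lerXn2r// nnegrE// (le_trans z0).
Qed.

Variables (n : nat) (L : set 'rV[R]_n).
Hypotheses (uL : unimodular L) (n8 : (8 <= n)%N) (n24 : (n < 24)%N).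
Hypothesis L_low : forall i, (0 < i)%N -> (i <= n %/ 8)%N -> no_vector_of_norm L i%:R.

Lemma secrecy_gain_poly y : 0 < y -> secrecy L y = (gain_poly n (fev hauptz (nome y)))^-1.
Proof.
move=> y0; have n1 := nome_lt1 y0.
have [c [d [cd thE c0 clow _]]] := unimodular_theta uL.
have c_low i : (0 < i)%N -> (i <= n %/ 8)%N -> c i = 0.
  by move=> i0 ik; apply: clow => //; exact: L_low.
have [a [cE _]] := hecke cd; have [cc _ _ _] := cd.
have cU : conv (phi_inv ^+ n : fps R) by convs.
have cphi : conv (phi : fps R) := conv_phi.
have A0 : fev phi (nome y) ^+ n != 0 by rewrite expf_neq0// fev_phi_neq0.
have FE : fev c (nome y) = fev (c * phi_inv ^+ n) (nome y) * fev phi (nome y) ^+ n.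
  have cfe : c = c * phi_inv ^+ n * phi ^+ n.
    by rewrite -mulrA -(exprMn n) [X in X ^+ n]mulrC phi_invK expr1n mulr1.
  have := congr1 (fev^~ (nome y)) cfe; cbv beta.
  by rewrite (fevM n1 (convM cc cU) (convX n cphi)) (fevX n n1 cphi).
have PE : fev (c * phi_inv ^+ n) (nome y) = gain_poly n (fev hauptz (nome y)).
  have cz := conv_hauptz (R := R).
  have czr r : conv (fC (a r) * hauptz ^+ r) by exact: convM (conv_fC _) (convX r cz).
  have a0 := hecke_coef0 c0 cE.
  have k1 : (0 < n %/ 8)%N by rewrite divn_gt0.
  have a1 := hecke_coef1 c0 c_low cE k1.
  rewrite cE (fev_sum _ n1) => [|r]; last exact: czr.
  under eq_bigr do rewrite (fevM n1 (conv_fC _) (convX _ cz)) fev_fC (fevX _ n1 cz).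
  rewrite /gain_poly; case: ltnP => n16.
    have -> : (n %/ 8 = 1)%N by lia.
    rewrite !big_ord_recr big_ord0 /= a0 a1; ring.
  have k2 : (1 < n %/ 8)%N by rewrite leq_divRL.
  have a2 := hecke_coef2 c0 c_low cE k2 n24.
  have -> : (n %/ 8 = 2)%N by lia.
  rewrite !big_ord_recr big_ord0 /= a0 a1 a2; ring.
rewrite /secrecy theta3_phiE// thE// FE PE invfM mulrCA divff// mulr1 //.
Qed.

Theorem low_dim_secrecy :
  secrecy_max_at L 1 /\ is_secrecy_gain L (gain_poly n 64^-1)^-1.
Proof.
have s1 : secrecy L 1 = (gain_poly n 64^-1)^-1 by rewrite secrecy_gain_poly// hauptz_1.
have le y : 0 < y -> secrecy L y <= (gain_poly n 64^-1)^-1.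
  move=> y0; rewrite secrecy_gain_poly//.
  have h := gain_poly_le n (hauptz_ge0 y0) (hauptz_le y0).
  have p := gain_poly_gt0 n24; move: h; move: (fev hauptz _) => z h.
  by rewrite lef_pV2 ?posrE ?p ?(lt_le_trans p h).
split; first by split; [exact: ltr01|move=> y y0; rewrite s1; exact: le].
by split; [exists 1; [exact: ltr01|exact: s1]|exact: le].
Qed.

End SecrecyGain.

(** Extremality enters through the absence of the norms [1, ..., n %/ 8]. For the named lattices
    [n %/ 8] is 1, 1, 1 and 2, matching the norms that their predicates exclude. *)
Theorem mainTheorem2 (R : realType) :
  (forall (n : nat) (L : set 'rV[R]_n),
     (10 <= n)%N -> odd_unimodular L -> extremal L -> secrecy_max_at L 1) /\
  (secrecy_max_at (D_plus R 12) 1 /\ is_secrecy_gain (D_plus R 12) (8 / 5)) /\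
  (forall L : set 'rV[R]_12,
     is_D12_plus L -> secrecy_max_at L 1 /\ is_secrecy_gain L (8 / 5)) /\
  (forall L : set 'rV[R]_14,
     is_E7E7_plus L -> secrecy_max_at L 1 /\ is_secrecy_gain L (16 / 9)) /\
  (forall L : set 'rV[R]_15,
     is_A15_plus L -> secrecy_max_at L 1 /\ is_secrecy_gain L (32 / 17)) /\
  (forall L : set 'rV[R]_23,
     is_O23 L -> secrecy_max_at L 1 /\ is_secrecy_gain L (32 / 9)).
Proof.
have D12 (L : set 'rV[R]_12) : is_D12_plus L ->
    secrecy_max_at L 1 /\ is_secrecy_gain L (8 / 5).
  move=> [uL L1]; have -> : 8 / 5 = (gain_poly 12 64^-1)^-1 :> R.
    by rewrite /gain_poly /=; field.
  apply: low_dim_secrecy => // i i0 i1.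
  by have -> : i = 1%N by lia.
split=> [n L n10 [uL oL] [_ eL]|].
  have L_low i : (0 < i)%N -> (i <= n %/ 8)%N -> no_vector_of_norm L i%:R.
    move=> i0 ik x Lx; apply/eqP => xi.
    have x0 : x != 0.
      apply/eqP => x0; move: xi; rewrite x0 /sqnorm /dotp big1 => [/eqP|j _].
        by rewrite eq_sym pnatr_eq0 -leqn0 leqNgt i0.
      by rewrite mxE mul0r.
    by have := eL x Lx x0; rewrite xi ler_nat ltnNge ik.
  have [n24|n24] := ltnP n 24.
    by apply: (low_dim_secrecy uL _ n24 L_low).1; apply: leq_trans n10.
  (* From dimension 24 on the shadow would contain the zero vector, which makes the lattice even,
     contrary to the hypothesis. *)
  exfalso; have [c [d [cd _ c0 clow [dnat dE]]]] := unimodular_theta uL.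
  apply: oL; apply: dE; apply: (shadow_coef0_neq0 cd c0 _ dnat n24) => i i0 ik.
  by apply: clow => //; exact: L_low.
split.
  by apply: D12; split; [exact: D12_plus_unimodular|exact: D12_plus_no_norm1].
split; first exact: D12.
split; [|split] => L.
- move=> [uL L1]; have -> : 16 / 9 = (gain_poly 14 64^-1)^-1 :> R.
    by rewrite /gain_poly /=; field.
  apply: low_dim_secrecy => // i i0 i1.
  by have -> : i = 1%N by lia.
- move=> [uL L1]; have -> : 32 / 17 = (gain_poly 15 64^-1)^-1 :> R.
    by rewrite /gain_poly /=; field.
  apply: low_dim_secrecy => // i i0 i1.
  by have -> : i = 1%N by lia.
- move=> [uL L1 L2]; have -> : 32 / 9 = (gain_poly 23 64^-1)^-1 :> R.
    have -> : gain_poly 23 64^-1 = 9 / 32 :> R; last by rewrite invf_div.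
    have lt : (23 < 16)%N = false by [].
    rewrite /gain_poly lt subnn mulr0n mulr0 mul0r subr0; lra.
  apply: low_dim_secrecy => // i i0 i1.
  have : i = 1%N \/ i = 2%N by lia.
  by case=> ->.
Qed.
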